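(* Fix $g\ge2$ and put $n=g-1$. Isomorphism classes of connected étale cyclic triple covers of hyperelliptic genus-$g$ curves are naturally equivalent to isomorphism classes of simply branched degree-three maps $h:C_0\longrightarrow\mathbb P^1$ with $g(C_0)=n$.
   Context: Curves are smooth, projective and connected, and $g(C_0)$ denotes the genus of $C_0$. An étale cyclic triple cover of a curve $C$ is an étale Galois cover $\widetilde C\to C$ of degree three with deck group $\mathbb Z/3\mathbb Z$. Covers $\widetilde C\to C$, and likewise maps $h:C_0\to\mathbb P^1$, are considered modulo isomorphisms of source and target commuting with the maps. A degree-three map $h:C_0\to\mathbb P^1$ is simply branched if over each branch point there is exactly one ramification point and it has ramification index two (equivalently, every fiber contains at least two distinct points). *)

(* Defs.v *)
From HB Require Import structures.
From mathcomp Require Import all_boot all_order all_fingroup all_algebra.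
From mathcomp Require Import zify.
From mathcomp Require Import generic_quotient.
From mathcomp.multinomials Require Import freeg.
From Stdlib Require Classical_Prop.

Set Implicit Arguments.
Unset Strict Implicit.
Unset Printing Implicit Defensive.

Import Order.TTheory GRing.Theory Num.Theory.
Local Open Scope ring_scope.

(* Smooth projective connected curves over an algebraically closed field k.

   As there is no scheme theory available, a curve is given by the data that
   its structure sheaf amounts to in dimension one (Hartshorne, I.6 and II.6):
   the set of its closed points, its field K of rational functions, and for each
   point p the order of vanishing ord_p : K^* -> Z, so that the stalk at p is
   {f | f = 0 or ord_p f >= 0}, and O(U) is the intersection of the stalks at
   the points of U (the open sets being the empty set and the complements of
   the finite sets).
   - integral of dimension one, of finite type: K is a finitely generated field
     of transcendence degree one over k;
   - smooth: the stalks are discrete valuation rings;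
   - separated and proper (valuative criterion): every discrete valuation ring
     of K/k is the stalk at exactly one point.  For smooth curves, proper and
     projective are the same.
   A smooth connected curve is irreducible, so connectedness is included. *)

Section FunctionField.
Variables (k : closedFieldType) (K : fieldType) (cst : {rmorphism k -> K}).

Definition transcendental_elt (x : K) : Prop :=
  forall P : {poly k}, P != 0 -> (map_poly cst P).[x] != 0.

(* [K : k(x)] is finite for some transcendental x: the denominators are cleared
   in the expression of f as a k(x)-combination of the b_i *)
Definition function_field : Prop :=
  exists x : K, transcendental_elt x /\
  exists (m : nat) (b : 'I_m -> K), forall f : K,
    exists (Q : {poly k}) (P : 'I_m -> {poly k}), Q != 0 /\
      (map_poly cst Q).[x] * f = \sum_(i < m) (map_poly cst (P i)).[x] * b i.

(* normalized discrete valuation of K/k; the value v 0 is irrelevant *)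
Record discrete_valuation (v : K -> int) : Prop := DiscreteValuation {
  valuationM : forall f h, f != 0 -> h != 0 -> v (f * h) = v f + v h;
  valuationD : forall f h, f != 0 -> h != 0 -> f + h != 0 ->
    Num.min (v f) (v h) <= v (f + h);
  valuation_cst : forall a : k, a != 0 -> v (cst a) = 0;
  valuation_uniformizer : exists t, t != 0 /\ v t = 1
}.

End FunctionField.

Record curve (k : closedFieldType) := Curve {
  point : choiceType;
  ratfun : fieldType;
  cst : {rmorphism k -> ratfun};
  ord : point -> ratfun -> int;
  curve_function_field : function_field cst;
  curve_smooth : forall p, discrete_valuation cst (ord p);
  curve_separated : forall p q,
    (forall f, f != 0 -> ord p f = ord q f) -> p = q;
  curve_proper : forall v, discrete_valuation cst v ->
    exists p, forall f, f != 0 -> ord p f = v f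
}.

Arguments cst {k} c.
Arguments ord {k c} p f.

(* f lies in the local ring at p, resp. in its maximal ideal *)
Definition regular_at (k : closedFieldType) (X : curve k) (p : point X)
  (f : ratfun X) : bool := (f == 0) || (0 <= ord p f).
Definition vanishes_at (k : closedFieldType) (X : curve k) (p : point X)
  (f : ratfun X) : bool := (f == 0) || (0 < ord p f).

(* Nonconstant morphisms X -> Y over k: a map on points together with the
   pullback of rational functions, which maps local rings to local rings by
   local homomorphisms. *)
Record mor (k : closedFieldType) (X Y : curve k) := Mor {
  on_points :> point X -> point Y;
  pullback : {rmorphism ratfun Y -> ratfun X};
  pullback_cst : forall a, pullback (cst Y a) = cst X a;
  pullback_regular : forall p f,
    regular_at (on_points p) f -> regular_at p (pullback f);
  pullback_local : forall p f,
    vanishes_at (on_points p) f -> vanishes_at p (pullback f)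
}.

Section Morphisms.
Variable k : closedFieldType.
Implicit Types X Y Z : curve k.

Definition mor_id X : mor X X :=
  @Mor k X X id idfun (fun _ => erefl) (fun _ _ h => h) (fun _ _ h => h).

Section Comp.
Variables (X Y Z : curve k) (u : mor Y Z) (v : mor X Y).

Definition mor_comp : mor X Z.
Proof.
refine (@Mor k X Z (u \o v) (pullback v \o pullback u) _ _ _) => [a|p f h|p f h].
- by rewrite /= !pullback_cst.
- exact/pullback_regular/pullback_regular.
- exact/pullback_local/pullback_local.
Defined.
End Comp.

Definition mor_eq X Y (u v : mor X Y) : Prop :=
  u =1 v /\ pullback u =1 pullback v.

Definition is_iso X Y (u : mor X Y) : Prop :=
  exists v : mor Y X,
    mor_eq (mor_comp v u) (mor_id X) /\ mor_eq (mor_comp u v) (mor_id Y).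

(* [k(X) : k(Y)] = n *)
Definition has_degree X Y (u : mor X Y) (n : nat) : Prop :=
  exists b : 'I_n -> ratfun X, forall f : ratfun X,
    exists! c : 'rV[ratfun Y]_n, f = \sum_(i < n) pullback u (c 0 i) * b i.

Definition ramification_index X Y (u : mor X Y) (p : point X) (e : nat) : Prop :=
  exists t : ratfun Y,
    [/\ t != 0, ord (u p) t = 1 & ord p (pullback u t) = e%:Z].

(* Nonconstant morphisms of smooth curves are flat and the residue fields are all
   equal to k, so that étale means that the ramification indices are 1. *)
Definition etale X Y (u : mor X Y) : Prop :=
  forall p : point X, ramification_index u p 1.

Definition ramified_at X Y (u : mor X Y) (p : point X) : Prop :=
  ~ ramification_index u p 1.

Definition deck X Y (u : mor X Y) (s : mor X X) : Prop :=
  is_iso s /\ mor_eq (mor_comp u s) u.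

Definition galois_with (G : finGroupType) X Y (u : mor X Y) : Prop :=
  has_degree u #|G| /\
  exists rho : G -> mor X X,
    [/\ forall a, deck u (rho a),
        forall a b, mor_eq (rho (a * b)%g) (mor_comp (rho a) (rho b)),
        forall a b, mor_eq (rho a) (rho b) -> a = b
      & forall s, deck u s -> exists a, mor_eq s (rho a)].

(* L(D) = H^0(X, O(D)) *)
Definition riemann_roch_space X (D : {freeg (point X)}) (f : ratfun X) : Prop :=
  f = 0 \/ forall p : point X, - coeff p D <= ord p f.

Definition has_dim X (L : ratfun X -> Prop) (d : nat) : Prop :=
  exists b : 'I_d -> ratfun X, (forall i, L (b i)) /\
    forall f, L f ->
      exists! c : 'rV[k]_d, f = \sum_(i < d) cst X (c 0 i) * b i.

(* The genus as in Riemann's theorem: the maximum of deg D + 1 - l(D) over all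
   divisors D (Stichtenoth, Definition 1.4.15), i.e. dim H^1(X, O_X). *)
Definition has_genus X (g : nat) : Prop :=
  (forall (D : {freeg (point X)}) (l : nat),
     has_dim (riemann_roch_space D) l -> deg D + 1 - l%:Z <= g%:Z) /\
  (exists (D : {freeg (point X)}) (l : nat),
     has_dim (riemann_roch_space D) l /\ deg D + 1 - l%:Z = g%:Z).

End Morphisms.

(* The projective line: its points are the elements of k and infinity (None), and
   its rational functions are the elements of k(x). *)
Section ProjectiveLine.
Variable k : closedFieldType.
Local Notation kx := {fraction {poly k}}.
Local Notation "x %:F" := (@FracField.tofrac _ x).
Implicit Types (a : option k) (P Q : {poly k}) (f h : kx).

Definition P1_cst : {rmorphism k -> kx} := @FracField.tofrac {poly k} \o polyC.

Definition P1_poly_ord a P : int :=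
  if a is Some c then (mup c P)%:Z else 1 - (size P)%:Z.

Definition P1_ord a f : int :=
  P1_poly_ord a \n_(repr f) - P1_poly_ord a \d_(repr f).

Lemma P1_poly_ordM a P Q : P != 0 -> Q != 0 ->
  P1_poly_ord a (P * Q) = P1_poly_ord a P + P1_poly_ord a Q.
Proof.
case: a => [c|] P0 Q0 /=; first by rewrite mupM // PoszD.
rewrite size_mul //.
have := P0; have := Q0; rewrite -!size_poly_gt0.
by case: (size P) => // m; case: (size Q) => // n _ _; rewrite addnS /=; lia.
Qed.

Lemma P1_poly_ordD a P Q : P != 0 -> Q != 0 -> P + Q != 0 ->
  Num.min (P1_poly_ord a P) (P1_poly_ord a Q) <= P1_poly_ord a (P + Q).
Proof.
case: a => [c|] P0 Q0 PQ0 /=.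
  have : (minn (mup c P) (mup c Q) <= mup c (P + Q))%N.
    by rewrite mup_geq // dvdp_add // -mup_geq // ?geq_minl ?geq_minr.
  by lia.
have := size_polyD P Q; move: (size _) (size _) (size _) => x y z.
by rewrite ge_min; lia.
Qed.

Lemma fracE f : f = (\n_(repr f))%:F / (\d_(repr f))%:F.
Proof.
have d0 : (\d_(repr f))%:F != 0 :> kx by rewrite tofrac_eq0 denom_ratioP.
apply: (canRL (mulfK d0)).
rewrite -{1}[f]reprK; move: (repr f) d0 => r _.
unlock FracField.tofrac; rewrite -[LHS]FracField.pi_mul; apply/eqmodP.
rewrite /= FracField.equivfE /FracField.mulf !numden_Ratio ?oner_eq0 //.
  by rewrite !mulr1 mulrC.
all: by rewrite mulr1 denom_ratioP.
Qed.

Lemma P1_ordE a P Q : P != 0 -> Q != 0 ->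
  P1_ord a (P%:F / Q%:F) = P1_poly_ord a P - P1_poly_ord a Q.
Proof.
move=> P0 Q0; have [f fPQ] : exists f, f = P%:F / Q%:F by eexists.
rewrite -fPQ; have fE := fracE f.
have D0 : \d_(repr f) != 0 by apply: denom_ratioP.
have f0 : f != 0 by rewrite fPQ mulf_neq0 ?invr_eq0 ?tofrac_eq0.
have N0 : \n_(repr f) != 0.
  by apply: contraNneq f0 => N0; rewrite fE N0 tofrac0 mul0r.
have /eqP : P * \d_(repr f) = \n_(repr f) * Q.
  apply/eqP; rewrite -tofrac_eq !tofracM; apply/eqP.
  by apply/eqP; rewrite -eqr_div ?tofrac_eq0 // -fPQ -fE.
move=> /eqP/(congr1 (P1_poly_ord a)); rewrite !P1_poly_ordM // /P1_ord.
by lia.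
Qed.

Variant fracd_spec f : kx -> Prop :=
  FracdSpec P Q of P != 0 & Q != 0 : fracd_spec f (P%:F / Q%:F).

Lemma fracdP f : f != 0 -> fracd_spec f f.
Proof.
move=> f0; rewrite {2}[f]fracE; constructor; last exact: denom_ratioP.
by apply: contraNneq f0 => N0; rewrite [f]fracE N0 tofrac0 mul0r.
Qed.

Lemma P1_ord_poly a P : P != 0 -> P1_ord a P%:F = P1_poly_ord a P.
Proof.
move=> P0; rewrite -[P%:F]divr1 -tofrac1 P1_ordE ?oner_eq0 //.
case: a => [c|] /=; last by rewrite size_poly1 subrr subr0.
by rewrite [mup c 1]mupNroot ?root1 // subr0.
Qed.

Lemma P1_function_field : function_field P1_cst.
Proof.
have hE P : (map_poly P1_cst P).['X%:F] = P%:F.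
  have -> : map_poly P1_cst P = map_poly (@FracField.tofrac _) (map_poly polyC P).
    by rewrite -map_poly_comp.
  rewrite horner_map /=; congr (@FracField.tofrac _ _); exact: comp_polyXr.
exists 'X%:F; split; first by move=> P P0; rewrite hE tofrac_eq0.
exists 1%N, (fun=> 1) => f.
exists \d_(repr f), (fun=> \n_(repr f)); split; first exact: denom_ratioP.
rewrite big_ord1 !hE mulr1 {2}[f]fracE mulrC divfK //.
by rewrite tofrac_eq0 denom_ratioP.
Qed.

Lemma P1_ordM a f h : f != 0 -> h != 0 ->
  P1_ord a (f * h) = P1_ord a f + P1_ord a h.
Proof.
move=> /fracdP[P Q P0 Q0] /fracdP[P' Q' P'0 Q'0].
rewrite mulf_div -!tofracM !P1_ordE ?mulf_neq0 // !P1_poly_ordM //.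
by lia.
Qed.

Lemma P1_valuation a : discrete_valuation P1_cst (P1_ord a).
Proof.
split.
- exact: P1_ordM.
- move=> _ _ /fracdP[P Q P0 Q0] /fracdP[P' Q' P'0 Q'0].
  rewrite addf_div ?tofrac_eq0 // -!tofracM -tofracD => s0.
  have N0 : P * Q' + P' * Q != 0.
    by apply: contraNneq s0 => ->; rewrite tofrac0 mul0r.
  rewrite !P1_ordE ?mulf_neq0 // P1_poly_ordM //.
  have := @P1_poly_ordD a _ _ _ _ N0; rewrite !mulf_neq0 // => /(_ isT isT).
  rewrite !P1_poly_ordM //; move: (P1_poly_ord a (_ + _)) => s.
  move: (P1_poly_ord a P) (P1_poly_ord a Q) => x y.
  move: (P1_poly_ord a P') (P1_poly_ord a Q') => x' y'.
  by rewrite !ge_min => /orP[h|h]; apply/orP; [left|right]; lia.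
- move=> c c0; rewrite /= P1_ord_poly ?polyC_eq0 //.
  case: a => [d|] /=; last by rewrite size_polyC c0.
  by rewrite mupNroot // rootC.
- case: a => [c|].
    exists ('X - c%:P)%:F; split; first by rewrite tofrac_eq0 polyXsubC_eq0.
    rewrite P1_ord_poly ?polyXsubC_eq0 //= -['X - _]expr1 mup_XsubCX.
    by rewrite eqxx.
  exists (1%:F / 'X%:F).
  rewrite mulf_neq0 ?invr_eq0 ?tofrac_eq0 ?oner_eq0 ?polyX_eq0 //.
  by rewrite P1_ordE ?oner_eq0 ?polyX_eq0 //= size_poly1 size_polyX.
Qed.

Lemma P1_ord_XsubC a c :
  P1_ord a ('X - c%:P)%:F = if a is Some d then (c == d)%:Z else -1.
Proof.
rewrite P1_ord_poly ?polyXsubC_eq0 //; case: a => [d|] /=.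
  by rewrite -['X - _]expr1 mup_XsubCX; case: eqP.
by rewrite size_XsubC.
Qed.

Lemma P1_separated a b : (forall f, f != 0 -> P1_ord a f = P1_ord b f) -> a = b.
Proof.
have X0 c : ('X - c%:P)%:F != 0 :> kx by rewrite tofrac_eq0 polyXsubC_eq0.
case: a b => [a|] [b|] // ab.
- by have := ab _ (X0 a); rewrite !P1_ord_XsubC eqxx; case: eqP => [->|].
- by have := ab _ (X0 a); rewrite !P1_ord_XsubC eqxx.
- by have := ab _ (X0 b); rewrite !P1_ord_XsubC eqxx.
Qed.

Lemma P1_valuation_ext (v w : kx -> int) (e : int) :
  discrete_valuation P1_cst v -> discrete_valuation P1_cst w ->
  (forall c, v ('X - c%:P)%:F = e * w ('X - c%:P)%:F) ->
  forall f, f != 0 -> v f = e * w f.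
Proof.
move=> Hv Hw vw.
have vwP P : P != 0 -> v P%:F = e * w P%:F.
  move=> P0; have [s sE] := closed_field_poly_normal P.
  have l0 : lead_coef P != 0 by rewrite lead_coef_eq0.
  rewrite sE -mul_polyC tofracM.
  have p0 (t : seq k) : (\prod_(z <- t) ('X - z%:P))%:F != 0 :> kx.
    by rewrite tofrac_eq0 monic_neq0 // monic_prod_XsubC.
  have c0 : (lead_coef P)%:P%:F != 0 :> kx by rewrite tofrac_eq0 polyC_eq0.
  rewrite (valuationM Hv c0 (p0 s)) (valuationM Hw c0 (p0 s)) mulrDr.
  have -> : v (lead_coef P)%:P%:F = 0 by exact: (valuation_cst Hv l0).
  have -> : w (lead_coef P)%:P%:F = 0 by exact: (valuation_cst Hw l0).
  rewrite mulr0; congr (_ + _); elim: s {sE} => [|z s IH].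
    have one0 : (1 : k) != 0 := oner_neq0 k.
    rewrite big_nil.
    have -> : v (1 : {poly k})%:F = 0 by exact: (valuation_cst Hv one0).
    have -> : w (1 : {poly k})%:F = 0 by exact: (valuation_cst Hw one0).
    by rewrite mulr0.
  have z0 : ('X - z%:P)%:F != 0 :> kx by rewrite tofrac_eq0 polyXsubC_eq0.
  rewrite big_cons tofracM (valuationM Hv z0 (p0 s)) (valuationM Hw z0 (p0 s)).
  by rewrite mulrDr IH vw.
move=> f /[dup] f0 /fracdP; case=> P Q P0 Q0.
have PF : P%:F != 0 :> kx by rewrite tofrac_eq0.
have QF : Q%:F != 0 :> kx by rewrite tofrac_eq0.
have g0 : P%:F / Q%:F != 0 := mulf_neq0 PF (invr_neq0 QF).
have := vwP P P0; rewrite -{1 2}(divfK QF P%:F).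
by rewrite (valuationM Hv g0 QF) (valuationM Hw g0 QF) (vwP Q Q0) mulrDr => /addIr.
Qed.

Lemma P1_proper (v : kx -> int) : discrete_valuation P1_cst v ->
  exists a, forall f, f != 0 -> P1_ord a f = v f.
Proof.
move=> Hv.
have X0 c : ('X - c%:P)%:F != 0 :> kx by rewrite tofrac_eq0 polyXsubC_eq0.
have shift c d : c != d ->
    Num.min (v ('X - c%:P)%:F) 0 <= v ('X - d%:P)%:F.
  move=> cd; have e0 : c - d != 0 by rewrite subr_eq0.
  have E : ('X - d%:P)%:F = ('X - c%:P)%:F + P1_cst (c - d).
    by rewrite /= -tofracD polyCB addrA subrK.
  have C0 : P1_cst (c - d) != 0 by rewrite fmorph_eq0.
  have := valuationD Hv (X0 c) C0; rewrite -E => /(_ (X0 d)).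
  by rewrite (valuation_cst Hv e0).
have shift0 c d : c != d -> 0 < v ('X - c%:P)%:F -> v ('X - d%:P)%:F = 0.
  move=> cd vc; have dc : d != c by rewrite eq_sym.
  have := shift _ _ cd.
  suff : v ('X - d%:P)%:F <= 0 by lia.
  have e0 : c - d != 0 by rewrite subr_eq0.
  have E : P1_cst (c - d) = ('X - d%:P)%:F - ('X - c%:P)%:F.
    by rewrite /= -tofracB opprB [in RHS]addrC subrKA polyCB.
  have n1 : (-1 : k) != 0 by rewrite oppr_eq0 oner_eq0.
  have N1 : P1_cst (-1) != 0 by rewrite fmorph_eq0.
  have mE : - ('X - c%:P)%:F = P1_cst (-1) * ('X - c%:P)%:F.
    by rewrite rmorphN1 mulN1r.
  have m0 : - ('X - c%:P)%:F != 0 :> kx by rewrite oppr_eq0; apply: X0.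
  have m1 : v (- ('X - c%:P)%:F) = v ('X - c%:P)%:F.
    by rewrite mE (valuationM Hv N1 (X0 c)) (valuation_cst Hv n1) add0r.
  have s0 : ('X - d%:P)%:F + (- ('X - c%:P)%:F) != 0 :> kx.
    by rewrite -E fmorph_eq0.
  have := valuationD Hv (X0 d) m0 s0.
  by rewrite -E m1 (valuation_cst Hv e0); lia.
have key a (e : int) : 0 <= e ->
    (forall c, v ('X - c%:P)%:F = e * P1_ord a ('X - c%:P)%:F) ->
    exists b, forall f, f != 0 -> P1_ord b f = v f.
  move=> e0 he; have ve := P1_valuation_ext Hv (P1_valuation a) he.
  have [t [t0 vt]] := valuation_uniformizer Hv.
  have e1 : e = 1.
    have := ve t t0; rewrite vt; move: (P1_ord a t) => w h.
    suff : (absz e * absz w = 1)%N by move=> /eqP; rewrite muln_eq1; lia.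
    by rewrite -abszM -h.
  by exists a => f f0; rewrite (ve f f0) e1 mul1r.
have [[c vc]|nc] := Classical_Prop.classic (exists c, 0 < v ('X - c%:P)%:F).
  apply: (key (Some c) (v ('X - c%:P)%:F)) => [|d]; first exact: ltW.
  rewrite P1_ord_XsubC; have [->|dc] := eqVneq d c; first by rewrite mulr1.
  by rewrite mulr0 (shift0 c) // eq_sym.
have le0 c : v ('X - c%:P)%:F <= 0.
  by rewrite leNgt; apply/negP => vc; apply: nc; exists c.
apply: (key None (- v ('X - 0%:P)%:F)) => [|d]; first by rewrite oppr_ge0.
rewrite P1_ord_XsubC mulrN1 opprK.
have [->//|d0] := eqVneq d 0.
have d0' : 0 != d by rewrite eq_sym.
have := shift _ _ d0; have := shift _ _ d0'; have := le0 0; have := le0 d.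
move: (v ('X - d%:P)%:F) (v ('X - 0%:P)%:F) => x y x0 y0.
by rewrite !(min_idPl _) // => yx xy; apply: le_anti; rewrite xy yx.
Qed.

Definition P1 : curve k :=
  Curve P1_function_field P1_valuation P1_separated P1_proper.

End ProjectiveLine.

Section Covers.
Variable k : closedFieldType.

Definition cover_iso (X Y X' Y' : curve k) (u : mor X Y) (u' : mor X' Y') : Prop :=
  exists (a : mor X X') (b : mor Y Y'),
    [/\ is_iso a, is_iso b & mor_eq (mor_comp u' a) (mor_comp b u)].

(* for curves of genus >= 2 *)
Definition hyperelliptic (X : curve k) : Prop :=
  exists u : mor X (P1 k), has_degree u 2.

Record triple_cover (g : nat) := TripleCover {
  cover_source : curve k;
  cover_base : curve k;
  cover_map : mor cover_source cover_base;
  cover_etale : etale cover_map;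
  cover_cyclic : galois_with 'Z_3 cover_map;
  cover_base_genus : has_genus cover_base g;
  cover_base_hyperelliptic : hyperelliptic cover_base
}.

(* exactly one ramification point over each branch point q, of index two *)
Definition simply_branched (X Y : curve k) (u : mor X Y) : Prop :=
  forall q : point Y, (exists p, u p = q /\ ramified_at u p) ->
    exists p, [/\ u p = q, ramification_index u p 2
                & forall p', u p' = q -> ramified_at u p' -> p' = p].

Record simple_triple_map (n : nat) := SimpleTripleMap {
  triple_source : curve k;
  triple_map : mor triple_source (P1 k);
  triple_degree : has_degree triple_map 3;
  triple_simply_branched : simply_branched triple_map;
  triple_genus : has_genus triple_source n
}.

(* The cover C~ -> C and the map h : C0 -> P^1 correspond to each other if there
   is a commutative square

        C~ --q--> C0
        |         |
        |         h
        v         v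
        C --pi--> P^1

   whose diagonal is a Galois cover with group S_3.  For reasons of degree, C is
   then the quotient of C~ by A_3, C0 is the quotient of C~ by an involution, and
   C~ is the Galois closure of h. *)
Definition S3_related (g n : nat) (E : triple_cover g) (h : simple_triple_map n) :
    Prop :=
  exists (pi : mor (cover_base E) (P1 k))
         (q : mor (cover_source E) (triple_source h)),
    mor_eq (mor_comp pi (cover_map E)) (mor_comp (triple_map h) q) /\
    galois_with {perm 'I_3} (mor_comp pi (cover_map E)).

End Covers.

(* Main.v *)
Require Import Defs.
From HB Require Import structures.
From mathcomp Require Import all_boot all_order all_fingroup all_algebra.
From mathcomp Require Import zify ring generic_quotient.
From mathcomp.classical Require Import boolp.
From mathcomp.classical Require classical_sets.
From mathcomp Require Import fieldext.
From mathcomp.multinomials Require Import freeg.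

Set Implicit Arguments.
Unset Strict Implicit.
Unset Printing Implicit Defensive.
Import Order.TTheory GRing.Theory Num.Theory.
Local Open Scope ring_scope.

(* Let F = k(x) and let z be a primitive cube root of unity.  The diagonal of a square as
   in S3_related is an extension L = F(u) with u^6 - c u^3 + b^3 = 0 and automorphisms
   sigma u = z u, s u = b / u.  Then k(C) = Fix sigma contains a = u^3, and
   k(C_0) = Fix s = F(w) with w = u + b / u and w^3 = 3 b w + c.

   For an etale cyclic cover, k(C~) = k(C)(u) with u^3 = a and div a = 3 D.  The norm of a
   to F therefore has all its orders divisible by 3, so it is a cube b^3, and u -> b / u
   extends the hyperelliptic involution to an involution s, which defines C_0.  The
   ramification indices of h are bounded by those of C -> P^1, i.e. by 2.  Conversely, for a
   simply branched h put w in Cardano's form and adjoin u; were u in k(C_0), then u^3 would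
   lie in F with orders divisible by 3, so u would be in F.  The cover C~ -> C is etale
   because 3 divides no ramification index of C~ -> P^1.

   The functions on C_0 are the r + beta u + s(beta u) with r in F
   and beta in k(C), so that l(m h^*oo) = m + 1 + l(m pi^*oo + D), and by Riemann's theorem
   g(C_0) = g(C) - 1.

   The isomorphism class of h is determined by the cover since a curve of genus at least
   two has at most one rational subfield of index two; that of the cover is determined by h
   since C~ is its Galois closure and sigma generates the elements of order three. *)

(** * Dimensions of extensions given by field homomorphisms *)

(** Every step is carried out on function fields: a k-homomorphism between them comes from exactly
    one morphism ([mor_of_hom], [mor_ext]), and points are found by restricting or extending a
    valuation and invoking properness. Extensions are homomorphisms rather than inclusions, so
    intermediate fields appear as images, and maps between them come from [hom_factor] and
    [hom_extend]. The genus being a maximum of deg D + 1 - l(D), genera are compared through l along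
    m B + D1, with B the poles of a map to the projective line: for large m the maximum is attained
    there, whatever D1 is. On C the shift D1 is the divisor D with div a = 3 D; it has degree 0 and
    makes l on C and on C_0 comparable for every m. Simple branching and deg pi = 2 act through one
    fact: the indices of h and pi are 1 or 2, hence prime to 3, so divisibility of orders by 3
    descends to the projective line, where it characterizes cubes. An arbitrary involution only
    gives s u = z^i b / u; u has to be rotated before the normal form [s3_square] is reached, and
    both halves of the correspondence are deduced from that form. *)

Lemma sum_option (V : nmodType) (I : finType) (f : option I -> V) :
  \sum_i f i = f None + \sum_i f (Some i).
Proof.
rewrite (bigD1 None) //=; congr (_ + _).
rewrite (reindex_omap Some id) /=; last by case.
by apply: eq_bigl => i; rewrite eqxx.
Qed.

Section LinearAlgebra.
Variables (F K : fieldType) (phi : {rmorphism F -> K}).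
Implicit Types (L : K -> Prop).

Definition free_family (I : finType) (b : I -> K) : Prop :=
  forall c : I -> F, \sum_i phi (c i) * b i = 0 -> forall i, c i = 0.

(** For [phi = cst X] this is [has_dim], and for [L = full] it is the condition in [has_degree], so
    one theory covers both l(D) and the degree of a morphism. *)
Definition has_dimension L (n : nat) : Prop :=
  exists b : 'I_n -> K, (forall i, L (b i)) /\
    forall f, L f -> exists! c : 'rV[F]_n, f = \sum_(i < n) phi (c 0 i) * b i.

Definition is_subspace L : Prop :=
  L 0 /\ forall a f h, L f -> L h -> L (phi a * f + h).

Lemma subspace_sum L (I : finType) (c : I -> F) (b : I -> K) :
  is_subspace L -> (forall i, L (b i)) -> L (\sum_i phi (c i) * b i).
Proof.
move=> [L0 LD] Lb; apply: (big_ind L) => // [f h Lf Lh|i _].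
  by have := LD 1 f h Lf Lh; rewrite rmorph1 mul1r.
by have := LD (c i) _ _ (Lb i) L0; rewrite addr0.
Qed.

(** With more rows than columns, the matrix of the [c i] in terms of the [b j] has a nonzero left
    kernel, and a nonzero row of that kernel is a relation among the [c i]. *)
Lemma free_card_le (I J : finType) (b : J -> K) (c : I -> K) :
  free_family c ->
  (forall i, exists r : J -> F, c i = \sum_j phi (r j) * b j) -> (#|I| <= #|J|)%N.
Proof.
move=> cfree /choice[r cE]; rewrite leqNgt; apply/negP => JI.
pose M := \matrix_(i < #|I|, j < #|J|) r (enum_val i) (enum_val j).
have kM : kermx M != 0.
  rewrite -mxrank_eq0 mxrank_ker subn_eq0 -ltnNge.
  by apply: leq_ltn_trans JI; apply: rank_leq_col.
have [i0 [j0 nz]] : exists i j, kermx M i j != 0.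
  have [/forallP h|/forallPn[i /forallPn[j hj]]] :=
    boolP [forall i, forall j, kermx M i j == 0].
    case/negP: kM; apply/eqP/matrixP => i j; rewrite [RHS]mxE; apply/eqP.
    by move/forallP: (h i).
  by exists i, j.
case/negP: nz; apply/eqP; rewrite -(enum_valK j0).
move: (enum_val j0) => x; apply: (cfree (fun x => kermx M i0 (enum_rank x))) => {x}.
under eq_bigr do rewrite cE mulr_sumr.
rewrite exchange_big /= big1 // => j _.
under eq_bigr do rewrite mulrA -rmorphM.
rewrite -mulr_suml -rmorph_sum.
have -> : \sum_i kermx M i0 (enum_rank i) * r i j = (kermx M *m M) i0 (enum_rank j).
  rewrite [RHS]mxE (reindex (@enum_rank I)) /=; last by apply: onW_bij; apply: enum_rank_bij.
  by apply: eq_bigr => i _; rewrite [M _ _]mxE !enum_rankK.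
by rewrite mulmx_ker mxE rmorph0 mul0r.
Qed.

Lemma dimension_intro L (I : finType) (b : I -> K) :
  free_family b -> (forall i, L (b i)) ->
  (forall f, L f -> exists c : I -> F, f = \sum_i phi (c i) * b i) ->
  has_dimension L #|I|.
Proof.
move=> bfree Lb span; exists (b \o enum_val); split=> [i|f /span[c ->]].
  exact: Lb.
have re (d : I -> F) : \sum_i phi (d i) * b i =
    \sum_(i < #|I|) phi ((\row_j d (enum_val j)) 0 i) * (b \o enum_val) i.
  rewrite (reindex (@enum_val I xpredT)) /=.
    by apply: eq_bigr => i _; rewrite mxE.
  by apply: onW_bij; apply: enum_val_bij.
exists (\row_j c (enum_val j)); split; first exact: re.
move=> r rE; apply/rowP => j; rewrite mxE.
apply/eqP; rewrite -subr_eq0; apply/eqP.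
rewrite -{2}(enum_valK j); move: (enum_val j).
apply: (bfree (fun x => c x - r 0 (enum_rank x))).
under eq_bigr do rewrite rmorphB mulrBl.
apply/eqP; rewrite sumrB subr_eq0 rE; apply/eqP.
rewrite [LHS](reindex (@enum_rank I)) /=; last by apply: onW_bij; apply: enum_rank_bij.
by apply: eq_bigr => i _; rewrite enum_rankK.
Qed.

(** Uniqueness of the coordinates of 0 is freeness; the subspace hypothesis supplies 0 in [L]. *)
Lemma dimension_elim L n : is_subspace L -> has_dimension L n ->
  exists b : 'I_n -> K, [/\ free_family b, forall i, L (b i) &
    forall f, L f -> exists c : 'I_n -> F, f = \sum_i phi (c i) * b i].
Proof.
move=> [L0 _] [b [Lb bE]]; exists b; split=> // [c c0 i|f /bE[c [-> _]]].
  have [c' [_ c'u]] := bE 0 L0.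
  have z0 : 0 = \sum_(i < n) phi ((0 : 'rV_n) 0 i) * b i.
    by rewrite big1 // => j _; rewrite mxE rmorph0 mul0r.
  have c1 : 0 = \sum_(i < n) phi ((\row_j c j) 0 i) * b i.
    by apply: etrans (esym c0) _; apply: eq_bigr => j _; rewrite mxE.
  have := etrans (esym (c'u _ c1)) (c'u _ z0).
  by move/rowP/(_ i); rewrite !mxE.
by exists (c 0).
Qed.

Lemma dimension_free_le L n (I : finType) (c : I -> K) :
  has_dimension L n -> free_family c -> (forall i, L (c i)) -> (#|I| <= n)%N.
Proof.
move=> [b [Lb bE]] cfree Lc; rewrite -[leqRHS]card_ord.
apply: (free_card_le (b := b) cfree) => i.
by have [r [-> _]] := bE _ (Lc i); exists (r 0).
Qed.

Lemma dimension_mono L L' n m : is_subspace L -> (forall f, L f -> L' f) ->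
  has_dimension L n -> has_dimension L' m -> (n <= m)%N.
Proof.
move=> sL LL' /(dimension_elim sL)[b [bf Lb _]] hm.
by rewrite -[leqLHS]card_ord; apply: dimension_free_le hm bf _ => i; apply: LL'.
Qed.

Lemma dimension_uniq L n m : is_subspace L ->
  has_dimension L n -> has_dimension L m -> n = m.
Proof. by move=> sL hn hm; apply/eqP; rewrite eqn_leq !(@dimension_mono L L). Qed.

Lemma eq_dimension L L' n : (forall f, L f <-> L' f) ->
  has_dimension L n -> has_dimension L' n.
Proof.
move=> LL' [b [Lb bE]]; exists b; split=> [i|f /LL'/bE //].
exact/LL'/Lb.
Qed.

Lemma free_family_option (I : finType) (b : I -> K) (f : K) :
  free_family b -> ~ (exists c : I -> F, f = \sum_i phi (c i) * b i) ->
  free_family (oapp b f).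
Proof.
move=> bfree nf c; rewrite sum_option /= => c0.
have cN : c None = 0.
  apply/eqP/negPn/negP => cN; apply: nf.
  exists (fun i => - (c None)^-1 * c (Some i)).
  have pc : phi (c None) != 0 by rewrite fmorph_eq0.
  apply: (mulfI pc); rewrite mulr_sumr.
  move/eqP: c0; rewrite addr_eq0 => /eqP ->; rewrite -sumrN.
  by apply: eq_bigr => i _; rewrite mulrA -rmorphM mulrA mulrN divff // mulN1r rmorphN mulNr.
move: c0; rewrite cN rmorph0 mul0r add0r => c0 [i|//].
exact: (bfree (c \o Some) c0).
Qed.

(** A free family of maximal length in [L] spans [L], since a vector outside its span could be added
    to it. *)
Lemma dimension_exists L (N : nat) : is_subspace L ->
  (forall (n : nat) (c : 'I_n -> K), free_family c -> (forall i, L (c i)) -> (n <= N)%N) ->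
  exists2 d, (d <= N)%N & has_dimension L d.
Proof.
move=> sL bound.
pose P n := `[< exists c : 'I_n -> K, free_family c /\ forall i, L (c i) >].
have P0 : exists n, P n.
  exists 0%N; apply/asboolP; exists (fun=> 0); split=> [c _|]; by case.
have Pb n : P n -> (n <= N)%N by move=> /asboolP[c [cf Lc]]; apply: bound cf Lc.
case: (ex_maxnP P0 Pb) => d /asboolP[b [bf Lb]] dmax.
exists d; first by apply: bound bf Lb.
rewrite -[d]card_ord; apply: (dimension_intro bf Lb) => f Lf.
apply: contrapT => nf.
have of_ := free_family_option bf nf.
suff : P d.+1 by move/dmax; rewrite ltnn.
apply/asboolP; have eqd : #|{: option 'I_d}| = d.+1 by rewrite card_option card_ord.
exists (fun i => oapp b f (enum_val (cast_ord (esym eqd) i))); split.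
  move=> c c0 i.
  have := of_ (fun x => c (cast_ord eqd (enum_rank x))) _
    (enum_val (cast_ord (esym eqd) i)).
  rewrite enum_valK cast_ordKV; apply.
  rewrite -[RHS]c0 (reindex (fun i => enum_val (cast_ord (esym eqd) i))) /=.
    by apply: eq_bigr => j _; rewrite enum_valK cast_ordKV.
  exists (fun x => cast_ord eqd (enum_rank x)) => x _.
    by rewrite enum_valK cast_ordKV.
  by rewrite cast_ordK enum_rankK.
move=> i; by case: (enum_val _) => [j|] /=.
Qed.

Lemma free_span L n (I : finType) (c : I -> K) : is_subspace L ->
  has_dimension L n -> #|I| = n -> free_family c -> (forall i, L (c i)) ->
  forall f, L f -> exists r : I -> F, f = \sum_i phi (r i) * c i.
Proof.
move=> sL hn In cf Lc f Lf; apply: contrapT => nf.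
have := dimension_free_le hn (free_family_option cf nf).
by rewrite card_option In ltnn => h; suff: false by []; apply: h; case.
Qed.

Definition full (f : K) := True.

Lemma subspace_full : is_subspace full. Proof. by []. Qed.

End LinearAlgebra.

Section Tower.
Variables (F K M : fieldType) (phi : {rmorphism F -> K}) (psi : {rmorphism K -> M}).

Lemma tower_sum (I J : finType) (b : I -> K) (c : J -> M) (r : I * J -> F) :
  \sum_j psi (\sum_i phi (r (i, j)) * b i) * c j =
  \sum_p (psi \o phi) (r p) * (psi (b p.1) * c p.2).
Proof.
transitivity (\sum_i \sum_j (psi \o phi) (r (i, j)) * (psi (b i) * c j)).
  rewrite exchange_big; apply: eq_bigr => j _ /=.
  rewrite rmorph_sum mulr_suml; apply: eq_bigr => i _.
  by rewrite rmorphM mulrA.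
by rewrite pair_bigA; apply: eq_bigr => -[i j] _.
Qed.

Lemma free_tower (I J : finType) (b : I -> K) (c : J -> M) :
  free_family phi b -> free_family psi c ->
  free_family (psi \o phi) (fun ij : I * J => psi (b ij.1) * c ij.2).
Proof.
move=> bf cf r r0 [i j]; move: i; apply: (bf (fun i => r (i, j))).
by move: j; apply: (cf (fun j => \sum_i phi (r (i, j)) * b i)); rewrite tower_sum.
Qed.

Lemma dimension_tower n m : has_dimension phi (@full K) n -> has_dimension psi (@full M) m ->
  has_dimension (psi \o phi) (@full M) (n * m).
Proof.
move=> /(dimension_elim (subspace_full _))[b [bf _ bs]].
move=> /(dimension_elim (subspace_full _))[c [cf _ cs]].
have -> : (n * m)%N = #|{: 'I_n * 'I_m}| by rewrite card_prod !card_ord.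
apply: dimension_intro (free_tower bf cf) _ _ => // f _.
have [r ->] := cs f I.
have /choice[s sE] i : exists s : 'I_n -> F, r i = \sum_j phi (s j) * b j by apply: bs.
exists (fun ij => s ij.2 ij.1); rewrite -tower_sum.
by apply: eq_bigr => j _; rewrite {1}sE.
Qed.

(** Products of a free family of K over F with a basis of M over K are free, so [n] bounds the
    degree of K over F; multiplicativity then identifies it. *)
Lemma dimension_tower_bottom n m : (0 < m)%N ->
  has_dimension (psi \o phi) (@full M) n -> has_dimension psi (@full M) m ->
  exists2 d, has_dimension phi (@full K) d & n = (d * m)%N.
Proof.
move=> m0 hn hm.
have [c [cf _ _]] := dimension_elim (subspace_full _) hm.
have [d _ hd] : exists2 d, (d <= n)%N & has_dimension phi (@full K) d.
  apply: dimension_exists (subspace_full _) _ => d b bf _.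
  have := dimension_free_le hn (free_tower bf cf) (fun=> I).
  by rewrite card_prod !card_ord; apply: leq_trans; rewrite leq_pmulr.
exists d => //; apply: dimension_uniq (subspace_full _) hn _.
exact: dimension_tower.
Qed.

Lemma dimension_tower_top n d : (0 < d)%N ->
  has_dimension (psi \o phi) (@full M) n -> has_dimension phi (@full K) d ->
  exists2 m, has_dimension psi (@full M) m & n = (d * m)%N.
Proof.
move=> d0 hn hd.
have [b [bf _ _]] := dimension_elim (subspace_full _) hd.
have [m _ hm] : exists2 m, (m <= n)%N & has_dimension psi (@full M) m.
  apply: dimension_exists (subspace_full _) _ => m c cf _.
  have := dimension_free_le hn (free_tower bf cf) (fun=> I).
  by rewrite card_prod !card_ord; apply: leq_trans; rewrite leq_pmull.
exists m => //; apply: dimension_uniq (subspace_full _) hn _.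
exact: dimension_tower.
Qed.

End Tower.

(** * Factoring and extending homomorphisms of fields *)

Section FieldHom.

Lemma hom_factor (A B M : fieldType) (iota : {rmorphism A -> M}) (psi : {rmorphism B -> M}) :
  (forall x, exists y, psi x = iota y) ->
  exists theta : {rmorphism B -> A}, forall x, iota (theta x) = psi x.
Proof.
move=> /choice[t tE].
have inj := fmorph_inj iota.
have tz : zmod_morphism t by move=> x y; apply: inj; rewrite -!tE rmorphB !tE rmorphB.
have tm : monoid_morphism t.
  split=> [|x y]; first by apply: inj; rewrite -tE !rmorph1.
  by apply: inj; rewrite -tE !rmorphM /= !tE.
pose T := HB.pack_for {rmorphism B -> A} t
  (GRing.isZmodMorphism.Build _ _ t tz) (GRing.isMonoidMorphism.Build _ _ t tm).
by exists T => x /=; rewrite -tE.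
Qed.

Lemma hom_bij_inverse (A B : fieldType) (psi : {rmorphism A -> B}) :
  (forall y, exists x, psi x = y) ->
  exists theta : {rmorphism B -> A}, cancel psi theta /\ cancel theta psi.
Proof.
move=> sur; have [y|theta thE] := @hom_factor A B B psi idfun.
  by have [x <-] := sur y; exists x.
exists theta; split=> x; first by apply: (fmorph_inj psi); rewrite thE.
exact: thE.
Qed.

(** The prescription P(z) -> P(z') is well defined because every relation of z over F also holds for
    z'. *)
Lemma hom_extend (F L M : fieldType) (phi : {rmorphism F -> L}) (psi : {rmorphism F -> M})
    (z : L) (z' : M) :
  (forall f, exists P : {poly F}, f = (map_poly phi P).[z]) ->
  (forall P : {poly F}, (map_poly phi P).[z] = 0 -> (map_poly psi P).[z'] = 0) ->
  exists chi : {rmorphism L -> M}, (forall a, chi (phi a) = psi a) /\ chi z = z'.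
Proof.
move=> /choice[p pE] ker.
have eqz P Q : (map_poly phi P).[z] = (map_poly phi Q).[z] ->
    (map_poly psi P).[z'] = (map_poly psi Q).[z'].
  move=> PQ; apply/eqP; rewrite -subr_eq0 -hornerN -hornerD -rmorphN -rmorphD.
  by apply/eqP/ker; rewrite rmorphD rmorphN hornerD hornerN PQ subrr.
pose t f := (map_poly psi (p f)).[z'].
have tE P : t (map_poly phi P).[z] = (map_poly psi P).[z'] by apply: eqz; rewrite -pE.
have tz : zmod_morphism t.
  move=> f h; rewrite {1}(pE f) {1}(pE h) -hornerN -hornerD -rmorphN -rmorphD tE.
  by rewrite rmorphD rmorphN hornerD hornerN.
have tm : monoid_morphism t.
  split=> [|f h]; last first.
    by rewrite {1}(pE f) {1}(pE h) -hornerM -rmorphM tE rmorphM hornerM.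
  by have := tE 1; rewrite !rmorph1 !hornerC.
pose T := HB.pack_for {rmorphism L -> M} t
  (GRing.isZmodMorphism.Build _ _ t tz) (GRing.isMonoidMorphism.Build _ _ t tm).
exists T; split=> [a|] /=.
  by have := tE a%:P; rewrite !map_polyC !hornerC.
by have := tE 'X; rewrite !map_polyX !hornerX.
Qed.

End FieldHom.

Section FiniteExtensions.
Variables (F K : fieldType) (phi : {rmorphism F -> K}).

Definition finite_over : Prop := exists d, has_dimension phi (@full K) d.

Lemma finite_over_span (I : finType) (b : I -> K) :
  (forall f, exists r : I -> F, f = \sum_i phi (r i) * b i) -> finite_over.
Proof.
move=> span; have [|d _ hd] := dimension_exists (N := #|I|) (subspace_full phi).
  by move=> n c cf _; rewrite -[n]card_ord; apply: (free_card_le cf) => i; apply: span.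
by exists d.
Qed.

Lemma algebraic_reduce (R : {poly F}) (z : K) : R != 0 -> (map_poly phi R).[z] = 0 ->
  forall P : {poly F}, exists r : 'I_(size R) -> F,
    (map_poly phi P).[z] = \sum_i phi (r i) * z ^+ i.
Proof.
move=> R0 Rz P; exists (fun i => (P %% R)`_i).
rewrite {1}(divp_eq P R) rmorphD rmorphM hornerD hornerM /= Rz mulr0 add0r.
rewrite (@horner_coef_wide _ (size R)); last first.
  by rewrite size_map_poly ltnW // ltn_modp.
by apply: eq_bigr => i _; rewrite coef_map.
Qed.

(** The n + 1 powers 1, z, ..., z^n are dependent. The bound on the degree is what makes n! a common
    exponent in [extend_valuation]. *)
Lemma finite_algebraic n (z : K) : has_dimension phi (@full K) n ->
  exists P : {poly F}, [/\ P != 0, (size P <= n.+1)%N & (map_poly phi P).[z] = 0].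
Proof.
move=> hn; have : ~ free_family phi (fun i : 'I_n.+1 => z ^+ i).
  by move/(dimension_free_le hn)/(_ (fun=> I)); rewrite card_ord ltnn.
move=> /existsNP[c /not_implyP[c0 /existsNP[i ci]]].
exists (\poly_(i < n.+1) (if insub i is Some j then c j else 0)); split.
- apply/eqP => /(congr1 (fun p : {poly F} => p`_i)).
  by rewrite coef0 coef_poly ltn_ord valK => /ci.
- exact: size_poly.
rewrite (@horner_coef_wide _ n.+1); last by rewrite size_map_poly size_poly.
rewrite -[RHS]c0; apply: eq_bigr => j _.
by rewrite coef_map coef_poly ltn_ord valK.
Qed.

End FiniteExtensions.

Lemma finite_over_comp (F K M : fieldType) (phi : {rmorphism F -> K})
  (psi : {rmorphism K -> M}) : finite_over phi -> finite_over psi ->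
  finite_over (psi \o phi).
Proof. by move=> [n hn] [m hm]; exists (n * m)%N; apply: dimension_tower. Qed.

Lemma finite_over_bottom (F K M : fieldType) (phi : {rmorphism F -> K})
  (psi : {rmorphism K -> M}) : finite_over (psi \o phi) -> finite_over phi.
Proof.
move=> [n hn]; have [|d _ hd] := dimension_exists (N := n) (subspace_full phi); last by exists d.
move=> m c cf _; rewrite -[m]card_ord; apply: (dimension_free_le (c := psi \o c) hn) => // r r0.
apply: cf; apply/eqP; rewrite -(fmorph_eq0 psi) rmorph_sum; apply/eqP.
by apply: etrans r0; apply: eq_bigr => i _; rewrite rmorphM.
Qed.

Lemma eq_dimension_hom (F K : fieldType) (phi psi : {rmorphism F -> K}) L n :
  phi =1 psi -> has_dimension phi L n -> has_dimension psi L n.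
Proof.
move=> e [b [Lb bE]]; exists b; split=> // f /bE[c [cE cu]]; exists c; split.
  by rewrite cE; apply: eq_bigr => i _; rewrite e.
by move=> c' c'E; apply: cu; rewrite c'E; apply: eq_bigr => i _; rewrite e.
Qed.

(** * Function fields *)

Section FunctionFields.
Variable k : closedFieldType.
Local Notation kx := {fraction {poly k}}.
Local Notation "x %:F" := (@FracField.tofrac _ x).

Lemma frac_hom (K : fieldType) (g : {rmorphism {poly k} -> K}) :
  (forall P, P != 0 -> g P != 0) ->
  exists phi : {rmorphism kx -> K}, forall P, phi P%:F = g P.
Proof.
move=> g0.
pose t (f : kx) := g \n_(repr f) / g \d_(repr f).
have tE P Q : Q != 0 -> t (P%:F / Q%:F) = g P / g Q.
  move=> Q0; rewrite /t; set f := P%:F / Q%:F.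
  have D0 : \d_(repr f) != 0 by apply: denom_ratioP.
  apply/eqP; rewrite eqr_div ?g0 // -!rmorphM; apply/eqP; congr (g _).
  apply/eqP; rewrite -tofrac_eq !tofracM -eqr_div ?tofrac_eq0 //.
  by rewrite -fracE.
have den (f : kx) : exists P Q, Q != 0 /\ f = P%:F / Q%:F.
  by exists \n_(repr f), \d_(repr f); split; [apply: denom_ratioP | apply: fracE].
have tP P : t P%:F = g P.
  by rewrite -[P%:F]divr1 -tofrac1 tE ?oner_eq0 // rmorph1 divr1.
have tz : zmod_morphism t.
  move=> f h; have [P [Q [Q0 ->]]] := den f; have [P' [Q' [Q'0 ->]]] := den h.
  rewrite -mulNr addf_div ?tofrac_eq0 // -tofracN -!tofracM -tofracD.
  rewrite !tE ?mulf_neq0 // -mulNr addf_div ?g0 //.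
  by rewrite rmorphD !rmorphM rmorphN.
have tm : monoid_morphism t.
  split=> [|f h]; first by rewrite -tofrac1 tP rmorph1.
  have [P [Q [Q0 ->]]] := den f; have [P' [Q' [Q'0 ->]]] := den h.
  by rewrite mulf_div -!tofracM !tE ?mulf_neq0 // mulf_div !rmorphM.
pose T := HB.pack_for {rmorphism kx -> K} t
  (GRing.isZmodMorphism.Build _ _ t tz) (GRing.isMonoidMorphism.Build _ _ t tm).
by exists T.
Qed.

Variables (K : fieldType) (cst : {rmorphism k -> K}).

Lemma transcendental_hom (x : K) : transcendental_elt cst x ->
  exists phi : {rmorphism kx -> K},
    (forall a, phi (P1_cst k a) = cst a) /\ phi 'X%:F = x.
Proof.
move=> tx; have [|phi pE] := @frac_hom K (horner_eval x \o map_poly cst).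
  by move=> P P0; apply: tx.
exists phi; split=> [a|]; rewrite pE /= /horner_eval.
  by rewrite map_polyC hornerC.
by rewrite map_polyX hornerX.
Qed.

Lemma kx_hom_poly (phi : {rmorphism kx -> K}) (P : {poly k}) :
  (forall a, phi (P1_cst k a) = cst a) -> phi P%:F = (map_poly cst P).[phi 'X%:F].
Proof.
move=> ec; elim/poly_ind: P => [|P c IH].
  by rewrite tofrac0 !rmorph0 horner0.
rewrite tofracD tofracM !rmorphD !rmorphM /= IH map_polyX map_polyC hornerMXaddC.
by congr (_ + _); apply: ec.
Qed.

Lemma kx_hom_transcendental (phi : {rmorphism kx -> K}) :
  (forall a, phi (P1_cst k a) = cst a) -> transcendental_elt cst (phi 'X%:F).
Proof. by move=> ec P P0; rewrite -(kx_hom_poly _ ec) fmorph_eq0 tofrac_eq0. Qed.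

Lemma common_denominator (I : finType) (c : I -> kx) :
  exists Q : {poly k}, Q != 0 /\ forall i, exists P : {poly k}, Q%:F * c i = P%:F.
Proof.
exists (\prod_i \d_(repr (c i))); split.
  by apply/prodf_neq0 => i _; apply: denom_ratioP.
move=> i; exists (\n_(repr (c i)) * \prod_(j | j != i) \d_(repr (c j))).
rewrite (bigD1 i) //= !tofracM {2}[c i]fracE [(\d_(repr (c i)))%:F * _]mulrC mulrACA divff.
  by rewrite mulr1 mulrC.
by rewrite tofrac_eq0 denom_ratioP.
Qed.

Lemma finite_of_cleared (phi : {rmorphism kx -> K}) m (b : 'I_m -> K) :
  (forall a, phi (P1_cst k a) = cst a) ->
  (forall f, exists (Q : {poly k}) (P : 'I_m -> {poly k}), Q != 0 /\
    (map_poly cst Q).[phi 'X%:F] * f = \sum_(i < m) (map_poly cst (P i)).[phi 'X%:F] * b i) ->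
  finite_over phi.
Proof.
move=> ec bE; apply: (finite_over_span (b := b)) => f.
have [Q [P [Q0 QE]]] := bE f; exists (fun i => (P i)%:F / Q%:F).
have Q0' : phi Q%:F != 0 by rewrite fmorph_eq0 tofrac_eq0.
apply: (mulfI Q0'); rewrite mulr_sumr (kx_hom_poly _ ec) QE.
apply: eq_bigr => i _; rewrite -!(kx_hom_poly _ ec) mulrA -rmorphM; congr (phi _ * _).
by rewrite mulrC divfK // tofrac_eq0.
Qed.

Lemma function_fieldP : function_field cst <->
  exists phi : {rmorphism kx -> K},
    (forall a, phi (P1_cst k a) = cst a) /\ finite_over phi.
Proof.
split=> [[x [tx [m [b bE]]]]|[phi [ec [m hm]]]].
  have [phi [ec eX]] := transcendental_hom tx; exists phi; split=> //.
  by apply: (finite_of_cleared (b := b) ec); rewrite eX.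
exists (phi 'X%:F); split; first exact: kx_hom_transcendental.
have [b [_ _ bs]] := dimension_elim (subspace_full _) hm.
exists m, b => f; have [c fE] := bs f I.
have [Q [Q0 /choice[P PE]]] := common_denominator c.
exists Q, P; split=> //; rewrite -(kx_hom_poly _ ec) fE mulr_sumr.
by apply: eq_bigr => i _; rewrite -(kx_hom_poly _ ec) -PE rmorphM mulrA.
Qed.

(** Over an algebraically closed field a polynomial relation splits into linear factors, one of
    which must vanish at [f]. *)
Lemma constant_or_transcendental (f : K) :
  (exists a, f = cst a) \/ transcendental_elt cst f.
Proof.
have [|h] := lem (transcendental_elt cst f); first by right.
left; move: h => /existsNP[P /not_implyP[P0 /negP/negPn/eqP fP]].
have [s sE] := closed_field_poly_normal P.
move: fP; rewrite sE -mul_polyC rmorphM /= hornerM map_polyC hornerC.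
move/eqP; rewrite mulf_eq0 fmorph_eq0 lead_coef_eq0 (negPf P0) /=.
elim: s {sE} => [|a s IH]; first by rewrite big_nil rmorph1 hornerC oner_eq0.
rewrite big_cons rmorphM hornerM mulf_eq0 => /orP[|//].
by rewrite rmorphB /= map_polyX map_polyC hornerXsubC subr_eq0 => /eqP ->; exists a.
Qed.

(* Exchange: a relation G(x, f) = 0 between transcendental elements is algebraic in x
   over k(f), and a common denominator in k[x] does not affect linear independence. *)
Lemma transcendental_finite (phi : {rmorphism kx -> K}) : function_field cst ->
  (forall a, phi (P1_cst k a) = cst a) -> finite_over phi.
Proof.
move=> ff ec; have tf := kx_hom_transcendental ec.
have [x [tx [m [b bE]]]] := ff.
have [phix [ecx eXx]] := transcendental_hom tx.
have [n hn] : finite_over phix.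
  by apply: (finite_of_cleared (b := b) ecx); rewrite eXx.
have [G [G0 _ Gf]] := finite_algebraic (phi 'X%:F) hn.
have [D [D0 /choice[P PE]]] := common_denominator (fun i : 'I_(size G) => G`_i).
have relP : \sum_(i < size G) (map_poly cst (P i)).[x] * (phi 'X%:F) ^+ i = 0.
  transitivity (phix D%:F * (map_poly phix G).[phi 'X%:F]); last by rewrite Gf mulr0.
  rewrite horner_coef size_map_poly mulr_sumr; apply: eq_bigr => i _.
  by rewrite coef_map mulrA -rmorphM PE (kx_hom_poly _ ecx) eXx.
pose N := \max_(i < size G) size (P i).
(* The relation G(f) = 0 over k(x), cleared of denominators by [D], is a polynomial in x and f.
   [q j] collects the coefficient of x^j, so that [R] is the same relation read as an equation for x
   over k(f). *)
pose q j : {poly k} := \poly_(i < size G) (if insub i is Some i' then (P i')`_j else 0).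
pose R : {poly kx} := \poly_(j < N) (q j)%:F.
have R0 : R != 0.
  have sG : (0 < size G)%N by rewrite size_poly_gt0.
  have l : ((size G).-1 < size G)%N by rewrite prednK.
  pose i0 := Ordinal l.
  have P0 : P i0 != 0.
    by rewrite -tofrac_eq0 -PE mulf_neq0 ?tofrac_eq0 // -lead_coefE lead_coef_eq0.
  apply/eqP => /(congr1 (fun p : {poly kx} => p`_((size (P i0)).-1))).
  have sP : ((size (P i0)).-1 < N)%N.
    rewrite prednK ?size_poly_gt0 //.
    exact: (@leq_bigmax _ (fun i => size (P i))).
  rewrite coef0 coef_poly sP => /eqP; rewrite tofrac_eq0 => /eqP.
  move=> /(congr1 (fun p : {poly k} => p`_i0)).
  by rewrite coef0 coef_poly ltn_ord valK => /eqP; rewrite -lead_coefE lead_coef_eq0 (negPf P0).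
have Rx : (map_poly phi R).[x] = 0.
  rewrite (@horner_coef_wide _ N); last by rewrite size_map_poly size_poly.
  rewrite -[RHS]relP.
  transitivity (\sum_(j < N) \sum_(i < size G) cst (P i)`_j * phi 'X%:F ^+ i * x ^+ j).
    apply: eq_bigr => j _; rewrite coef_map coef_poly ltn_ord.
    rewrite -mulr_suml; congr (_ * _); apply: etrans (kx_hom_poly (q j) ec) _.
    rewrite (@horner_coef_wide _ (size G)); last first.
      by rewrite size_map_poly; apply: size_poly.
    by apply: eq_bigr => i _; rewrite coef_map /q coef_poly ltn_ord valK.
  rewrite exchange_big; apply: eq_bigr => i _ /=.
  rewrite (@horner_coef_wide _ N); last first.
    by rewrite size_map_poly; apply: (@leq_bigmax _ (fun i => size (P i))).
  by rewrite mulr_suml; apply: eq_bigr => j _; rewrite coef_map mulrAC.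
have [|d _ hd] := dimension_exists (N := #|{: 'I_(size R) * 'I_m}|) (subspace_full phi).
  move=> r c cf _; rewrite -[r]card_ord.
  have /choice[Qc QcE] : forall i, exists Q : {poly k}, Q != 0 /\
      exists P : 'I_m -> {poly k},
      (map_poly cst Q).[x] * c i = \sum_j (map_poly cst (P j)).[x] * b j.
    by move=> i; have [Q [P' [Q0 QE]]] := bE (c i); exists Q; split=> //; exists P'.
  (* Each [c i] has its own denominator in k[x]. The product [Q] scales the whole family, which
     therefore stays free, and moves it into the k(f)-span of the x^i b_j. *)
  pose Q := \prod_i Qc i.
  have Q0 : (map_poly cst Q).[x] != 0.
    by apply: tx; apply/prodf_neq0 => i _; have [] := QcE i.
  have Qcf : free_family phi (fun i => (map_poly cst Q).[x] * c i).
    move=> s s0; apply: cf; apply: (mulfI Q0); rewrite mulr0 -[RHS]s0 mulr_sumr.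
    by apply: eq_bigr => i _; rewrite mulrCA.
  apply: (free_card_le (b := fun ij : 'I_(size R) * 'I_m => x ^+ ij.1 * b ij.2) Qcf) => i.
  have [_ [P' P'E]] := QcE i.
  pose T := \prod_(j | j != i) Qc j.
  have /choice[s sE] : forall j, exists s : 'I_(size R) -> kx,
      (map_poly cst (T * P' j)).[x] = \sum_i phi (s i) * x ^+ i.
    move=> j; have := algebraic_reduce R0 Rx (map_poly (P1_cst k) (T * P' j)).
    have -> // : map_poly phi (map_poly (P1_cst k) (T * P' j)) = map_poly cst (T * P' j).
    by rewrite -map_poly_comp; apply: eq_map_poly => a; apply: ec.
  exists (fun ij => s ij.2 ij.1).
  rewrite -(pair_bigA _ (fun i j => phi (s j i) * (x ^+ i * b j))) /= exchange_big /=.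
  rewrite /Q (bigD1 i) //= [Qc i * _]mulrC rmorphM hornerM -mulrA P'E mulr_sumr.
  apply: eq_bigr => j _; rewrite mulrA -hornerM -rmorphM sE mulr_suml.
  by apply: eq_bigr => l _; rewrite mulrA.
by exists d.
Qed.

End FunctionFields.

Lemma function_field_up (k : closedFieldType) (F K : fieldType) (cstF : {rmorphism k -> F})
  (cstK : {rmorphism k -> K}) (phi : {rmorphism F -> K}) :
  (forall a, phi (cstF a) = cstK a) -> function_field cstF -> finite_over phi ->
  function_field cstK.
Proof.
move=> ec /function_fieldP[psi [psic psif]] phif; apply/function_fieldP.
exists (phi \o psi); split; last exact: finite_over_comp.
by move=> a; rewrite -ec -psic.
Qed.

(** K is finite over k(x) for a transcendental x coming from F ([transcendental_finite]), hence over
    the larger field F. *)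
Lemma function_field_finite (k : closedFieldType) (F K : fieldType) (cstF : {rmorphism k -> F})
  (cstK : {rmorphism k -> K}) (phi : {rmorphism F -> K}) :
  (forall a, phi (cstF a) = cstK a) -> function_field cstF -> function_field cstK ->
  finite_over phi.
Proof.
move=> ec /function_fieldP[psi [psic [d hd]]] ffK.
have [n hn] : finite_over (phi \o psi).
  by apply: (transcendental_finite ffK) => a; rewrite -ec -psic.
have d0 : (0 < d)%N.
  case: d hd => // -[b [_ bE]]; have [c [] ] := bE 1 I.
  by rewrite big_ord0 => /eqP; rewrite oner_eq0.
by have [m hm _] := dimension_tower_top d0 hn hd; exists m.
Qed.

(** * Restriction and extension of valuations *)

Section Valuations.
Variables (k : closedFieldType) (K : fieldType) (cst : {rmorphism k -> K}).

(** No uniformizer is asked for: restrictions to subfields, and the function [W] in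
    [extend_valuation], may take values in a proper subgroup of the integers until they are
    normalized. *)
Definition weak_valuation (v : K -> int) : Prop :=
  [/\ forall f h, f != 0 -> h != 0 -> v (f * h) = v f + v h,
      forall f h, f != 0 -> h != 0 -> f + h != 0 -> Num.min (v f) (v h) <= v (f + h)
    & forall a, a != 0 -> v (cst a) = 0].

Lemma discrete_weak v : discrete_valuation cst v -> weak_valuation v.
Proof. by case. Qed.

Section Weak.
Variables (v : K -> int) (Hv : weak_valuation v).

(** The value of [v] at 0 is arbitrary; admitting f = 0 separately amounts to v 0 = oo and makes the
    condition closed under sums. *)
Definition vge (m : int) (f : K) : bool := (f == 0) || (m <= v f).

Lemma valM f h : f != 0 -> h != 0 -> v (f * h) = v f + v h.
Proof. by case: Hv => h1 _ _; apply: h1. Qed.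

Lemma val_cst a : a != 0 -> v (cst a) = 0.
Proof. by case: Hv => _ _; apply. Qed.

Lemma val1 : v 1 = 0.
Proof. by rewrite -(rmorph1 cst) val_cst // oner_neq0. Qed.

Lemma valV f : f != 0 -> v f^-1 = - v f.
Proof.
move=> f0; apply/eqP; rewrite -addr_eq0 addrC -valM ?invr_eq0 //.
by rewrite divff // val1.
Qed.

Lemma valB_div f h : f != 0 -> h != 0 -> v (f / h) = v f - v h.
Proof. by move=> f0 h0; rewrite valM ?invr_eq0 // valV. Qed.

Lemma valX f n : f != 0 -> v (f ^+ n) = n%:Z * v f.
Proof.
move=> f0; elim: n => [|n IH]; first by rewrite expr0 val1 mul0r.
by rewrite exprS valM ?expf_neq0 // IH; lia.
Qed.

Lemma valXz f (m : int) : f != 0 -> v (f ^ m) = m * v f.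
Proof.
move=> f0; case: m => n; first by rewrite -exprnP valX.
by rewrite NegzE -invr_expz valV ?expfz_neq0 // -exprnP valX //; lia.
Qed.

Lemma valN f : v (- f) = v f.
Proof.
have [->|f0] := eqVneq f 0; first by rewrite oppr0.
have n1 : (-1 : k) != 0 by rewrite oppr_eq0 oner_eq0.
have := val_cst n1; rewrite rmorphN1 => e.
by rewrite -mulN1r valM ?oppr_eq0 ?oner_eq0 // e add0r.
Qed.

Lemma vge0 m : vge m 0. Proof. by rewrite /vge eqxx. Qed.

Lemma vge_val m f : f != 0 -> vge m f = (m <= v f).
Proof. by rewrite /vge => /negPf ->. Qed.

Lemma vge_le m n f : m <= n -> vge n f -> vge m f.
Proof. by move=> mn /orP[h|h]; rewrite /vge ?h // (le_trans mn h) orbT. Qed.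

Lemma vgeD m f h : vge m f -> vge m h -> vge m (f + h).
Proof.
have [->|f0] := eqVneq f 0; first by rewrite add0r.
have [->|h0] := eqVneq h 0; first by rewrite addr0.
have [->|s0] := eqVneq (f + h) 0; first by rewrite vge0.
rewrite !vge_val // => mf mh; case: Hv => _ /(_ f h f0 h0 s0) H _.
by apply: le_trans H; rewrite le_min mf.
Qed.

Lemma vge_sum (I : finType) (P : pred I) m (x : I -> K) :
  (forall i, P i -> vge m (x i)) -> vge m (\sum_(i | P i) x i).
Proof. by move=> h; apply: (big_ind (vge m)) => //; [apply: vge0 | apply: vgeD]. Qed.

Lemma vgeM m n f h : vge m f -> vge n h -> vge (m + n) (f * h).
Proof.
have [->|f0] := eqVneq f 0; first by rewrite mul0r !vge0.
have [->|h0] := eqVneq h 0; first by rewrite mulr0 !vge0.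
by rewrite !vge_val ?mulf_neq0 // valM //; lia.
Qed.

Lemma vgeN m f : vge m (- f) = vge m f.
Proof. by rewrite /vge oppr_eq0 valN. Qed.

Lemma vge_cst a : vge 0 (cst a).
Proof.
have [->|a0] := eqVneq a 0; first by rewrite rmorph0 vge0.
by rewrite vge_val ?fmorph_eq0 // val_cst.
Qed.

Lemma vge_cstM m a f : vge m f -> vge m (cst a * f).
Proof. by rewrite -{2}[m]add0r; apply/vgeM/vge_cst. Qed.

Lemma val_dominant f h : f != 0 -> vge (v f + 1) h -> f + h != 0 /\ v (f + h) = v f.
Proof.
move=> f0 hh.
have s0 : f + h != 0.
  apply: (contraL _ hh); rewrite addr_eq0 => /eqP fE.
  by rewrite -vgeN -fE vge_val // -ltNge ltzD1.
split=> //; apply: le_anti; apply/andP; split; last first.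
  rewrite -vge_val //; apply: vgeD; first by rewrite vge_val.
  by apply: vge_le hh; lia.
rewrite leNgt; apply/negP => lt.
suff : vge (v f + 1) (f + h - h) by rewrite addrK vge_val // lezD1 ltxx.
by apply: vgeD; rewrite ?vgeN // vge_val // lezD1.
Qed.

Lemma sum_dominant (I : finType) (x : I -> K) (i0 : I) : x i0 != 0 ->
  (forall i, i != i0 -> vge (v (x i0) + 1) (x i)) ->
  \sum_i x i != 0 /\ v (\sum_i x i) = v (x i0).
Proof.
move=> x0 h; rewrite (bigD1 i0) //=; apply: val_dominant => //.
exact: vge_sum.
Qed.

Lemma distinct_values_sum (I : finType) (x : I -> K) (i1 : I) : x i1 != 0 ->
  (forall i j, x i != 0 -> x j != 0 -> v (x i) = v (x j) -> i = j) ->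
  \sum_i x i != 0.
Proof.
move=> x1 inj.
case: (@Order.TotalTheory.arg_minP _ _ _ i1 (fun i => x i != 0) (fun i => v (x i)) x1) => i0 x0 imin.
suff [] : \sum_i x i != 0 /\ v (\sum_i x i) = v (x i0) by [].
apply: sum_dominant => // i ii0.
have [->|xi] := eqVneq (x i) 0; first exact: vge0.
rewrite vge_val //; have := imin i xi; rewrite le_eqVlt => /orP[/eqP e|]; last by lia.
by case/eqP: ii0; apply: inj.
Qed.

(** The values form a nonzero subgroup of the integers; [e] is its least positive element, and
    division with remainder shows that it generates. *)
Lemma normalize_valuation f0 : f0 != 0 -> v f0 != 0 ->
  exists w e, [/\ discrete_valuation cst w, 0 < e & forall f, f != 0 -> v f = e * w f].
Proof.
move=> f00 vf0.
pose P n := (0 < n)%N && `[< exists f, f != 0 /\ v f = n%:Z >].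
have exP : exists n, P n.
  exists `|v f0|%N; rewrite /P absz_gt0 vf0; apply/asboolP.
  have [h|h] := leP 0 (v f0); first by exists f0; split=> //; lia.
  by exists f0^-1; rewrite invr_eq0 f00 valV //; split=> //; lia.
case: (ex_minnP exP) => e /andP[e0 /asboolP[t [t0 vt]]] emin.
have dvd f : f != 0 -> (e %| v f)%Z.
  move=> f1; apply/dvdz_mod0P/eqP.
  have e1 : e%:Z != 0 by lia.
  have r0 : f / t ^ (v f %/ e)%Z != 0 by rewrite mulf_neq0 // invr_eq0 expfz_neq0.
  have rE : v (f / t ^ (v f %/ e)%Z) = (v f %% e)%Z.
    by rewrite valB_div ?expfz_neq0 // valXz // vt {1}(divz_eq (v f) e) addrC addKr.
  apply/negPn/negP => n0.
  have rlt : (v f %% e)%Z < e%:Z by rewrite ltz_mod.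
  have rge : 0 <= (v f %% e)%Z by rewrite modz_ge0.
  suff : (e <= `|(v f %% e)%Z|)%N by lia.
  apply: emin; apply/andP; split; first by rewrite absz_gt0.
  by apply/asboolP; exists (f / t ^ (v f %/ e)%Z); split=> //; rewrite rE; lia.
pose w f := (v f %/ e)%Z.
have vE f : f != 0 -> v f = e%:Z * w f.
  by move=> f1; rewrite mulrC /w divzK // dvd.
have eP : 0 < e%:Z by lia.
exists w, e%:Z; split=> //; split.
- by move=> f h f1 h1; apply: (mulfI (lt0r_neq0 eP)); rewrite mulrDr -!vE ?mulf_neq0 // valM.
- move=> f h f1 h1 s1; case: Hv => _ /(_ f h f1 h1 s1) H _.
  move: H; rewrite !vE // !ge_min => /orP[] H; apply/orP; [left|right]; move: H;
  by rewrite ler_pM2l.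
- move=> a a0; apply: (mulfI (lt0r_neq0 eP)).
  by rewrite mulr0 -vE ?fmorph_eq0 // val_cst.
- by exists t; split=> //; apply: (mulfI (lt0r_neq0 eP)); rewrite mulr1 -vE.
Qed.

End Weak.

End Valuations.

Section RestrictionOfValuations.
Variables (k : closedFieldType) (F K : fieldType).
Variables (cstF : {rmorphism k -> F}) (cstK : {rmorphism k -> K}).
Variables (phi : {rmorphism F -> K}) (phiE : forall a, phi (cstF a) = cstK a).

Lemma weak_restrict w : weak_valuation cstK w -> weak_valuation cstF (w \o phi).
Proof.
move=> [wM wD wc]; split=> [f h f0 h0|f h f0 h0 s0|a a0] /=.
- by rewrite rmorphM wM ?fmorph_eq0.
- by rewrite rmorphD wD // -?rmorphD fmorph_eq0.
- by rewrite phiE wc.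
Qed.

(** The terms of a relation have the values i w(t), pairwise different, and such terms cannot
    cancel. Hence a valuation with a uniformizer cannot be trivial on a subfield over which the
    field is finite. *)
Lemma powers_free w t m : weak_valuation cstK w -> t != 0 -> w t != 0 ->
  (forall f, f != 0 -> w (phi f) = 0) -> free_family phi (fun i : 'I_m => t ^+ i).
Proof.
move=> Ww t0 wt triv c c0 i; apply/eqP/negPn/negP => ci; move/eqP: c0; apply/negP.
have nz j : (phi (c j) * t ^+ j != 0) = (c j != 0).
  by rewrite mulf_eq0 fmorph_eq0 expf_eq0 (negPf t0) andbF orbF.
apply: (distinct_values_sum Ww (i1 := i)); first by rewrite nz.
move=> j l; rewrite !nz => cj cl.
rewrite !(valM Ww) ?fmorph_eq0 ?expf_neq0 // !triv // !(valX Ww) // !add0r.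
by move=> /(mulIf wt) -[]; apply: val_inj.
Qed.

Lemma finite_nontrivial w : discrete_valuation cstK w -> finite_over phi ->
  exists2 f, f != 0 & w (phi f) != 0.
Proof.
move=> /[dup] Hw [_ _ _ [t [t0 wt]]] [n hn]; apply: contrapT => triv.
have {}triv f : f != 0 -> w (phi f) = 0.
  by move=> f0; apply/eqP/negPn/negP => h; apply: triv; exists f.
have : free_family phi (fun i : 'I_n.+1 => t ^+ i).
  by apply: (@powers_free w t _ (discrete_weak Hw)) => //; rewrite wt.
by move/(dimension_free_le hn)/(_ (fun=> I)); rewrite card_ord ltnn.
Qed.

Lemma restrict_valuation w : discrete_valuation cstK w -> finite_over phi ->
  exists v e, [/\ discrete_valuation cstF v, 0 < e &
    forall f, f != 0 -> w (phi f) = e * v f].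
Proof.
move=> Hw fin; have [f0 f00 wf0] := finite_nontrivial Hw fin.
exact: (normalize_valuation (weak_restrict (discrete_weak Hw)) f00 wf0).
Qed.

(** Division of f by t^(v f) leaves a unit of the ring of v, which is a unit for w as well; so w(f)
    = v(f) w(t). Positivity of the factor is a separate matter. *)
Lemma valuation_ring_proportional v w : discrete_valuation cstF v ->
  weak_valuation cstK w -> (forall f, f != 0 -> 0 <= v f -> 0 <= w (phi f)) ->
  exists e, 0 <= e /\ forall f, f != 0 -> w (phi f) = e * v f.
Proof.
move=> /[dup] Hv [_ _ _ [t [t0 vt]]] Ww sub; exists (w (phi t)).
have Wv := discrete_weak Hv.
have WwF := weak_restrict Ww.
split=> [|f f0]; first by apply: sub => //; rewrite vt.
pose g := f / t ^ v f.
have g0 : g != 0 by rewrite mulf_neq0 // invr_eq0 expfz_neq0.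
have vg : v g = 0 by rewrite (valB_div Wv) ?expfz_neq0 // (valXz Wv) // vt mulr1 subrr.
have wg : w (phi g) = 0.
  have := sub _ g0; rewrite vg => /(_ isT) h1.
  have := sub g^-1; rewrite invr_eq0 (valV Wv) // vg => /(_ g0 isT).
  by have := valV WwF g0; rewrite /= => ->; lia.
have := valB_div WwF f0 (expfz_neq0 (v f) t0); rewrite /= -/g wg.
by have := valXz WwF (v f) t0; rewrite /= => ->; lia.
Qed.

End RestrictionOfValuations.

(** * Extension of a discrete valuation to a finite extension *)

Section Extension.
Variables (k : closedFieldType) (F K : fieldType) (cstF : {rmorphism k -> F}).
Variables (phi : {rmorphism F -> K}).
Variables (v : F -> int) (Hv : discrete_valuation cstF v).

Let Wv := discrete_weak Hv.

Section ValuationRing.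
Variable A : K -> Prop.
Hypotheses (A1 : A 1) (AB : forall x y, A x -> A y -> A (x - y))
  (AM : forall x y, A x -> A y -> A (x * y)).

Lemma subring0 : A 0. Proof. by rewrite -(subrr 1); apply: AB. Qed.
Lemma subringN x : A x -> A (- x).
Proof. by rewrite -[- x]add0r; apply/AB/subring0. Qed.
Lemma subringD x y : A x -> A y -> A (x + y).
Proof. by move=> Ax Ay; rewrite -[y]opprK; apply/AB/subringN. Qed.
Lemma subringX x n : A x -> A (x ^+ n).
Proof. by move=> Ax; elim: n => [|n IH]; rewrite ?expr0 ?exprS //; apply: AM. Qed.
Lemma subring_sum (I : Type) (r : seq I) (P : pred I) (x : I -> K) :
  (forall i, P i -> A (x i)) -> A (\sum_(i <- r | P i) x i).
Proof. by move=> h; apply: (big_ind A) => //; [apply: subring0 | apply: subringD]. Qed.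

Definition coefs_in (P : {poly K}) := forall i, A P`_i.

Lemma coefs_inB P Q : coefs_in P -> coefs_in Q -> coefs_in (P - Q).
Proof. by move=> hP hQ i; rewrite coefB; apply: AB. Qed.
Lemma coefs_inM P Q : coefs_in P -> coefs_in Q -> coefs_in (P * Q).
Proof. by move=> hP hQ i; rewrite coefM; apply: subring_sum => j _; apply: AM. Qed.
Lemma coefs_inC a : A a -> coefs_in a%:P.
Proof. by move=> Aa i; rewrite coefC; case: eqP => _ //; apply: subring0. Qed.
Lemma coefs_inX : coefs_in 'X.
Proof. by move=> i; rewrite coefX; case: eqP => _ //; apply: subring0. Qed.
(** Put y = 1 - tau a. If 1/y were not in A, then 1/tau would be a polynomial in 1/y over A.
    Multiplication by y^n, with n the size of the polynomial, clears 1/y, and y^n = 1 - tau b gives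
    1/tau = y^n / tau + b in A. *)
Lemma pole_inverse_unit (tau a : K) : tau != 0 -> ~ A tau^-1 -> A tau -> A a ->
  (forall x, ~ A x -> exists P, coefs_in P /\ P.[x] = tau^-1) ->
  1 - tau * a != 0 /\ A (1 - tau * a)^-1.
Proof.
move=> tau0 ntau At Aa ext; set y := 1 - tau * a.
have y0 : y != 0.
  rewrite subr_eq0; apply/eqP => e; apply: ntau.
  suff -> : tau^-1 = a by [].
  by apply: (mulfI tau0); rewrite divff // e.
split=> //; apply: contrapT => /ext[P [hP PE]].
have [b [Ab yE]] : exists b, A b /\ y ^+ (size P) = 1 - tau * b.
  elim: (size P) => [|n [b [Ab yE]]]; first by exists 0; rewrite mulr0 subr0; split=> //; apply: subring0.
  exists (a + b - tau * a * b); split; last by rewrite exprS yE /y; ring.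
  by apply: AB; [apply: subringD | apply/AM/Ab/AM].
apply: ntau; suff -> : tau^-1 = y ^+ (size P) * tau^-1 + b.
  apply: subringD => //; rewrite -PE horner_coef mulr_sumr.
  apply: subring_sum => i _; rewrite mulrCA; apply: AM => //.
  have -> : y ^+ size P * y^-1 ^+ i = y ^+ (size P - i).
    by rewrite exprVn expfB_cond // (negPf y0) add0n ltnW.
  by apply: subringX; apply: AB => //; apply: AM.
by rewrite yE mulrBl mul1r [tau * b]mulrC mulfK // subrK.
Qed.

(** Chevalley's degree reduction: the relation for z = 1/x says that y = 1 - tau Q_0 is the sum of
    the tau Q_i z^i with i > 0, and y is a unit of A. Multiplied by x^d / y it expresses x^d through
    lower powers of x, which removes the top term of P. *)
Lemma valuation_ring_step (tau x z : K) (P Q : {poly K}) :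
  tau != 0 -> ~ A tau^-1 -> A tau ->
  (forall x, ~ A x -> exists P, coefs_in P /\ P.[x] = tau^-1) ->
  x * z = 1 -> coefs_in P -> P.[x] = tau^-1 -> coefs_in Q -> Q.[z] = tau^-1 ->
  (size Q <= size P)%N ->
  exists R, [/\ coefs_in R, R.[x] = tau^-1 & (size R < size P)%N].
Proof.
move=> tau0 ntau At ext xz hP PE hQ QE QP.
have [y0 Ay] := pole_inverse_unit tau0 ntau At (hQ 0%N) ext.
set y := 1 - _ in y0 Ay.
have nz R u : R.[u] = tau^-1 -> (0 < size R)%N.
  move=> RE; rewrite size_poly_gt0; apply/eqP => R0; move/eqP: RE.
  by rewrite R0 horner0 eq_sym invr_eq0 (negPf tau0).
have sP := nz _ _ PE; have sQ := nz _ _ QE.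
pose d := (size P).-1; pose e := (size Q).-1.
have ed : (e <= d)%N by rewrite /e /d; lia.
pose c i := tau * Q`_i.+1 / y.
pose R := \sum_(i < e) (c i)%:P * 'X ^+ (d - i.+1).
have cR : coefs_in R.
  move=> j; rewrite coef_sum; apply: subring_sum => i _; move: j; apply: coefs_inM.
    by apply: coefs_inC; apply: AM => //; apply: AM.
  by move=> j; rewrite coefXn; case: eqP => _ //; apply: subring0.
have yE : y = \sum_(i < e) tau * Q`_i.+1 * z ^+ i.+1.
  have := QE; rewrite horner_coef -(prednK sQ) big_ord_recl expr0 mulr1 => QE'.
  have -> : y = tau * (tau^-1 - Q`_0) by rewrite mulrBr divff.
  by rewrite -QE' addrC addKr mulr_sumr; apply: eq_bigr => i _; rewrite mulrA.
have RE : R.[x] = x ^+ d.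
  apply: (mulfI y0); rewrite mulrC {2}yE mulr_suml horner_sum mulr_suml.
  apply: eq_bigr => i _; rewrite hornerM hornerC hornerXn /c.
  have -> : tau * Q`_i.+1 * z ^+ i.+1 * x ^+ d =
      tau * Q`_i.+1 * (x ^+ (d - i.+1) * (x * z) ^+ i.+1).
    have -> : x ^+ d = x ^+ (d - i.+1) * x ^+ i.+1.
      by rewrite -exprD subnK //; apply: leq_trans ed.
    by rewrite exprMn; ring.
  by rewrite xz expr1n mulr1 mulrAC divfK.
exists (\poly_(i < d) P`_i + (P`_d)%:P * R); split.
- move=> i; rewrite coefD coefCM coef_poly; apply: subringD; last exact: AM.
  by case: ifP => _ //; apply: subring0.
- rewrite hornerD hornerCM RE -PE horner_poly [RHS]horner_coef -(prednK sP).
  by rewrite big_ord_recr.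
- rewrite -(prednK sP) -/d ltnS; apply: leq_trans (size_polyD _ _) _.
  rewrite geq_max size_poly /= mul_polyC.
  apply: leq_trans (size_scale_leq _ _) _.
  apply: leq_trans (size_sum _ _ _) _; apply/bigmax_leqP => i _.
  rewrite mul_polyC; apply: leq_trans (size_scale_leq _ _) _.
  by rewrite size_polyXn; have := ltn_ord i; lia.
Qed.

(** If neither x nor 1/x were in A, both would have relations of minimal degree, and the longer of
    the two could be shortened. *)
Lemma valuation_ring_total (tau : K) : tau != 0 -> ~ A tau^-1 -> A tau ->
  (forall x, ~ A x -> exists P, coefs_in P /\ P.[x] = tau^-1) ->
  forall x, x != 0 -> A x \/ A x^-1.
Proof.
move=> tau0 ntau At ext x x0; apply: contrapT => /not_orP[nx nz].
have minimal u : ~ A u -> exists P, [/\ coefs_in P, P.[u] = tau^-1 &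
    forall R, coefs_in R -> R.[u] = tau^-1 -> (size P <= size R)%N].
  move=> /ext[P0 [hP0 P0E]].
  pose S n := `[< exists P, [/\ coefs_in P, P.[u] = tau^-1 & size P = n] >].
  have exS : exists n, S n by exists (size P0); apply/asboolP; exists P0.
  case: (ex_minnP exS) => n /asboolP[P [hP PE Pn]] nmin.
  exists P; split=> // R hR RE; rewrite Pn; apply: nmin.
  by apply/asboolP; exists R.
have [P [hP PE Pmin]] := minimal _ nx; have [Q [hQ QE Qmin]] := minimal _ nz.
have [QP|/ltnW PQ] := leqP (size Q) (size P).
  have [R [hR RE]] := valuation_ring_step tau0 ntau At ext (divff x0) hP PE hQ QE QP.
  by rewrite ltnNge Pmin.
have [R [hR RE]] := valuation_ring_step tau0 ntau At ext (mulVf x0) hQ QE hP PE PQ.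
by rewrite ltnNge Qmin.
Qed.

Hypothesis Atotal : forall x, x != 0 -> A x \/ A x^-1.

(** As A is a valuation ring, some nonzero term x_i0 has all the ratios x_j / x_i0 in A. If no other
    term were associated to it, these ratios for j != i0 would be nonunits, and so would their sum,
    which is -1. *)
Lemma valuation_ring_dominant (I : finType) (x : I -> K) (i1 : I) : x i1 != 0 ->
  \sum_i x i = 0 ->
  exists i j, [/\ i != j, x i != 0, x j != 0, A (x i / x j) & A (x j / x i)].
Proof.
move=> x1 sum0; apply: contrapT => nex.
have dom (s : seq I) : i1 \in s -> exists i0, [/\ i0 \in s, x i0 != 0 &
    forall j, j \in s -> A (x j / x i0)].
  suff : (forall i, i \in s -> x i = 0) \/ exists i0, [/\ i0 \in s, x i0 != 0 &
    forall j, j \in s -> A (x j / x i0)].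
    by case=> // h s1; move: x1; rewrite h // eqxx.
  elim: s {sum0} => [|i s [IH|[i0 [i0s xi0 IH]]]]; first by left.
    have [xi|xi] := eqVneq (x i) 0.
      by left=> j; rewrite inE => /orP[/eqP ->|/IH].
    right; exists i; rewrite mem_head; split=> // j; rewrite inE => /orP[/eqP ->|/IH ->].
      by rewrite divff.
    by rewrite mul0r; apply: subring0.
  right; have [A0|A0] : A (x i / x i0) \/ (x i != 0 /\ A (x i0 / x i)).
  - have [->|xi] := eqVneq (x i) 0; first by left; rewrite mul0r; apply: subring0.
    have := Atotal (mulf_neq0 xi (invr_neq0 xi0)); rewrite invf_div.
    by case; [left | right].
  - exists i0; rewrite inE i0s orbT; split=> // j; rewrite inE => /orP[/eqP ->|/IH] //.
  - case: A0 => xi A0; exists i; rewrite mem_head; split=> // j.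
    rewrite inE => /orP[/eqP ->|/IH h]; first by rewrite divff.
    have -> : x j / x i = (x j / x i0) * (x i0 / x i) by rewrite mulrA divfK.
    exact: AM.
have [i0 [_ x0 h]] := dom (enum I) (mem_enum _ _).
(* The nonunits of A; totality makes them closed under addition. *)
pose m y := A y /\ forall u, A u -> u * y <> 1.
have mD y z : m y -> m z -> m (y + z).
  have aux y' z' : m y' -> A z' -> y' != 0 -> A (z' / y') -> m (y' + z').
    move=> [Ay ny] Az y0 zy; split; first exact: subringD.
    move=> u Au e; apply: (ny (u * (1 + z' / y'))).
      by apply: AM => //; apply: subringD.
    by rewrite -mulrA mulrDl mul1r divfK.
  move=> my mz; have [y0|y0] := eqVneq y 0; first by rewrite y0 add0r.
  have [z0|z0] := eqVneq z 0; first by rewrite z0 addr0.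
  have [zy|] := Atotal (mulf_neq0 z0 (invr_neq0 y0)).
    by apply: aux => //; case: mz.
  by rewrite invf_div addrC => zy; apply: aux => //; case: my.
have m1 : m (\sum_(i | i != i0) x i / x i0).
  apply: (big_ind m) => //.
    by split=> [|u _ /eqP]; [apply: subring0 | rewrite mulr0 eq_sym oner_eq0].
  move=> i ii0; split=> [|u Au ux]; first by apply: h; rewrite mem_enum.
  have xi : x i != 0.
    by apply/eqP => xi; move/eqP: ux; rewrite xi mul0r mulr0 eq_sym oner_eq0.
  apply: nex; exists i, i0; split=> //; first by apply: h; rewrite mem_enum.
  have d0 : x i / x i0 != 0 by rewrite mulf_neq0 ?invr_eq0.
  suff -> : x i0 / x i = u by [].
  by apply: (mulIf d0); rewrite ux -invf_div mulVf.
have [_] := m1; move/(_ (-1) (subringN A1)); apply.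
rewrite -mulr_suml; move: sum0; rewrite (bigD1 i0) //= => /eqP.
by rewrite addrC addr_eq0 => /eqP ->; rewrite mulN1r mulNr opprK divff.
Qed.

End ValuationRing.

Let t_spec := valuation_uniformizer Hv.

(* A subring of K that contains the valuation ring of v and is maximal among those in
   which the uniformizer of v is not invertible is a valuation ring of K. *)
Lemma dominating_valuation_ring : exists (A : K -> Prop) (t : F),
  [/\ [/\ A 1, forall x y, A x -> A y -> A (x - y) & forall x y, A x -> A y -> A (x * y)],
      forall x, x != 0 -> A x \/ A x^-1,
      forall f, f != 0 -> 0 <= v f -> A (phi f)
    & [/\ t != 0, v t = 1 & ~ A (phi t)^-1]].
Proof.
have [t [t0 vt]] := t_spec.
pose tau := phi t; have tau0 : tau != 0 by rewrite fmorph_eq0.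
pose good (A : K -> Prop) := [/\ A 1, forall x y, A x -> A y -> A (x - y),
   forall x y, A x -> A y -> A (x * y), forall f, vge v 0 f -> A (phi f) & ~ A tau^-1].
pose R (A B : {A | good A}) := `[< forall x, proj1_sig A x -> proj1_sig B x >].
have g0 : good (fun x => exists2 f, vge v 0 f & x = phi f).
  split.
  - by exists 1; rewrite ?rmorph1 // vge_val ?oner_eq0 // (val1 Wv).
  - move=> _ _ [f hf ->] [h hh ->]; exists (f - h); rewrite ?rmorphB //.
    by apply: (vgeD Wv) => //; rewrite (vgeN Wv).
  - move=> _ _ [f hf ->] [h hh ->]; exists (f * h); rewrite ?rmorphM //.
    by rewrite -[0]addr0; apply: (vgeM Wv).
  - by move=> f hf; exists f.
  - case=> f; rewrite /tau -fmorphV => hf /(fmorph_inj phi) fE.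
    by move: hf; rewrite -fE vge_val ?invr_eq0 // (valV Wv) // vt.
(* Zorn's lemma on the good subrings; the image of the valuation ring of v shows that there are
   any. *)
have [|||A Amax] := @classical_sets.ZL_preorder _ (exist good _ g0) R.
- by move=> A; apply/asboolP.
- by move=> A B C /asboolP AB /asboolP BC; apply/asboolP => x /AB/BC.
- move=> C Ctot; have [[A0 CA0]|C0] := lem (exists A, C A); last first.
    by exists (exist good _ g0) => A CA; case: C0; exists A.
  have gU : good (fun x => exists2 A, C A & proj1_sig A x).
    have join A B x y : C A -> C B -> proj1_sig A x -> proj1_sig B y ->
        exists2 D, C D & proj1_sig D x /\ proj1_sig D y.
      move=> CA CB Ax By; have [/asboolP AB|/asboolP BA] := Ctot A B CA CB.
        by exists B => //; split=> //; apply: AB.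
      by exists A => //; split=> //; apply: BA.
    split.
    - by exists A0 => //; case: (proj2_sig A0).
    - move=> x y [A CA Ax] [B CB By]; have [D CD [Dx Dy]] := join _ _ _ _ CA CB Ax By.
      by exists D => //; case: (proj2_sig D) => _ h _ _ _; apply: h.
    - move=> x y [A CA Ax] [B CB By]; have [D CD [Dx Dy]] := join _ _ _ _ CA CB Ax By.
      by exists D => //; case: (proj2_sig D) => _ _ h _ _; apply: h.
    - by move=> f hf; exists A0 => //; case: (proj2_sig A0) => _ _ _ h _; apply: h.
    - by case=> A _; case: (proj2_sig A).
  by exists (exist good _ gU) => A CA; apply/asboolP => x Ax; exists A.
have [A1 AB AM Av ntau] := proj2_sig A; set B := proj1_sig A in A1 AB AM Av ntau.
have At : B tau by apply: Av; rewrite vge_val // vt.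
exists B, t; split=> //; last by move=> f f0 vf; apply: Av; rewrite vge_val.
apply: (valuation_ring_total A1 AB AM tau0 ntau At) => x nx.
apply: contrapT => nP.
(* If 1/tau is not in A[x], then A[x] is good, and maximality of A puts x in A. *)
have gx : good (fun y => exists2 P, coefs_in B P & P.[x] = y).
  split.
  - by exists 1; rewrite ?hornerC //; apply: (coefs_inC A1 AB).
  - move=> _ _ [P hP <-] [Q hQ <-]; exists (P - Q); last by rewrite hornerD hornerN.
    exact: coefs_inB.
  - move=> _ _ [P hP <-] [Q hQ <-]; exists (P * Q); last by rewrite hornerM.
    exact: coefs_inM.
  - move=> f hf; exists (phi f)%:P; last by rewrite hornerC.
    by apply: (coefs_inC A1 AB); apply: Av.
  - by case=> P hP PE; apply: nP; exists P.
apply: nx; have := Amax (exist good _ gx); suff h : R A (exist good _ gx).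
  move=> /(_ h)/asboolP; apply; exists 'X; last by rewrite hornerX.
  exact: (coefs_inX A1 AB).
apply/asboolP => y By; exists y%:P; last by rewrite hornerC.
exact: (coefs_inC A1 AB).
Qed.

(** An element f satisfies a relation of degree at most n over F, two terms of which are associated
    in the dominating ring A. So some f^m with 0 < m <= n is a unit times an element of F, hence a
    unit times a power of tau. As m divides n!, f^(n!) is a unit times tau^(W f) for every nonzero
    f, and [W] is a valuation that restricts to n! v. *)
Lemma extend_valuation : finite_over phi ->
  exists w e, [/\ discrete_valuation (phi \o cstF) w, 0 < e &
    forall f, f != 0 -> w (phi f) = e * v f].
Proof.
move=> [n hn].
have [A [t [[A1 AB AM] Atot Av [t0 vt ntau]]]] := dominating_valuation_ring.
have AX x m : A x -> A (x ^+ m) by apply: (subringX A1 AM).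
have AD x y : A x -> A y -> A (x + y) by apply: (subringD A1 AB).
pose tau := phi t; have tau0 : tau != 0 by rewrite fmorph_eq0.
have At : A tau by apply: Av; rewrite ?vt.
pose N := n`!.
pose rel f (m : int) := A (f ^+ N * tau ^ (- m)) /\ A (f ^+ N * tau ^ (- m))^-1.
have tauX (m : int) : A (tau ^ m) -> 0 <= m.
  case: m => // m; rewrite NegzE -invr_expz -exprnP exprSr => h; exfalso; apply: ntau.
  rewrite -/tau; suff -> : tau^-1 = tau ^+ m * (tau ^+ m * tau)^-1.
    by apply: AM => //; apply: AX.
  by rewrite invfM mulrA divff ?mul1r // expf_neq0.
have unitF f : f != 0 -> A (phi f * tau ^ (- v f)) /\ A (phi f * tau ^ (- v f))^-1.
  move=> f0.
  have -> : phi f * tau ^ (- v f) = phi (f * t ^ (- v f)) by rewrite rmorphM rmorphXz ?unitfE.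
  have h0 : f * t ^ (- v f) != 0 by rewrite mulf_neq0 ?expfz_neq0.
  have vh : v (f * t ^ (- v f)) = 0.
    by rewrite (valM Wv) ?expfz_neq0 // (valXz Wv) // vt mulr1 subrr.
  by split; rewrite -?fmorphV; apply: Av; rewrite ?invr_eq0 // ?(valV Wv) // vh.
have relM f h a b : rel f a -> rel h b -> rel (f * h) (a + b).
  move=> [f1 f2] [h1 h2].
  have e : (f * h) ^+ N * tau ^ (- (a + b)) = (f ^+ N * tau ^ (- a)) * (h ^+ N * tau ^ (- b)).
    by rewrite exprMn opprD expfzDr // mulrACA.
  by rewrite /rel e invfM; split; apply: AM.
have relV f a : rel f a -> rel f^-1 (- a).
  move=> [f1 f2]; rewrite /rel.
  have -> : f^-1 ^+ N * tau ^ (- - a) = (f ^+ N * tau ^ (- a))^-1.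
    by rewrite invfM exprVn invr_expz.
  by rewrite invrK.
have rel_ge0 f a : f != 0 -> A f -> rel f a -> 0 <= a.
  move=> f0 Af [_ f2]; apply: tauX.
  suff -> : tau ^ a = f ^+ N * (f ^+ N * tau ^ (- a))^-1 by apply: AM => //; apply: AX.
  by rewrite invfM mulrA divff ?expf_neq0 // mul1r invr_expz opprK.
have rel_ex f : f != 0 -> exists m, rel f m.
  move=> f0; have [P [P0 sP Pf]] := finite_algebraic f hn.
  have nz i : (phi P`_i * f ^+ i != 0) = (P`_i != 0).
    by rewrite mulf_eq0 fmorph_eq0 expf_eq0 (negPf f0) andbF orbF.
  have sP0 : (0 < size P)%N by rewrite size_poly_gt0.
  have l : ((size P).-1 < size P)%N by rewrite prednK.
  have x1 : phi P`_(Ordinal l) * f ^+ (Ordinal l) != 0.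
    by rewrite nz -lead_coefE lead_coef_eq0.
  have sum0 : \sum_(i < size P) phi P`_i * f ^+ i = 0.
    by rewrite -[RHS]Pf horner_coef size_map_poly; apply: eq_bigr => i _; rewrite coef_map.
  have [i [j [ij]]] := valuation_ring_dominant A1 AB AM Atot x1 sum0.
  wlog ji : i j ij / (j < i)%N.
    move=> H xi xj h1 h2; have : val i != val j := ij; rewrite neq_ltn => /orP[] lt.
      by apply: (H j i) => //; rewrite eq_sym.
    exact: (H i j).
  rewrite !nz => Pi Pj h1 h2.
  pose m := (i - j)%N; pose c := P`_i / P`_j.
  have c0 : c != 0 by rewrite mulf_neq0 ?invr_eq0.
  have e : phi P`_i * f ^+ i / (phi P`_j * f ^+ j) = phi c * f ^+ m.
    rewrite fmorph_div /m expfB // invfM mulrACA //.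
  have m0 : (0 < m)%N by rewrite subn_gt0.
  have mN : (m %| N)%N.
    apply: dvdn_fact; rewrite m0 /=; have := ltn_ord i; rewrite /m; lia.
  have [q Nq] := dvdnP mN.
  (* phi(c) f^m is a unit and phi(c) is a unit times tau^(v c), so f^m is a unit times tau^(- v c);
     raise this to the power q = N / m. *)
  exists (- (v c) * q%:Z).
  have [u1 u2] := unitF c c0.
  have E : f ^+ N * tau ^ (- (- v c * q%:Z)) =
     (phi c * f ^+ m) ^+ q * (phi c * tau ^ (- v c))^-1 ^+ q.
    rewrite -exprMn invfM invr_expz opprK mulrACA divff ?fmorph_eq0 // mul1r exprMn -exprM.
    rewrite [(m * q)%N]mulnC -Nq mulNr opprK; congr (_ * _).
    by rewrite [RHS]exprnP exprz_exp.
  rewrite /rel E -e; split; first by apply: AM; apply: AX.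
  by rewrite invfM -!exprVn invrK invf_div; apply: AM; apply: AX.
have /choice[W WE] : forall f, exists m, f != 0 -> rel f m.
  by move=> f; have [_|/rel_ex[m]] := eqVneq f 0; [exists 0 | exists m].
have rel_uniq f a b : f != 0 -> rel f a -> rel f b -> a = b.
  move=> f0 ra rb; have := rel_ge0 1 _ (oner_neq0 _) A1; rewrite -(divff f0) => h.
  have := h _ (relM _ _ _ _ ra (relV _ _ rb)); have := h _ (relM _ _ _ _ rb (relV _ _ ra)).
  by lia.
have Wge0 f : f != 0 -> A f -> 0 <= W f by move=> f0 Af; apply: rel_ge0 f0 Af (WE f f0).
have WM f h : f != 0 -> h != 0 -> W (f * h) = W f + W h.
  move=> f0 h0; apply: rel_uniq (mulf_neq0 f0 h0) _ _; first exact/WE/mulf_neq0.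
  by apply: relM; apply: WE.
have Wphi f : f != 0 -> W (phi f) = N%:Z * v f.
  move=> f0; have p0 : phi f != 0 by rewrite fmorph_eq0.
  apply: rel_uniq p0 (WE _ p0) _; have [u1 u2] := unitF f f0.
  have E : phi f ^+ N * tau ^ (- (N%:Z * v f)) = (phi f * tau ^ (- v f)) ^+ N.
    by rewrite exprMn -mulrN [N%:Z * _]mulrC -exprz_exp; congr (_ * _).
  by rewrite /rel E -exprVn; split; apply: AX.
have Ww : weak_valuation (phi \o cstF) W.
  split=> // [f h f0 h0 s0|a a0]; last first.
    by rewrite /= Wphi ?fmorph_eq0 // (val_cst Wv) // mulr0.
  have aux f' h' : f' != 0 -> h' != 0 -> f' + h' != 0 -> A (h' / f') -> W f' <= W (f' + h').
    move=> f'0 h'0 s'0 hA.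
    have q0 : 1 + h' / f' != 0.
      by apply: contraNneq s'0 => e; rewrite -[f' + h'](divfK f'0) mulrDl divff // e mul0r.
    have -> : f' + h' = f' * (1 + h' / f') by rewrite mulrDr mulr1 mulrCA divff // mulr1.
    by rewrite WM // lerDl; apply: Wge0 => //; apply: AD.
  rewrite ge_min; have [hA|] := Atot _ (mulf_neq0 h0 (invr_neq0 f0)).
    by rewrite aux.
  by rewrite invf_div [f + h]addrC => hA; rewrite (aux h f) ?orbT // addrC.
have [|w [e [Hw e0 wE]]] := normalize_valuation Ww tau0.
  by rewrite Wphi // vt mulr1 -lt0n fact_gt0.
have wt : N%:Z = e * w tau by rewrite -wE // Wphi // vt mulr1.
exists w, (w tau); split=> //.
  by have := fact_gt0 n; rewrite -/N; nia.
move=> f f0; apply: (mulfI (lt0r_neq0 e0)); rewrite mulrA -wt -wE ?fmorph_eq0 //.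
exact: Wphi.
Qed.

End Extension.

(** * Morphisms of curves and ramification *)

Section Curves.
Variable k : closedFieldType.
Implicit Types X Y Z : curve k.

Lemma ord_weak X (p : point X) : weak_valuation (cst X) (ord p).
Proof. exact: discrete_weak (curve_smooth p). Qed.

Lemma eq_discrete (K : fieldType) (c c' : {rmorphism k -> K}) v :
  c =1 c' -> discrete_valuation c v -> discrete_valuation c' v.
Proof. by move=> e [vM vD vc vt]; split=> // a a0; rewrite -e vc. Qed.

Lemma proportional_discrete (K : fieldType) (c : {rmorphism k -> K}) v w (e : int) :
  discrete_valuation c v -> discrete_valuation c w -> 0 <= e ->
  (forall f, f != 0 -> w f = e * v f) -> forall f, f != 0 -> v f = w f.
Proof.
move=> _ [_ _ _ [t [t0 wt]]] e0 wE f f0.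
have := wE t t0; have := wE f f0; rewrite wt => -> h.
suff -> : e = 1 by rewrite mul1r.
by have [] := leP (v t) 0; nia.
Qed.

(** Functions regular at u p pull back to functions regular at p, which makes the two valuations
    proportional; locality of the pullback makes the factor positive. *)
Lemma ram_exists X Y (u : mor X Y) (p : point X) : exists e : nat, (0 < e)%N /\
  forall f, f != 0 -> ord p (pullback u f) = e%:Z * ord (u p) f.
Proof.
have [f f0 vf|e [e0 eE]] :=
  valuation_ring_proportional (pullback_cst u) (curve_smooth (u p)) (ord_weak p).
  have := @pullback_regular _ _ _ u p f; rewrite /regular_at vf orbT => /(_ isT).
  by rewrite fmorph_eq0 (negPf f0).
have [t [t0 vt]] := valuation_uniformizer (curve_smooth (u p)).
have := @pullback_local _ _ _ u p t; rewrite /vanishes_at vt orbT => /(_ isT).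
rewrite fmorph_eq0 (negPf t0) /= eE // vt mulr1 => eP.
by exists `|e|%N; split=> [|f f0]; [lia | rewrite eE // gez0_abs].
Qed.

Definition ram X Y (u : mor X Y) (p : point X) : nat := projT1 (cid (ram_exists u p)).

Lemma ram_gt0 X Y (u : mor X Y) p : (0 < ram u p)%N.
Proof. by rewrite /ram; case: cid => e []. Qed.

Lemma ramE X Y (u : mor X Y) p f : f != 0 ->
  ord p (pullback u f) = (ram u p)%:Z * ord (u p) f.
Proof. by rewrite /ram; case: cid => e [] /= _; apply. Qed.

Lemma ramification_indexP X Y (u : mor X Y) p e :
  ramification_index u p e <-> ram u p = e.
Proof.
split=> [[t [t0 vt]]|<-]; first by rewrite ramE // vt mulr1 => -[].
have [t [t0 vt]] := valuation_uniformizer (curve_smooth (u p)).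
by exists t; rewrite ramE // vt mulr1.
Qed.

(** Normalized valuations that are proportional agree, and their points coincide by separatedness.
    Images of points and ramification indices can thus be computed from the pullback alone. *)
Lemma ram_unique X Y (u : mor X Y) p q (e : int) : 0 < e ->
  (forall f, f != 0 -> ord p (pullback u f) = e * ord q f) ->
  u p = q /\ (ram u p)%:Z = e.
Proof.
move=> e0 eE; have r0 := ram_gt0 u p.
have [t [t0 vt]] := valuation_uniformizer (curve_smooth (u p)).
have [t' [t'0 vt']] := valuation_uniformizer (curve_smooth q).
have E f : f != 0 -> (ram u p)%:Z * ord (u p) f = e * ord q f.
  by move=> f0; rewrite -ramE // eE.
have re : (ram u p)%:Z = e.
  have := E t t0; have := E t' t'0; rewrite vt vt' !mulr1.
  move: (ord q t) (ord (u p) t') (ram u p) r0 => a b r r0 h1 h2.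
  have a0 : 0 < a by have [] := leP a 0; nia.
  have b0 : 0 < b by have [] := leP b 0; nia.
  by apply/eqP; rewrite eq_le; apply/andP; split; nia.
split=> //; apply: curve_separated => f f0.
by apply: (mulfI (lt0r_neq0 e0)); rewrite -E // re.
Qed.

(** The point u p is the only one whose valuation is proportional to the restriction of ord p along
    the pullback. *)
Lemma mor_ext X Y (u v : mor X Y) : pullback u =1 pullback v -> mor_eq u v.
Proof.
move=> e; split=> // p; have [] // := @ram_unique _ _ u p (v p) (ram v p).
  exact: ram_gt0.
by move=> f f0; rewrite e ramE.
Qed.

Lemma curve_hom_finite X Y (phi : {rmorphism ratfun Y -> ratfun X}) :
  (forall a, phi (cst Y a) = cst X a) -> finite_over phi.
Proof.
move=> h; apply: (function_field_finite h); exact: curve_function_field.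
Qed.

Lemma pullback_finite X Y (u : mor X Y) : finite_over (pullback u).
Proof. exact/curve_hom_finite/pullback_cst. Qed.

(** The image of p is the point whose valuation normalizes the restriction of ord p; it exists by
    properness. *)
Lemma mor_of_hom X Y (phi : {rmorphism ratfun Y -> ratfun X}) :
  (forall a, phi (cst Y a) = cst X a) -> exists u : mor X Y, pullback u = phi.
Proof.
move=> ec; have /choice[g gE] : forall p : point X, exists q : point Y,
    exists e, 0 < e /\ forall f, f != 0 -> ord p (phi f) = e * ord q f.
  move=> p; have [v [e [Hv e0 vE]]] :=
    restrict_valuation ec (curve_smooth p) (curve_hom_finite ec).
  have [q qE] := curve_proper Hv; exists q, e; split=> // f f0.
  by rewrite qE // vE.
have reg p f : regular_at (g p) f -> regular_at p (phi f).
  rewrite /regular_at fmorph_eq0; have [->//|f0 /=] := eqVneq f 0.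
  by have [e [e0 eE]] := gE p; rewrite eE // pmulr_rge0.
have loc p f : vanishes_at (g p) f -> vanishes_at p (phi f).
  rewrite /vanishes_at fmorph_eq0; have [->//|f0 /=] := eqVneq f 0.
  by have [e [e0 eE]] := gE p; rewrite eE // pmulr_rgt0.
by exists (Mor ec reg loc).
Qed.

Lemma iso_pullback X Y (u : mor X Y) : is_iso u ->
  exists v : mor Y X, cancel (pullback u) (pullback v) /\ cancel (pullback v) (pullback u).
Proof. by move=> [v [[_ h1] [_ h2]]]; exists v; split=> f; [apply: h2 | apply: h1]. Qed.

Lemma iso_of_pullback X Y (u : mor X Y) :
  (forall f, exists h, pullback u h = f) -> is_iso u.
Proof.
move=> /hom_bij_inverse[theta [uK Ku]].
have [a|v vE] := @mor_of_hom Y X theta; first by rewrite -(pullback_cst u) uK.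
by exists v; split; apply: mor_ext => f /=; rewrite vE.
Qed.

(** Extend the valuation of q to k(X); properness provides its point. *)
Lemma mor_surjective X Y (u : mor X Y) q : exists p, u p = q.
Proof.
have [w [e [Hw e0 wE]]] := extend_valuation (curve_smooth q) (pullback_finite u).
have [p pE] := curve_proper (@eq_discrete _ (pullback u \o cst Y) (cst X) w (pullback_cst u) Hw); exists p.
have [] // := @ram_unique _ _ u p q e e0.
by move=> f f0; rewrite pE ?fmorph_eq0 // wE.
Qed.

Lemma ram_comp X Y Z (u : mor Y Z) (v : mor X Y) p :
  ram (mor_comp u v) p = (ram v p * ram u (v p))%N.
Proof.
have [] // := @ram_unique _ _ (mor_comp u v) p (u (v p)) (ram v p * ram u (v p))%N.
- by rewrite ltz_nat muln_gt0 !ram_gt0.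
- by move=> f f0 /=; rewrite ramE ?fmorph_eq0 // ramE // PoszM mulrA.
- by move=> _ [].
Qed.

Lemma eq_ram X Y (u v : mor X Y) p : mor_eq u v -> ram u p = ram v p.
Proof.
move=> [up uf]; have [] // := @ram_unique _ _ u p (v p) (ram v p).
- exact: ram_gt0.
- by move=> f f0; rewrite uf ramE.
- by move=> _ [].
Qed.

Lemma iso_ram X Y (u : mor X Y) p : is_iso u -> ram u p = 1%N.
Proof.
move=> [v [h _]]; have := eq_ram p h; rewrite ram_comp.
have -> : ram (mor_id X) p = 1%N.
  have [] // := @ram_unique _ _ (mor_id X) p p 1 => [f f0|_ []//].
  by rewrite mul1r.
by move/eqP; rewrite muln_eq1 => /andP[/eqP].
Qed.

Lemma pullback_P1_const X (u : mor X (P1 k)) a : pullback u (P1_cst k a) = cst X a.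
Proof. exact: (pullback_cst u a). Qed.

Lemma P1_mor X (f : ratfun X) : transcendental_elt (cst X) f ->
  exists u : mor X (P1 k), pullback u (FracField.tofrac 'X) = f.
Proof.
move=> /transcendental_hom[phi [ec eX]].
by have [u uE] := @mor_of_hom X (P1 k) phi ec; exists u; rewrite uE.
Qed.

Lemma P1_mor_XsubC X (u : mor X (P1 k)) (p : point X) (c : k) :
  ord p (pullback u (FracField.tofrac 'X) - cst X c) =
  (ram u p)%:Z * (if u p is Some d then (c == d)%:Z else -1).
Proof.
have -> : pullback u (FracField.tofrac 'X) - cst X c =
    pullback u (FracField.tofrac ('X - c%:P)).
  by rewrite tofracB rmorphB; congr (_ - _); apply: esym (pullback_P1_const u c).
rewrite ramE; last by rewrite tofrac_eq0 polyXsubC_eq0.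
by congr (_ * _); apply: P1_ord_XsubC.
Qed.

(** A nonconstant f is a map to the projective line; its value at p is finite because f has no pole
    there, and it is the residue. *)
Lemma residue_field X (p : point X) f : vge (ord p) 0 f ->
  exists a : k, vge (ord p) 1 (f - cst X a).
Proof.
move=> fr; have [[a ->]|tf] := constant_or_transcendental (cst X) f.
  by exists a; rewrite subrr vge0.
have [u uE] := P1_mor tf; have r0 := ram_gt0 u p.
have := P1_mor_XsubC u p; rewrite uE; case: (u p) => [c|] E.
  by exists c; rewrite /vge E eqxx; apply/orP; right; lia.
have := E 0; rewrite rmorph0 subr0 => fE.
have f0 : f != 0.
  apply: contraPneq tf => -> /(_ 'X); rewrite polyX_eq0 map_polyX hornerX eqxx.
  by move/(_ isT).
by move: fr; rewrite vge_val // fE; lia.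
Qed.

(** * Weak approximation *)

Section Approximation.
Variable X : curve k.
Implicit Types p : point X.

(** If every function regular at q were regular at q', the valuations would be proportional and the
    points equal. The quotient of two functions obtained in this way, one for each order of the
    points, has a zero at p and a pole at p'. *)
Lemma separate_points p p' : p != p' ->
  exists f, [/\ f != 0, 0 < ord p f & ord p' f < 0].
Proof.
have half (q q' : point X) : q != q' -> exists f, [/\ f != 0, 0 <= ord q f & ord q' f < 0].
  move=> qq'; apply: contrapT => nex.
  have [f f0 qf|e [e0 eE]] := @valuation_ring_proportional _ _ _ (cst X) (cst X) idfun
     (fun=> erefl) _ _ (curve_smooth q) (ord_weak q').
    by rewrite leNgt; apply/negP => lt; apply: nex; exists f.
  case/eqP: qq'; apply: curve_separated => f f0.
  exact: (proportional_discrete (curve_smooth q) (curve_smooth q') e0 eE f0).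
move=> pp'; have [g [g0 pg p'g]] := half _ _ pp'.
have [h [h0 p'h ph]] : exists f, [/\ f != 0, 0 <= ord p' f & ord p f < 0].
  by apply: half; rewrite eq_sym.
exists (g / h); rewrite mulf_neq0 ?invr_eq0 //.
by rewrite !(valB_div (ord_weak _)) //; split=> //; lia.
Qed.

Lemma separate_from_list p (s : seq (point X)) : p \notin s ->
  exists f, [/\ f != 0, 0 < ord p f & forall p', p' \in s -> ord p' f < 0].
Proof.
elim: s => [_|q s IH].
  have [t [t0 vt]] := valuation_uniformizer (curve_smooth p).
  by exists t; rewrite vt.
rewrite inE negb_or => /andP[pq /IH[y [y0 py ys]]].
have [qy|qy] := ltP (ord q y) 0.
  by exists y; split=> // p'; rewrite inE => /orP[/eqP ->|/ys].
have [z [z0 pz qz]] := separate_points pq.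
(* Larger than the order of [y] in absolute value at every point of the list, so that z^r and y
   never have poles of equal order there and cannot cancel. *)
pose r := (\sum_(p' <- s) `|ord p' y|).+1%N.
have zr0 : z ^+ r != 0 by rewrite expf_neq0.
have Wq := ord_weak q.
have qzr : ord q (z ^+ r) < 0 by rewrite (valX Wq) //; rewrite /r; nia.
have [s0 qs] : z ^+ r + y != 0 /\ ord q (z ^+ r + y) = ord q (z ^+ r).
  by apply: (val_dominant Wq) => //; rewrite vge_val //; lia.
exists (z ^+ r + y); split=> //.
  have Wp := ord_weak p; apply: (@lt_le_trans _ _ 1) => //; rewrite -vge_val //.
  apply: (vgeD Wp); rewrite vge_val //.
  by rewrite (valX Wp) // /r; nia.
move=> p'; rewrite inE => /orP[/eqP ->|p's]; first by rewrite qs.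
have Wp := ord_weak p'; have p'y := ys _ p's.
have yr : (`|ord p' y| < r)%N.
  by rewrite ltnS (perm_big _ (perm_to_rem p's)) big_cons leq_addr.
have [zy|zy] := ltP (ord p' (z ^+ r)) (ord p' y).
  have [|_ ->] := val_dominant Wp zr0 (h := y); first by rewrite vge_val //; lia.
  lia.
have {}zy : ord p' y < ord p' (z ^+ r).
  rewrite lt_neqAle zy andbT; apply/eqP => e; move: e yr p'y.
  rewrite (valX Wp) //; case: (ord p' z) => m; nia.
have [|_] := val_dominant Wp y0 (h := z ^+ r); first by rewrite vge_val //; lia.
by rewrite addrC => ->.
Qed.

(** If x vanishes at p and has poles on s, then 1 / (1 + x^M) is a unit at p and vanishes to order
    at least M on s; multiply it by t^m. *)
Lemma weak_approximation p (s : seq (point X)) (m N : int) : p \notin s ->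
  exists f, [/\ f != 0, ord p f = m & forall p', p' \in s -> N <= ord p' f].
Proof.
move=> /separate_from_list[x [x0 px xs]].
have [t [t0 pt]] := valuation_uniformizer (curve_smooth p).
pose M := (`|N| + \sum_(p' <- s) `|ord p' (t ^ m)|).+1%N.
have xM0 : x ^+ M != 0 by rewrite expf_neq0.
have Wp := ord_weak p.
have [z0 pz] : 1 + x ^+ M != 0 /\ ord p (1 + x ^+ M) = 0.
  rewrite -(val1 Wp); apply: (val_dominant Wp); rewrite ?oner_eq0 // vge_val //.
  by rewrite (val1 Wp) (valX Wp) // /M; nia.
have tm0 : t ^ m != 0 by rewrite expfz_neq0.
exists (t ^ m / (1 + x ^+ M)); rewrite mulf_neq0 ?invr_eq0 //; split=> //.
  by rewrite (valB_div Wp) // pz (valXz Wp) // pt subr0 mulr1.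
move=> p' p's; have Wp' := ord_weak p'; have xp := xs _ p's.
have tM : (`|N| + `|ord p' (t ^ m)| < M)%N.
  by rewrite ltnS leq_add2l (perm_big _ (perm_to_rem p's)) big_cons leq_addr.
have xpM : ord p' (x ^+ M) <= - M%:Z by rewrite (valX Wp') //; nia.
have [|_] := val_dominant Wp' xM0 (h := 1).
  by rewrite vge_val ?oner_eq0 // (val1 Wp'); lia.
by rewrite addrC => e; rewrite (valB_div Wp') // e; lia.
Qed.

End Approximation.

Section FundamentalInequality.
Variables (X Y : curve k) (u : mor X Y) (n : nat).
Hypothesis un : has_dimension (pullback u) (@full (ratfun X)) n.

(* Weak approximation provides e_i functions of orders 0, ..., e_i - 1 at p_i and of large
   order at the other points of the fibre; they are linearly independent. *)
Lemma sum_ram_le q (s : seq (point X)) : uniq s -> (forall p, p \in s -> u p = q) ->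
  (\sum_(p <- s) ram u p <= n)%N.
Proof.
move=> us sq; pose P (i : 'I_(size s)) := tnth (in_tuple s) i.
have Pinj : injective P by apply/tuple_uniqP.
have Pq i : u (P i) = q by apply: sq; apply: mem_tnth.
pose e i := ram u (P i).
pose N : int := (\max_i e i)%N.
have eN i : (e i)%:Z <= N by rewrite lez_nat (leq_bigmax_cond (F := e)).
have /choice[h hE] : forall ij : {i : 'I_(size s) & 'I_(e i)}, exists f,
    [/\ f != 0, ord (P (tag ij)) f = (tagged ij)%:Z &
        forall l, l != tag ij -> N <= ord (P l) f].
  move=> [i j] /=.
  have [|f [f0 fi fs]] := @weak_approximation X (P i) [seq P l | l <- enum 'I_(size s) & l != i] j N.
    by apply/mapP => -[l]; rewrite mem_filter => /andP[li _] /Pinj il; rewrite il eqxx in li.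
  exists f; split=> // l li; apply: fs; apply/mapP; exists l => //.
  by rewrite mem_filter li mem_enum.
suff hf : free_family (pullback u) h.
  have := dimension_free_le un hf (fun=> I).
  rewrite card_tagged sumnE big_map big_enum /=; apply: leq_trans; apply: eq_leq.
  by rewrite big_tnth; apply: eq_big => [i|i _]; rewrite ?inE ?card_ord.
move=> c c0 ij; apply/eqP/negPn/negP => cij.
(* Among the coefficients of least order mu at q, fix a point i0 that occurs and the least index j0
   occurring there. At P i0 this term has order e mu + j0, strictly below all others: a term of i0
   has a larger index or gains at least e > j0, a term of another point gains at least N >= e. *)
have [[i0 j1] c1 min1] := @Order.TotalTheory.arg_minP _ _ _ ij (fun x => c x != 0)
   (fun x => ord q (c x)) cij.
pose T i (j : 'I_(e i)) : {i : 'I_(size s) & 'I_(e i)} := existT _ i j.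
pose mu := ord q (c (T i0 j1)).
have c1' : (c (T i0 j1) != 0) && (ord q (c (T i0 j1)) == mu) by rewrite c1 eqxx.
have [j0 /andP[cj0 /eqP qj0] min2] := @arg_minnP _ j1
  (fun j => (c (T i0 j) != 0) && (ord q (c (T i0 j)) == mu)) (fun j => val j) c1'.
have Wp := ord_weak (P i0); have Wq := ord_weak q.
pose x ij := pullback u (c ij) * h ij.
have x0E : ord (P i0) (x (T i0 j0)) = (e i0)%:Z * mu + j0%:Z.
  have [h0 hv _] := hE (T i0 j0).
  by rewrite /x (valM Wp) ?fmorph_eq0 // ramE // Pq qj0 hv.
have x0 : x (T i0 j0) != 0.
  by have [h0 _ _] := hE (T i0 j0); rewrite mulf_neq0 ?fmorph_eq0.
have [] : \sum_ij x ij != 0 /\ ord (P i0) (\sum_ij x ij) = ord (P i0) (x (T i0 j0)).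
  apply: (sum_dominant Wp x0) => -[i j] ne; rewrite x0E.
  have [h0 hv hN] := hE (T i j).
  have [cz|cz] := eqVneq (c (T i j)) 0; first by rewrite /x cz rmorph0 mul0r vge0.
  have mc := min1 _ cz; rewrite -/mu in mc.
  rewrite vge_val ?mulf_neq0 ?fmorph_eq0 // (valM Wp) ?fmorph_eq0 // ramE // Pq -/(e i0).
  have e0 : (0 < e i0)%N := ram_gt0 _ _.
  have j0e : (j0 < e i0)%N := ltn_ord j0.
  have [ii|ii] := eqVneq i0 i; last first.
    have := hN i0 ii; have := eN i0; move: (ord q _) mc (ord _ _) => a mc b; nia.
  move: ii j ne h0 hv hN cz mc => <-{i} j ne h0 -> _ cz mc.
  change ((e i0)%:Z * mu + j0%:Z + 1 <= (e i0)%:Z * ord q (c (T i0 j)) + j%:Z).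
  have [mj|mj] := eqVneq (ord q (c (T i0 j))) mu.
    have := min2 j; rewrite cz mj eqxx => /(_ isT) /=.
    rewrite leq_eqVlt => /orP[/eqP jj|]; last by lia.
    by case/eqP: ne; congr (T _ _); apply: val_inj.
  have : mu + 1 <= ord q (c (T i0 j)) by lia.
  by move: (ord q _) => a; nia.
by rewrite /x c0 eqxx.
Qed.

End FundamentalInequality.

End Curves.

(** * The curve of a function field *)

Section CurveOfField.
Variables (k : closedFieldType) (K : fieldType) (c : {rmorphism k -> K}).
Hypothesis cK : function_field c.

(* the value at 0, which is irrelevant for a valuation, is normalized so that valuations that
   agree on K^* are equal *)
Definition place := {v : K -> int | discrete_valuation c v /\ v 0 = 0}.

Lemma place_separated (p q : {classic place}) :
  (forall f, f != 0 -> proj1_sig p f = proj1_sig q f) -> p = q.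
Proof.
case: p q => [v [Hv v0]] [w [Hw w0]] /= e.
have vw : v = w by apply/funext => f; have [->|/e//] := eqVneq f 0; rewrite v0 w0.
by subst w; congr exist; apply: Prop_irrelevance.
Qed.

Lemma place_proper (v : K -> int) : discrete_valuation c v ->
  exists p : {classic place}, forall f, f != 0 -> proj1_sig p f = v f.
Proof.
move=> [vM vD vc [t [t0 vt]]].
pose w f := if f == 0 then 0 else v f.
have wE f : f != 0 -> w f = v f by rewrite /w => /negPf ->.
have Hw : discrete_valuation c w /\ w 0 = 0.
  split; last by rewrite /w eqxx.
  split=> [f h f0 h0|f h f0 h0 s0|a a0|].
  - by rewrite !wE ?mulf_neq0 // vM.
  - by rewrite !wE // vD.
  - by rewrite wE ?fmorph_eq0 // vc.
  - by exists t; rewrite wE.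
by exists (exist _ w Hw) => f f0 /=; rewrite wE.
Qed.

Definition curve_of_field : curve k :=
  @Curve k {classic place} K c (fun p f => proj1_sig p f) cK
    (fun p => proj1 (proj2_sig p)) place_separated place_proper.

End CurveOfField.

(** A list of maximal length. It turns fibres, known only to have bounded size, into finite sets. *)
Lemma bounded_list (T : eqType) (P : T -> Prop) (N : nat) :
  (forall s, uniq s -> (forall x, x \in s -> P x) -> (size s <= N)%N) ->
  exists s, uniq s /\ forall x, x \in s <-> P x.
Proof.
move=> bound.
pose S n := `[< exists s, [/\ uniq s, forall x, x \in s -> P x & size s = n] >].
have exS : exists n, S n by exists 0%N; apply/asboolP; exists [::].
have bS n : S n -> (n <= N)%N by move=> /asboolP[s [us sP <-]]; apply: bound.
case: (ex_maxnP exS bS) => n /asboolP[s [us sP sn]] nmax.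
exists s; split=> // x; split=> [/sP//|Px]; apply/negPn/negP => xs.
suff : S n.+1 by move/nmax; rewrite ltnn.
apply/asboolP; exists (x :: s); rewrite /= xs us sn; split=> // y.
by rewrite inE => /orP[/eqP ->|/sP].
Qed.

(** * Divisors and Riemann's theorem *)

Section Divisors.
Variables (k : closedFieldType) (X : curve k).
Implicit Types (D : {freeg (point X)}) (p : point X) (f : ratfun X).

Definition rr D : ratfun X -> Prop := riemann_roch_space D.

Lemma rrP D f : rr D f <-> forall p, vge (ord p) (- coeff p D) f.
Proof.
split=> [[->|h] p|h]; first exact: vge0.
  by rewrite /vge h orbT.
have [->|f0] := eqVneq f 0; first by left.
by right=> p; rewrite -vge_val.
Qed.

Lemma rr_subspace D : is_subspace (cst X) (rr D).
Proof.
split=> [|a f h /rrP Lf /rrP Lh]; first by left.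
by apply/rrP => p; apply: (vgeD (ord_weak p)) => //; apply: vge_cstM (ord_weak p) _ _ _ _.
Qed.

Lemma rr_mono D D' f : (forall p, coeff p D <= coeff p D') -> rr D f -> rr D' f.
Proof.
by move=> DD /rrP Lf; apply/rrP => p; apply: vge_le (Lf p); rewrite lerN2.
Qed.

(** If f0 is in L(D + p) but not in L(D), its order at p is exactly the least one allowed, so f / f0
    is regular at p for every f in L(D + p). Subtracting the residue times f0 moves f into L(D). *)
Lemma rr_step D p d : has_dimension (cst X) (rr D) d ->
  exists2 d', (d <= d' <= d.+1)%N & has_dimension (cst X) (rr (D + << p >>)) d'.
Proof.
move=> hd; have DD q : coeff q D <= coeff q (D + << p >>).
  by rewrite coeffD coeffU mul1r lerDl; case: eqP.
have [sub|/existsNP[f0 /not_implyP[Lf0 nf0]]] :=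
    lem (forall f, rr (D + << p >>) f -> rr D f).
  exists d; first by rewrite leqnn leqnSn.
  by apply: eq_dimension hd => f; split; [apply: rr_mono | apply: sub].
exists d.+1; first by rewrite leqnSn leqnn.
have [b [bf Lb bs]] := dimension_elim (rr_subspace D) hd.
have Wp := ord_weak p.
have vf0 : f0 != 0 /\ ord p f0 = - coeff p D - 1.
  have f00 : f0 != 0 by apply/eqP => e; apply: nf0; rewrite e; left.
  split=> //; move/rrP: Lf0 => Lf0.
  have := Lf0 p; rewrite vge_val // coeffD coeffU eqxx mulr1 => h1.
  apply/eqP; rewrite eq_le; apply/andP; split; last by lia.
  rewrite leNgt; apply/negP => lt; apply: nf0; apply/rrP => q.
  have [->|qp] := eqVneq q p; first by rewrite vge_val //; lia.
  by have := Lf0 q; rewrite coeffD coeffU eq_sym (negPf qp) mulr0 addr0.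
case: vf0 => f00 vf0.
have -> : d.+1 = #|{: option 'I_d}| by rewrite card_option card_ord.
apply: (dimension_intro (b := oapp b f0)).
- apply: free_family_option bf _ => -[c fE]; apply: nf0; rewrite fE.
  exact: subspace_sum (rr_subspace D) Lb.
- by case=> [i|] /=; [apply: rr_mono (Lb i) | ].
move=> f /rrP Lf.
have /residue_field[a av] : vge (ord p) 0 (f / f0).
  have := vgeM Wp (Lf p) (n := coeff p D + 1) (h := f0^-1).
  rewrite vge_val ?invr_eq0 // (valV Wp) // vf0 coeffD coeffU eqxx mulr1.
  rewrite (_ : _ + (coeff p D + 1) = 0); last by lia.
  by apply; lia.
have /bs[c cE] : rr D (f - cst X a * f0).
  apply/rrP => q; have [->|qp] := eqVneq q p.
    have := vgeM Wp av (n := - coeff p D - 1) (h := f0).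
    rewrite vge_val // vf0 lexx mulrBl divfK // => /(_ isT).
    by rewrite (_ : 1 + _ = - coeff p D) //; lia.
  have Lq h : rr (D + << p >>) h -> vge (ord q) (- coeff q D) h.
    by move=> /rrP/(_ q); rewrite coeffD coeffU eq_sym (negPf qp) mulr0 addr0.
  apply: (vgeD (ord_weak q)); first by apply/Lq/rrP.
  by rewrite (vgeN (ord_weak q)); apply: vge_cstM (ord_weak q) _ _ _ _; apply: Lq.
exists (oapp c a); rewrite sum_option /=.
by rewrite -cE addrC subrK.
Qed.

(** A nonconstant function maps onto the projective line and therefore has a pole. *)
Lemma rr0 f : rr 0 f -> exists a, f = cst X a.
Proof.
move=> /rrP Lf; have [//|tf] := constant_or_transcendental (cst X) f.
have [u uE] := P1_mor tf; have [p pE] := mor_surjective u (None : point (P1 k)).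
have := P1_mor_XsubC u p 0; rewrite uE rmorph0 subr0 pE => vf.
have f0 : f != 0.
  apply: contraPneq tf => -> /(_ 'X); rewrite polyX_eq0 map_polyX hornerX eqxx.
  by move/(_ isT).
have := Lf p; have := ram_gt0 u p.
by rewrite vge_val // vf coeff0; lia.
Qed.

Lemma dimension_rr0 : has_dimension (cst X) (rr 0) 1.
Proof.
rewrite -card_unit; apply: (dimension_intro (b := fun=> 1)).
- move=> c; rewrite (bigD1 tt) //= big1 => [|[]//].
  by rewrite addr0 mulr1 => /eqP; rewrite fmorph_eq0 => /eqP c0 [].
- by move=> _; apply/rrP => p; rewrite vge_val ?oner_eq0 // (val1 (ord_weak p)) coeff0.
- move=> f /rr0[a ->]; exists (fun=> a).
  by rewrite (bigD1 tt) //= big1 => [|[]//]; rewrite addr0 mulr1.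
Qed.

Lemma rr_steps D (s : seq (point X)) d : has_dimension (cst X) (rr D) d ->
  exists2 d', (d <= d' <= d + size s)%N &
    has_dimension (cst X) (rr (D + \sum_(p <- s) << p >>)) d'.
Proof.
move=> hd; elim: s => [|p s [d' dd' hd']].
  by exists d; rewrite ?big_nil ?addr0 // leqnn leq_addr.
have [d'' dd'' hd''] := rr_step p hd'; exists d''; first by rewrite /=; lia.
by rewrite big_cons addrCA addrC.
Qed.

Lemma effective_list D : (forall p, 0 <= coeff p D) ->
  exists2 s : seq (point X), D = \sum_(p <- s) << p >> & deg D = (size s)%:Z.
Proof.
move=> D0; suff [s sE] : exists s : seq (point X), D = \sum_(p <- s) << p >>.
  exists s => //; rewrite sE raddf_sum /= (eq_bigr (fun=> 1)); last by move=> p _; rewrite degU.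
  by rewrite big_const_seq count_predT; elim: (size s) => //= n ->; lia.
rewrite -(freeg_sumE D); elim: (dom D) => [|z s [s' IH]].
  by exists [::]; rewrite !big_nil.
exists (nseq `|coeff z D| z ++ s'); rewrite big_cons big_cat IH /=; congr (_ + _).
rewrite big_nseq -(gez0_abs (D0 z)); move: `|_|%N => n.
elim: n => [|n IHn] /=; first by rewrite freegU0.
by rewrite -IHn freegUD /=; congr << _ *g _ >>; lia.
Qed.

(** L(D) lies in L of the positive part of D, which is reached from L(0) = k one point at a time. *)
Lemma ell_exists D : exists d, has_dimension (cst X) (rr D) d.
Proof.
have pos p : 0 <= coeff p (fgpos D) by rewrite coeff_fgposE le_max lexx.
have [s sE _] := effective_list pos.
have [d _] := rr_steps s dimension_rr0; rewrite add0r -sE => hd.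
have [|d' _ hd'] := dimension_exists (N := d) (rr_subspace D).
  move=> n c cf Lc; rewrite -[n]card_ord; apply: dimension_free_le hd cf _ => i.
  by apply: rr_mono (Lc i) => p; rewrite coeff_fgposE le_max lexx orbT.
by exists d'.
Qed.

Definition ell D : nat := projT1 (cid (ell_exists D)).

Lemma ellP D : has_dimension (cst X) (rr D) (ell D).
Proof. by rewrite /ell; case: cid. Qed.

Lemma ell_eq D d : has_dimension (cst X) (rr D) d -> ell D = d.
Proof. by move=> hd; apply: dimension_uniq (rr_subspace D) (ellP D) hd. Qed.

Lemma ell_ge D (I : finType) (b : I -> ratfun X) : free_family (cst X) b ->
  (forall i, rr D (b i)) -> (#|I| <= ell D)%N.
Proof. by move=> bf Lb; apply: dimension_free_le (ellP D) bf Lb. Qed.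

(** The quantity whose maximum is the genus; by Riemann-Roch it is g minus the dimension of H^1(X,
    O(D)). *)
Definition chi D : int := deg D + 1 - (ell D)%:Z.

Lemma ell_mono D D' : (forall p, coeff p D <= coeff p D') ->
  (ell D <= ell D')%N /\ (ell D')%:Z - (ell D)%:Z <= deg D' - deg D.
Proof.
move=> DD; have [p|s sE sd] := @effective_list (D' - D).
  by rewrite coeffB subr_ge0.
have [d hd] := rr_steps s (ellP D); rewrite -sE addrC subrK => /ell_eq de.
by move: sd; rewrite degB => ->; lia.
Qed.

Lemma chi_mono D D' : (forall p, coeff p D <= coeff p D') -> chi D <= chi D'.
Proof. by move=> /ell_mono[_]; rewrite /chi; lia. Qed.

Lemma ell_effective D : (forall p, 0 <= coeff p D) -> (ell D)%:Z <= deg D + 1.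
Proof.
move=> D0; have [|_] := @ell_mono 0 D; first by move=> p; rewrite coeff0.
by rewrite (ell_eq dimension_rr0) deg0; lia.
Qed.

End Divisors.

Arguments ell {k X} D%_ring_scope.

Section Fibres.
Variables (k : closedFieldType) (X Y : curve k) (u : mor X Y).

Lemma fibre_divisor_exists (q : point Y) : exists D : {freeg (point X)},
  (forall p, coeff p D = if u p == q then (ram u p)%:Z else 0) /\
  forall n, has_dimension (pullback u) (@full _) n -> deg D <= n%:Z.
Proof.
have [d hd] := pullback_finite u.
have [|s [us sP]] := @bounded_list _ (fun p => u p = q) d.
  move=> s us sq; apply: leq_trans (sum_ram_le hd us sq).
  rewrite -sum1_size; apply: leq_sum => p _; exact: ram_gt0.
exists (\sum_(p <- s) << (ram u p)%:Z *g p >>); split=> [p|n hn].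
  rewrite raddf_sum /=; under eq_bigr do rewrite coeffU.
  case: eqP => [pq|pq].
    have ps : p \in s by apply/sP.
    rewrite (perm_big _ (perm_to_rem ps)) big_cons /= eqxx mulr1 big_seq big1 ?addr0 // => x.
    by rewrite mem_rem_uniq // inE => /andP[/negPf -> _]; rewrite mulr0.
  rewrite big_seq big1 // => x /sP xq; case: eqP => [e|_]; last by rewrite mulr0.
  by case: pq; rewrite -e.
rewrite raddf_sum /=; under eq_bigr do rewrite degU.
have sq p : p \in s -> u p = q by move/sP.
have := sum_ram_le hn us sq; rewrite -lez_nat; apply: le_trans.
by elim: (s) => [|p s' IH]; rewrite ?big_nil // !big_cons PoszD lerD2l.
Qed.

Definition fibre_divisor q : {freeg (point X)} := projT1 (cid (fibre_divisor_exists q)).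

Lemma coeff_fibre q p :
  coeff p (fibre_divisor q) = if u p == q then (ram u p)%:Z else 0.
Proof. by rewrite /fibre_divisor; case: cid => D []. Qed.

Lemma deg_fibre_le q n : has_dimension (pullback u) (@full _) n ->
  deg (fibre_divisor q) <= n%:Z.
Proof. by rewrite /fibre_divisor; case: cid => D [] /= _; apply. Qed.

Lemma fibre_ge0 q p : 0 <= coeff p (fibre_divisor q).
Proof. by rewrite coeff_fibre; case: ifP. Qed.

End Fibres.

(** * Degrees of fibres, principal divisors and Riemann's theorem *)

Section RiemannRoch.
Variable k : closedFieldType.
Local Notation kx := {fraction {poly k}}.
Local Notation "x %:F" := (@FracField.tofrac _ x).

(** A coordinate of the projective line whose only pole is simple and lies at q. *)
Definition pole_function (q : option k) : kx :=
  if q is Some c then ('X - c%:P)%:F^-1 else 'X%:F.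

Lemma pole_function_neq0 q : pole_function q != 0.
Proof. by case: q => [c|]; rewrite ?invr_eq0 tofrac_eq0 ?polyXsubC_eq0 ?polyX_eq0. Qed.

Lemma P1_weak (q : option k) : weak_valuation (P1_cst k) (P1_ord q).
Proof. exact: discrete_weak (P1_valuation q). Qed.

Lemma ord_pole_function q q' : P1_ord q' (pole_function q) =
  if q' == q then -1 else if q is Some c then (q' == None)%:Z else (0 : int) + (q' == Some 0)%:Z.
Proof.
case: q => [c|] /=.
  rewrite (valV (P1_weak q')) ?tofrac_eq0 ?polyXsubC_eq0 // P1_ord_XsubC.
  case: q' => [d|] //=; rewrite (inj_eq (@Some_inj _)) eq_sym.
  by case: eqP.
have -> : 'X%:F = ('X - 0%:P)%:F :> kx by rewrite polyC0 subr0.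
rewrite P1_ord_XsubC; case: q' => [d|] //=.
by rewrite (inj_eq (@Some_inj _)) eq_sym add0r.
Qed.

Lemma pole_function_free q m : free_family (P1_cst k) (fun i : 'I_m => pole_function q ^+ i).
Proof.
have H := @powers_free k _ _ (P1_cst k) (P1_cst k).
apply: (H _ _ m (P1_weak q) (pole_function_neq0 q)).
  by rewrite ord_pole_function eqxx.
exact: val_cst (P1_weak q).
Qed.

Variable X : curve k.
Implicit Types (D : {freeg (point X)}) (f : ratfun X).

Lemma rrM D D' f h : rr D f -> rr D' h -> rr (D + D') (f * h).
Proof.
move=> /rrP Lf /rrP Lh; apply/rrP => p; rewrite coeffD opprD.
exact: (vgeM (ord_weak p)).
Qed.

Lemma rr_one : rr (0 : {freeg (point X)}) 1.
Proof. by apply/rrP => p; rewrite vge_val ?oner_eq0 // (val1 (ord_weak p)) coeff0. Qed.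

Lemma rrX D f n : rr D f -> rr (D *+ n) (f ^+ n).
Proof.
move=> Lf; elim: n => [|n IH]; first by rewrite mulr0n expr0; apply: rr_one.
by rewrite mulrS exprS; apply: rrM.
Qed.

Lemma mulrn_coeff_mono D m m' p : (forall p, 0 <= coeff p D) -> (m <= m')%N ->
  coeff p (D *+ m) <= coeff p (D *+ m').
Proof. by move=> D0 mm; rewrite !coeffMn; apply: ler_wpMn2l. Qed.

Lemma rr_pole_function (u : mor X (P1 k)) q :
  rr (fibre_divisor u q) (pullback u (pole_function q)).
Proof.
apply/rrP => p; rewrite vge_val ?fmorph_eq0 ?pole_function_neq0 // ramE ?pole_function_neq0 //.
rewrite coeff_fibre; have := ord_pole_function q (u p) => /= ->.
have := ram_gt0 u p; case: ifP => _; first by rewrite mulrN1.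
by case: (q) => [c|] r0; nia.
Qed.

Lemma pole_bound f : exists D, (forall p, 0 <= coeff p D) /\ rr D f.
Proof.
have [[a ->]|tf] := constant_or_transcendental (cst X) f.
  exists 0; split=> [p|]; first by rewrite coeff0.
  by apply/rrP => p; rewrite coeff0; apply: vge_cst (ord_weak p) a.
have [u uE] := P1_mor tf; exists (fibre_divisor u None); split; first exact: fibre_ge0.
by have := rr_pole_function u None; rewrite uE.
Qed.

Lemma pole_bound_family n (b : 'I_n -> ratfun X) :
  exists D, (forall p, 0 <= coeff p D) /\ forall i, rr D (b i).
Proof.
have /choice[C CE] i := pole_bound (b i); exists (\sum_i C i); split=> [p|i].
  by rewrite raddf_sum sumr_ge0 // => i _; have [h _] := CE i; apply: h.
have [_] := CE i; apply: rr_mono => p; rewrite raddf_sum (bigD1 i) //= lerDl.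
by rewrite sumr_ge0 // => j _; have [h _] := CE j; apply: h.
Qed.

(* If b is a basis of k(X) over k(x) and r has its only pole at q, the products r^i b_j
   with i <= m are independent functions with poles bounded by m u^*(q) + C. *)
Lemma ell_growth (u : mor X (P1 k)) q n : has_dimension (pullback u) (@full _) n ->
  exists C, (forall p, 0 <= coeff p C) /\
    forall m, (m.+1 * n <= ell (fibre_divisor u q *+ m + C))%N.
Proof.
move=> /(dimension_elim (subspace_full _))[b [bf _ _]].
have [C [C0 Cb]] := pole_bound_family b; exists C; split=> // m.
have := ell_ge (D := fibre_divisor u q *+ m + C) (I := {: 'I_m.+1 * 'I_n})
  (b := fun ij => pullback u (pole_function q ^+ ij.1) * b ij.2).
rewrite card_prod !card_ord; apply.
  have h := free_tower (@pole_function_free q m.+1) bf.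
  move=> c c0; apply: h; rewrite -[RHS]c0; apply: eq_bigr => ij _ /=; congr (_ * _).
  exact: (pullback_P1_const u).
move=> [i j] /=; apply: rrM => //; rewrite rmorphXn.
apply: rr_mono (rrX i (rr_pole_function u q)) => p.
by apply: mulrn_coeff_mono; [apply: fibre_ge0 | rewrite -ltnS].
Qed.

(** One inequality is the fundamental one. For the other, l(m B + C) is at least (m + 1) n but at
    most m deg B + deg C + 1, which for large m is impossible unless deg B >= n. *)
Lemma deg_fibre (u : mor X (P1 k)) q n : has_dimension (pullback u) (@full _) n ->
  deg (fibre_divisor u q) = n%:Z.
Proof.
move=> hn; apply/eqP; rewrite eq_le deg_fibre_le //=.
have [C [C0 hC]] := ell_growth q hn.
have [s _ dC] := effective_list C0.
have [s' _ dB] := effective_list (fibre_ge0 u q).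
rewrite leNgt; apply/negP => lt; pose m := (size s).+1.
have pos p : 0 <= coeff p (fibre_divisor u q *+ m + C).
  by rewrite coeffD coeffMn addr_ge0 // mulrn_wge0 // fibre_ge0.
have h2 := hC m; have h1 := ell_effective pos; rewrite degD degMn in h1.
rewrite dB -mulr_natr natz dC in h1; rewrite dB in lt.
by move: (ell _) h1 h2 => l h1 h2; rewrite /m in h1 h2; nia.
Qed.

(** The zeros and the poles of a nonconstant f are the fibres over 0 and oo of the map it defines,
    and these have the same degree. *)
Lemma principal_divisor f : f != 0 ->
  exists D, (forall p, coeff p D = ord p f) /\ deg D = 0.
Proof.
move=> f0; have [[a fa]|tf] := constant_or_transcendental (cst X) f.
  exists 0; rewrite deg0; split=> // p; rewrite coeff0 fa (val_cst (ord_weak p)) //.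
  by apply: contraNneq f0 => a0; rewrite fa a0 rmorph0.
have [u uE] := P1_mor tf; have [n hn] := pullback_finite u.
exists (fibre_divisor u (Some 0 : point (P1 k)) - fibre_divisor u None).
rewrite degB !(deg_fibre _ hn) subrr; split=> // p.
rewrite coeffB !coeff_fibre; have := P1_mor_XsubC u p 0.
rewrite uE rmorph0 subr0 => ->; case: (u p) => [c|] //=; last by rewrite mulrN1 sub0r.
by rewrite subr0 (inj_eq (@Some_inj _)) eq_sym; case: eqP; rewrite ?mulr1 ?mulr0.
Qed.

Lemma dimension_scale (K : fieldType) (c : {rmorphism k -> K}) (L L' : K -> Prop) (f : K) n :
  f != 0 -> (forall h, L' h <-> L (h * f)) -> has_dimension c L n -> has_dimension c L' n.
Proof.
move=> f0 LL' [b [Lb bE]]; exists (fun i => b i / f); split=> [i|h /LL' Lh].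
  by apply/LL'; rewrite divfK.
have [r [rE ru]] := bE _ Lh.
have sumE s : (h == \sum_(i < n) c (s 0 i) * (b i / f)) = (h * f == \sum_(i < n) c (s 0 i) * b i).
  under eq_bigr do rewrite mulrA.
  by rewrite -mulr_suml -(inj_eq (mulIf f0)) divfK.
exists r; split; first by apply/eqP; rewrite sumE rE.
by move=> s /eqP; rewrite sumE => /eqP/ru.
Qed.

(** Multiplication by f carries L(D') onto L(D), and div f has degree 0. *)
Lemma chi_principal D D' f : f != 0 -> (forall p, coeff p D' = coeff p D + ord p f) ->
  chi D' = chi D.
Proof.
move=> f0 DE; have [P [PE P0]] := principal_divisor f0.
have -> : D' = D + P by apply/eqP/freeg_eqP => p; rewrite DE coeffD PE.
rewrite /chi degD P0 addr0; congr (_ - _%:Z); apply: ell_eq.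
apply: (dimension_scale f0 _ (ellP D)) => h.
have [->|h0] := eqVneq h 0; first by rewrite mul0r; split=> _; left.
have e p : vge (ord p) (- coeff p (D + P)) h = vge (ord p) (- coeff p D) (h * f).
  rewrite !vge_val ?mulf_neq0 // (valM (ord_weak p)) // coeffD PE.
  by rewrite opprD lerBlDr.
by split=> /rrP Lh; apply/rrP => p; have := Lh p; rewrite e.
Qed.

(** [ell_growth] treats m B + C. Removing C and then the negative part of D lowers l by at most the
    degrees removed, and what is left is bounded by m B + D. *)
Lemma chi_bounded (u : mor X (P1 k)) n D : has_dimension (pullback u) (@full _) n ->
  exists N, forall m, (ell (fibre_divisor u None *+ m + D))%:Z >= m%:Z * n%:Z - N.
Proof.
move=> hn; have [C [C0 hC]] := ell_growth None hn.
exists (deg C + deg (fgneg D)) => m; set B := fibre_divisor u None.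
have [h1 h1'] : (ell (B *+ m) <= ell (B *+ m + C))%N /\
    (ell (B *+ m + C))%:Z - (ell (B *+ m))%:Z <= deg (B *+ m + C) - deg (B *+ m).
  by apply: ell_mono => p; rewrite coeffD lerDl.
have [h2 h2'] : (ell (B *+ m - fgneg D) <= ell (B *+ m))%N /\
    (ell (B *+ m))%:Z - (ell (B *+ m - fgneg D))%:Z <= deg (B *+ m) - deg (B *+ m - fgneg D).
  by apply: ell_mono => p; rewrite coeffB lerBlDr lerDl; have /fgposP := fgneg_le0 D; apply.
have [h3 _] : (ell (B *+ m - fgneg D) <= ell (B *+ m + D))%N /\
    (ell (B *+ m + D))%:Z - (ell (B *+ m - fgneg D))%:Z <= deg (B *+ m + D) - deg (B *+ m - fgneg D).
  apply: ell_mono => p; rewrite coeffB coeffD lerD2l coeff_fgnegE opprK.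
  by rewrite ge_min lexx orbT.
have := hC m; rewrite -/B; move: h1' h2'; rewrite degD degB.
by move: (ell _) (ell _) (ell _) (ell _) h1 h2 h3 => *; nia.
Qed.

(** Up to linear equivalence every D is at most m B + D1 for large m: l(m B + D1 - D) is positive by
    [chi_bounded], and a nonzero b in that space gives D <= m B + D1 + div b. As [chi] is monotone
    and invariant under linear equivalence, its maximum is reached along m B + D1. *)
Lemma genusP (u : mor X (P1 k)) n D1 g : has_dimension (pullback u) (@full _) n -> (0 < n)%N ->
  has_genus X g <->
  exists m0, forall m, (m0 <= m)%N -> chi (fibre_divisor u None *+ m + D1) = g%:Z.
Proof.
move=> hn n0; set B := fibre_divisor u None.
have B0 p : 0 <= coeff p B := fibre_ge0 _ _ _.
have dominated D : exists m0, forall m, (m0 <= m)%N -> chi D <= chi (B *+ m + D1).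
  have [N hN] := chi_bounded (D1 - D) hn; exists `|N|.+1%N => m Nm.
  have : (0 < ell (B *+ m + (D1 - D)))%N.
    by have := hN m; rewrite -/B; move: (ell _) => l; nia.
  have [b [bf Lb _]] := dimension_elim (rr_subspace _) (ellP (B *+ m + (D1 - D))).
  move=> l0; pose i := Ordinal l0; have b0 : b i != 0.
    apply/eqP => b0; have := bf (fun j => (j == i)%:R); rewrite (bigD1 i) //= b0 mulr0.
    rewrite add0r big1 => [/(_ erefl i)/eqP|j /negPf ->].
      by rewrite eqxx oner_eq0.
    by rewrite rmorph0 mul0r.
  have [P [PE P0]] := principal_divisor b0.
  rewrite -(@chi_principal (B *+ m + D1) (B *+ m + D1 + P) _ b0); last first.
    by move=> p; rewrite coeffD PE.
  apply: chi_mono => p; have /rrP/(_ p) := Lb i; rewrite vge_val // !coeffD coeffN PE.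
  by lia.
split=> [[gmax [D [l [hl lE]]]]|[m0 mE]].
  have gD D' : chi D' <= g%:Z by apply: gmax (ellP D').
  have Dg : chi D = g%:Z by rewrite -lE /chi (ell_eq hl).
  have [m0 hm] := dominated D; exists m0 => m m0m.
  by apply/eqP; rewrite eq_le gD -Dg hm.
split=> [D l hl|]; last first.
  by exists (B *+ m0 + D1), (ell (B *+ m0 + D1)); split; [apply: ellP | rewrite -(mE m0)].
have [m1 hm] := dominated D; rewrite -(ell_eq hl) -/(chi D).
have := hm (maxn m0 m1); rewrite leq_maxr => /(_ isT).
by rewrite mE ?leq_maxl.
Qed.

(* Two different pencils of degree two bound the genus by one: the functions x^i and x^i y,
   i <= m, are independent and have their poles in m (x)_oo + (y)_oo, of degree 2m + 2. *)
Lemma degree_two_subfield (u v : mor X (P1 k)) g : has_genus X g -> (2 <= g)%N ->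
  has_dimension (pullback u) (@full _) 2 -> has_dimension (pullback v) (@full _) 2 ->
  forall r, exists s, pullback v r = pullback u s.
Proof.
move=> hg g2 hu hv.
suff [s sE] : exists s, pullback v 'X%:F = pullback u s.
  have [|th thE] := @hom_factor _ _ _ (pullback u) (pullback v).
    move=> r; rewrite [r]fracE fmorph_div.
    have poly P : exists s, pullback v P%:F = pullback u s.
      elim/poly_ind: P => [|P c [t tE]]; first by exists 0; rewrite tofrac0 !rmorph0.
      exists (t * s + P1_cst k c).
      rewrite tofracD tofracM !rmorphD !rmorphM tE sE; congr (_ + _).
      by rewrite (pullback_P1_const u) -(pullback_P1_const v).
    have [n ->] := poly \n_(repr r); have [d ->] := poly \d_(repr r).
    by exists (n / d); rewrite fmorph_div.
  by move=> r; exists (th r); rewrite thE.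
apply: contrapT => ns.
pose y := pullback v 'X%:F.
have fy : free_family (pullback u) (fun b : bool => if b then y else 1).
  move=> c; rewrite big_bool /= mulr1 => c0.
  have ct : c true = 0.
    apply/eqP/negPn/negP => ct; apply: ns; exists (- c false / c true).
    have pt : pullback u (c true) != 0 by rewrite fmorph_eq0.
    apply: (mulfI pt); rewrite -rmorphM [c true * _]mulrC divfK // rmorphN -/y.
    by apply/eqP; rewrite -addr_eq0 c0.
  have cf : c false = 0.
    by move/eqP: c0; rewrite ct rmorph0 mul0r add0r fmorph_eq0 => /eqP.
  by case.
(* For this D the degree is 2 m0 + 2, and l(D) >= 2 m0 + 2 gives chi D <= 1, against chi D = g >=
   2. *)
have /(genusP (fibre_divisor v None) _ hu)[//|m0 /(_ m0 (leqnn _))] := hg.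
set D := _ + _ => chiE.
have := ell_ge (D := D) (I := {: 'I_m0.+1 * bool})
  (b := fun ij => pullback u (pole_function None ^+ ij.1) * (if ij.2 then y else 1)).
rewrite card_prod card_ord card_bool => h.
have : (m0.+1 * 2 <= ell D)%N.
  apply: h => [c c0|[i b] /=].
    have hf := free_tower (@pole_function_free None m0.+1) fy.
    apply: hf; rewrite -[RHS]c0; apply: eq_bigr => ij _ /=; congr (_ * _).
    exact: (pullback_P1_const u).
  apply: rrM; last first.
    case: b; first exact: (rr_pole_function v None).
    by apply: rr_mono rr_one => p; rewrite coeff0 fibre_ge0.
  rewrite rmorphXn; apply: rr_mono (rrX i (rr_pole_function u None)) => p.
  by apply: mulrn_coeff_mono; [apply: fibre_ge0 | rewrite -ltnS].
move: chiE; rewrite /chi {1}/D degD degMn (deg_fibre None hu) (deg_fibre None hv).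
by move: (ell D) => l; rewrite -mulr_natr natz; nia.
Qed.

End RiemannRoch.

(** Division with remainder: R has minimal degree, so every relation of x is a multiple of R and
    also holds for y. This is the kernel condition of [hom_extend]. *)
Lemma minimal_kernel (F L M : fieldType) (phi : {rmorphism F -> L}) (psi : {rmorphism F -> M})
    (R : {poly F}) (x : L) (y : M) : R != 0 ->
  (map_poly phi R).[x] = 0 -> (map_poly psi R).[y] = 0 ->
  (forall P : {poly F}, (size P < size R)%N -> (map_poly phi P).[x] = 0 -> P = 0) ->
  forall P : {poly F}, (map_poly phi P).[x] = 0 -> (map_poly psi P).[y] = 0.
Proof.
move=> R0 Rx Ry minR P; rewrite (divp_eq P R) !rmorphD !rmorphM !hornerD !hornerM /= Rx Ry.
rewrite !mulr0 !add0r => /minR -> //; last by rewrite ltn_modp.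
by rewrite rmorph0 horner0.
Qed.

Lemma hom_eq_gen (F L M : fieldType) (phi : {rmorphism F -> L}) (x : L)
    (chi psi : {rmorphism L -> M}) :
  (forall f, exists P : {poly F}, f = (map_poly phi P).[x]) ->
  (forall a, chi (phi a) = psi (phi a)) -> chi x = psi x -> chi =1 psi.
Proof.
move=> gen ef ex f; have [P ->] := gen f.
rewrite -!horner_map ex -!map_poly_comp; congr (_.[_]).
by apply: eq_map_poly => a; apply: ef.
Qed.

(** * Cardano's formula and S_3-extensions *)

Section Cubic.
Variables (F L : fieldType) (phi : {rmorphism F -> L}) (zeta : F).
Hypotheses (zetaE : zeta ^+ 2 + zeta + 1 = 0) (char3 : 3%:R != 0 :> F).

Let z : L := phi zeta.

Lemma root3Z : z ^+ 2 + z + 1 = 0.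
Proof. by rewrite -rmorphXn -(rmorph1 phi) -!rmorphD zetaE rmorph0. Qed.

Lemma root3E : z ^+ 2 = - z - 1.
Proof. by rewrite -[RHS]addr0 -root3Z; ring. Qed.

Lemma root3X : z ^+ 3 = 1.
Proof.
have -> : z ^+ 3 = (z - 1) * (z ^+ 2 + z + 1) + 1 by ring.
by rewrite root3Z mulr0 add0r.
Qed.

Lemma root3X4 : z ^+ 4 = z.
Proof. by rewrite exprS root3X mulr1. Qed.

Lemma three_neq0 : 3%:R != 0 :> L.
Proof. by rewrite -(rmorph_nat phi) fmorph_eq0. Qed.

Lemma root3_neq0 : z != 0.
Proof. by apply/eqP => e; have /eqP := root3X; rewrite e expr0n /= eq_sym oner_eq0. Qed.

Lemma root3_neq1 : z != 1.
Proof.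
apply/eqP => e; have := root3E; rewrite e expr1n => h; have := three_neq0.
by rewrite (_ : 3%:R = 1 - (- 1 - 1) :> L); [rewrite -h subrr eqxx | ring].
Qed.

Lemma cube_roots (x y : L) : x ^+ 3 = y ^+ 3 -> exists i : 'I_3, x = z ^+ i * y.
Proof.
move=> e; have : (x - y) * ((x - z * y) * (x - z ^+ 2 * y)) = 0.
  have -> : (x - y) * ((x - z * y) * (x - z ^+ 2 * y)) =
      x ^+ 3 - z ^+ 3 * y ^+ 3 - (z ^+ 2 + z + 1) * (x ^+ 2 * y - z * x * y ^+ 2) by ring.
  by rewrite root3X e root3E; ring.
move/eqP; rewrite !mulf_eq0 !subr_eq0 => /orP[/eqP ->|/orP[]/eqP ->].
- by exists ord0; rewrite mul1r.
- by exists (inord 1); rewrite inordK.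
- by exists (inord 2); rewrite inordK.
Qed.

Section Eigenvector.
Variables (sigma : {rmorphism L -> L}) (sphi : forall a, sigma (phi a) = phi a).

Lemma sigma_root3 : sigma z = z. Proof. exact: sphi. Qed.

(** The Lagrange resolvents r1 and r2 of x are eigenvectors for z and z^2, and the square of an
    eigenvector for z^2 is one for z^4 = z. Both cannot vanish: r2 - r1 = (2 z + 1) (y - y') with (2
    z + 1)^2 = -3. *)
Lemma eigenvector_exists (x : L) : (forall y, sigma (sigma (sigma y)) = y) -> sigma x != x ->
  exists u, u != 0 /\ sigma u = z * u.
Proof.
move=> s3 sx; set y := sigma x; set y' := sigma y.
pose r1 := x + (- z - 1) * y + z * y'; pose r2 := x + z * y + (- z - 1) * y'.
have sz : sigma (- z - 1) = - z - 1 by rewrite rmorphB rmorphN rmorph1 sigma_root3.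
have s1 : sigma r1 = z * r1.
  transitivity (y + (- z - 1) * y' + z * x + (z ^+ 2 + z + 1) * (y' - y)).
    by rewrite root3Z mul0r addr0 !rmorphD !rmorphM sz sigma_root3 s3.
  by rewrite /r1; ring.
have s2 : sigma r2 = (- z - 1) * r2.
  transitivity (y + z * y' + (- z - 1) * x + (z ^+ 2 + z + 1) * (y' - y)).
    by rewrite root3Z mul0r addr0 !rmorphD !rmorphM sz sigma_root3 s3.
  by rewrite /r2; ring.
have [r10|] := eqVneq r1 0; last by exists r1.
have [r20|r20] := eqVneq r2 0; last first.
  exists (r2 ^+ 2); rewrite expf_neq0 // rmorphXn s2 /=; split=> //.
  rewrite exprMn -root3E -exprM /=.
  by rewrite root3X4.
have d : 2%:R * z + 1 != 0.
  apply/eqP => e; have := three_neq0.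
  have -> : 3%:R = 4%:R * (z ^+ 2 + z + 1) - (2%:R * z + 1) ^+ 2 by ring.
  by rewrite e root3Z mulr0 expr0n subr0 eqxx.
case/eqP: sx; have : y = y'.
  apply: (mulfI d); apply/eqP; rewrite -subr_eq0; apply/eqP.
  by rewrite (_ : _ - _ = r2 - r1); [rewrite r10 r20 subrr | rewrite /r1 /r2; ring].
by move=> /(congr1 sigma)/(congr1 sigma); rewrite /y' /y !s3 => /esym.
Qed.

Variables (u : L) (u0 : u != 0) (su : sigma u = z * u).

(** 1, u and u^2 belong to the distinct eigenvalues 1, z and z^2 of sigma; combinations of the
    relation with its images under sigma isolate each term up to the factor 3. *)
Lemma eigen_free q0 q1 q2 : sigma q0 = q0 -> sigma q1 = q1 -> sigma q2 = q2 ->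
  q0 + q1 * u + q2 * u ^+ 2 = 0 -> [/\ q0 = 0, q1 = 0 & q2 = 0].
Proof.
move=> h0 h1 h2; set U1 := q1 * u; set U2 := q2 * u ^+ 2 => e0.
have s1 : sigma U1 = z * U1 by rewrite rmorphM h1 su mulrCA.
have s2 : sigma U2 = (- z - 1) * U2.
  by rewrite rmorphM rmorphXn h2 su exprMn root3E mulrCA.
have sz : sigma (- z - 1) = - z - 1 by rewrite rmorphB rmorphN rmorph1 sigma_root3.
have e1 : q0 + z * U1 + (- z - 1) * U2 = 0.
  by rewrite -[RHS](rmorph0 sigma) -e0 !rmorphD h0 s1 s2.
have e2 : q0 + (- z - 1) * U1 + z * U2 = 0.
  rewrite -[RHS](rmorph0 sigma) -e1 !rmorphD h0 (rmorphM sigma z) (rmorphM sigma (- z - 1)).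
  rewrite s1 s2 sigma_root3 sz.
  rewrite (_ : (- z - 1) * ((- z - 1) * U2) = z * U2 + (z ^+ 2 + z + 1) * U2); last by ring.
  by rewrite root3Z mul0r addr0 mulrA -expr2 root3E.
have n3 := three_neq0.
have q00 : q0 = 0.
  apply: (mulfI n3); rewrite mulr0; transitivity ((q0 + U1 + U2) +
    (q0 + z * U1 + (- z - 1) * U2) + (q0 + (- z - 1) * U1 + z * U2)); first by ring.
  by rewrite e0 e1 e2 !addr0.
have q10 : q1 = 0.
  apply: (mulIf u0); rewrite mul0r; apply: (mulfI n3); rewrite mulr0 -/U1.
  transitivity ((q0 + U1 + U2) + (- z - 1) * (q0 + z * U1 + (- z - 1) * U2)
    + z * (q0 + (- z - 1) * U1 + z * U2) + (z ^+ 2 + z + 1) * (2%:R * U1 - 2%:R * U2)).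
    by ring.
  by rewrite e0 e1 e2 root3Z !mulr0 mul0r !addr0.
split=> //; move/eqP: e0; rewrite /U1 q00 q10 mul0r !add0r mulf_eq0 expf_eq0 (negPf u0) orbF.
by move/eqP.
Qed.

End Eigenvector.

(* L = F(u) has degree six over F and u^3, (b/u)^3 are the roots of T^2 - c T + b^3: by
   Cardano's formula L is the splitting field of W^3 = 3 b W + c, with root w = u + b/u. *)
Record cardano (b c : F) (u : L) : Prop := Cardano {
  cardano_b : b != 0;
  cardano_rel : u ^+ 6 - phi c * u ^+ 3 + phi b ^+ 3 = 0;
  cardano_gen : forall f, exists2 P : {poly F}, (size P <= 6)%N & f = (map_poly phi P).[u];
  cardano_free : forall P : {poly F}, (size P <= 6)%N -> (map_poly phi P).[u] = 0 -> P = 0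
}.

(** Grouped by exponents mod 3: the coefficients of 1, u, u^2 lie in F(u^3). When sigma multiplies u
    by z, it fixes these coefficients, and the three groups are eigenvectors. *)
Lemma horner6 (P : {poly F}) (u : L) : (size P <= 6)%N -> (map_poly phi P).[u] =
  (phi P`_0 + phi P`_3 * u ^+ 3) + (phi P`_1 + phi P`_4 * u ^+ 3) * u
  + (phi P`_2 + phi P`_5 * u ^+ 3) * u ^+ 2.
Proof.
move=> sP; rewrite (@horner_coef_wide _ 6) ?size_map_poly //.
by rewrite !big_ord_recl big_ord0 !coef_map /= /bump /=; ring.
Qed.

Lemma free6 (u : L) : (forall P : {poly F}, (size P <= 6)%N -> (map_poly phi P).[u] = 0 -> P = 0) <->
  free_family phi (fun i : 'I_6 => u ^+ i).
Proof.
have polyE (c : 'I_6 -> F) : exists P : {poly F}, [/\ (size P <= 6)%N, forall i : 'I_6, P`_i = c i &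
    (map_poly phi P).[u] = \sum_i phi (c i) * u ^+ i].
  pose P := \poly_(i < 6) (if insub i is Some j then c j else 0).
  have cP (i : 'I_6) : P`_i = c i by rewrite coef_poly ltn_ord valK.
  exists P; split=> //; first exact: size_poly.
  rewrite (@horner_coef_wide _ 6) ?size_map_poly ?size_poly //.
  by apply: eq_bigr => i _; rewrite coef_map cP.
split=> [fr c c0 i|fr P sP].
  have [P [sP PE Pu]] := polyE c; rewrite -PE.
  by rewrite (fr P sP) ?coef0 // Pu.
rewrite (@horner_coef_wide _ 6) ?size_map_poly // => e.
apply/polyP => i; rewrite coef0; have [i6|i6] := ltnP i 6; last first.
  by rewrite nth_default // (leq_trans sP).
have := fr (fun i : 'I_6 => P`_i) _ (Ordinal i6); apply.
by rewrite -[RHS]e; apply: eq_bigr => j _; rewrite coef_map.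
Qed.

Definition cardano_poly (b c : F) : {poly F} := 'X^6 + ((b ^+ 3)%:P - c%:P * 'X^3).

Lemma size_cardano_poly b c : size (cardano_poly b c) = 7.
Proof.
rewrite size_polyDl size_polyXn // ltnS; apply: leq_trans (size_polyD _ _) _.
rewrite geq_max size_polyN; apply/andP; split; first by apply: leq_trans (size_polyC_leq1 _) _.
by rewrite mul_polyC; apply: leq_trans (size_scale_leq _ _) _; rewrite size_polyXn.
Qed.

Lemma horner_cardano_poly (M : fieldType) (psi : {rmorphism F -> M}) b c x :
  (map_poly psi (cardano_poly b c)).[x] = x ^+ 6 - psi c * x ^+ 3 + psi b ^+ 3.
Proof.
rewrite rmorphD rmorphB (rmorphM _ c%:P) /= !map_polyXn !map_polyC.
by rewrite 2!hornerD hornerN hornerCM !hornerXn hornerC; ring.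
Qed.

Section CardanoTheory.
Variables (b c : F) (u : L) (Hu : cardano b c u).

Lemma cardano_u0 : u != 0.
Proof.
apply/eqP => e; have /eqP := cardano_rel Hu.
by rewrite e !expr0n /= mulr0 subrr add0r expf_eq0 fmorph_eq0 (negPf (cardano_b Hu)).
Qed.

Lemma cardano_dimension : has_dimension phi (@full L) 6.
Proof.
rewrite -[6%N]card_ord.
apply: (dimension_intro (b := fun i : 'I_6 => u ^+ i)) => //.
  by apply/free6; apply: (cardano_free Hu).
move=> f _; have [P sP ->] := cardano_gen Hu f; exists (fun i : 'I_6 => P`_i).
rewrite (@horner_coef_wide _ 6) ?size_map_poly //.
by apply: eq_bigr => i _; rewrite coef_map.
Qed.

(** Freeness of the powers below the sixth makes [cardano_poly] a minimal polynomial of u. *)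
Lemma cardano_hom (M : fieldType) (psi : {rmorphism F -> M}) (y : M) :
  y ^+ 6 - psi c * y ^+ 3 + psi b ^+ 3 = 0 ->
  exists chi : {rmorphism L -> M}, (forall a, chi (phi a) = psi a) /\ chi u = y.
Proof.
move=> yE; apply: hom_extend => [f|]; first by have [P _ ->] := cardano_gen Hu f; exists P.
apply: (@minimal_kernel _ _ _ _ _ (cardano_poly b c)); rewrite ?horner_cardano_poly ?(cardano_rel Hu) //.
  by rewrite -size_poly_eq0 size_cardano_poly.
by move=> P; rewrite size_cardano_poly ltnS; apply: (cardano_free Hu).
Qed.

Lemma cardano_gen' f : exists P : {poly F}, f = (map_poly phi P).[u].
Proof. by have [P _ ->] := cardano_gen Hu f; exists P. Qed.

Lemma cardano_c : phi c = u ^+ 3 + (phi b / u) ^+ 3.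
Proof.
have u0 := cardano_u0; have u3 : u ^+ 3 != 0 by rewrite expf_neq0.
apply: (mulIf u3); rewrite mulrDl expr_div_n divfK // -exprD.
by apply/eqP; rewrite -subr_eq0 -oppr_eq0; apply/eqP; rewrite -[RHS](cardano_rel Hu); ring.
Qed.

Lemma cardano_root (M : fieldType) (chi : {rmorphism L -> M}) x :
  chi (phi c) = x ^+ 3 + (chi (phi b) / x) ^+ 3 -> x != 0 ->
  x ^+ 6 - chi (phi c) * x ^+ 3 + chi (phi b) ^+ 3 = 0.
Proof.
move=> -> x0; have x3 : x ^+ 3 != 0 by rewrite expf_neq0.
by rewrite mulrDl expr_div_n divfK //; ring.
Qed.

(** The cube of tau u is a root of T^2 - c T + b^3, whose roots are u^3 and (b/u)^3; a cube root is
    determined up to a power of z. *)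
Lemma cardano_aut_list (tau : {rmorphism L -> L}) : (forall a, tau (phi a) = phi a) ->
  exists i : 'I_3, tau u = z ^+ i * u \/ tau u = z ^+ i * (phi b / u).
Proof.
move=> tphi; have u0 := cardano_u0.
have : (tau u ^+ 3 - u ^+ 3) * (tau u ^+ 3 - (phi b / u) ^+ 3) = 0.
  have -> : (tau u ^+ 3 - u ^+ 3) * (tau u ^+ 3 - (phi b / u) ^+ 3) =
      tau u ^+ 6 - (u ^+ 3 + (phi b / u) ^+ 3) * tau u ^+ 3 + (u * (phi b / u)) ^+ 3 by ring.
  rewrite -cardano_c [u * (_ / u)]mulrCA divff // mulr1 -[RHS](rmorph0 tau) -(cardano_rel Hu).
  by rewrite rmorphD rmorphB (rmorphM tau (phi c)) !(rmorphXn tau) !tphi.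
by move/eqP; rewrite mulf_eq0 !subr_eq0 => /orP[]/eqP/cube_roots[i iE]; exists i; [left|right].
Qed.

Lemma cardano_aut_rotation (i : nat) : exists tau : {rmorphism L -> L},
  (forall a, tau (phi a) = phi a) /\ tau u = z ^+ i * u.
Proof.
have zi : (z ^+ i) ^+ 3 = 1 by rewrite exprAC root3X expr1n.
have zi6 : (z ^+ i) ^+ 6 = 1 by rewrite -[6%N]/(3 * 2)%N exprM zi expr1n.
by apply: cardano_hom; rewrite !exprMn zi zi6 !mul1r (cardano_rel Hu).
Qed.

Lemma cardano_conj_rel : (phi b / u) ^+ 6 - phi c * (phi b / u) ^+ 3 + phi b ^+ 3 = 0.
Proof.
have u0 := cardano_u0; have v0 : phi b / u != 0.
  by rewrite mulf_neq0 ?invr_eq0 // fmorph_eq0 (cardano_b Hu).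
apply: (@cardano_root _ idfun) => //=.
by rewrite invf_div [phi b * (u / _)]mulrCA divff ?fmorph_eq0 ?(cardano_b Hu) // mulr1 addrC cardano_c.
Qed.

Lemma cardano_aut_reflection (i : nat) : exists tau : {rmorphism L -> L},
  (forall a, tau (phi a) = phi a) /\ tau u = z ^+ i * (phi b / u).
Proof.
have [tau [t1 t2]] := cardano_aut_rotation i.
have [s [s1 s2]] := cardano_hom cardano_conj_rel.
exists (s \o tau); split=> [a|] /=; first by rewrite t1 s1.
by rewrite t2 rmorphM rmorphXn s1 s2.
Qed.

End CardanoTheory.

End Cubic.

(** Completing the square replaces a generator y0 by y = y0 - q/2 with y^2 in F; the involution is y
    -> -y. *)
Lemma quadratic_involution (F L : fieldType) (phi : {rmorphism F -> L}) :
  2%:R != 0 :> F -> has_dimension phi (@full L) 2 ->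
  exists tau : {rmorphism L -> L}, [/\ forall a, tau (phi a) = phi a,
    forall x, tau (tau x) = x, forall x, tau x = x -> exists a, x = phi a
    & exists2 y, y != 0 & tau y = - y].
Proof.
move=> n2 hn.
have one_free : free_family phi (fun _ : unit => 1).
  move=> c; rewrite (bigD1 tt) //= big1 => [|[]//].
  by rewrite addr0 mulr1 => /eqP; rewrite fmorph_eq0 => /eqP c0 [].
have [y0 ny0] : exists y, ~ exists a, y = phi a.
  apply/existsNP => h; have := dimension_elim (subspace_full phi) hn.
  move=> [b [bf _ _]]; have := free_card_le (b := fun _ : unit => 1) bf.
  rewrite card_ord card_unit => H; suff : (2 <= 1)%N by [].
  apply: H => i; have [a ->] := h (b i); exists (fun=> a).
  by rewrite (bigD1 tt) //= big1 => [|[]//]; rewrite addr0 mulr1.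
have span y : (~ exists a, y = phi a) -> free_family phi (fun i : bool => if i then y else 1) /\
    forall f, exists p q, f = phi p + phi q * y.
  move=> ny; have fy : free_family phi (fun i : bool => if i then y else 1).
    move=> c; rewrite big_bool /= mulr1 => c0.
    have ct : c true = 0.
      apply/eqP/negPn/negP => ct; apply: ny; exists (- c false / c true).
      have pt : phi (c true) != 0 by rewrite fmorph_eq0.
      apply: (mulfI pt); rewrite -rmorphM [c true * _]mulrC divfK // rmorphN.
      by apply/eqP; rewrite -addr_eq0 c0.
    by case=> //; move/eqP: c0; rewrite ct rmorph0 mul0r add0r fmorph_eq0 => /eqP.
  split=> // f; have [r ->] := free_span (subspace_full phi) hn card_bool fy (fun=> I) (I : full f).
  by exists (r false), (r true); rewrite big_bool /= mulr1 addrC.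
have n2L : 2%:R != 0 :> L by rewrite -(rmorph_nat phi) fmorph_eq0.
have [_ sp0] := span y0 ny0.
have [p [q yy]] := sp0 (y0 ^+ 2).
pose y := y0 - phi (q / 2%:R).
have ny : ~ exists a, y = phi a.
  case=> a ya; apply: ny0; exists (a + q / 2%:R).
  by rewrite rmorphD -ya subrK.
have [d yE] : exists d, y ^+ 2 = phi d.
  exists (p + (q / 2%:R) ^+ 2); rewrite rmorphD rmorphXn /y sqrrB yy.
  rewrite -[y0 * _ *+ 2]mulr_natr -mulrA -(rmorph_nat phi) -rmorphM divfK //.
  by rewrite [y0 * _]mulrC addrK.
have [fy sp] := span y ny.
have y_neq0 : y != 0 by apply/eqP => e; apply: ny; exists 0; rewrite rmorph0.
have [f||tau [tphi ty]] := @hom_extend F L L phi phi y (- y).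
- have [a [e ->]] := sp f; exists (a%:P + e%:P * 'X).
  by rewrite rmorphD rmorphM /= !map_polyC map_polyX !hornerE.
- apply: (@minimal_kernel F L L phi phi ('X^2 - d%:P) y (- y)).
  + by rewrite -size_poly_eq0 size_XnsubC.
  + by rewrite rmorphB /= map_polyXn map_polyC hornerD hornerN hornerXn hornerC yE subrr.
  + by rewrite rmorphB /= map_polyXn map_polyC hornerD hornerN hornerXn hornerC sqrrN yE subrr.
  + move=> R; rewrite size_XnsubC // ltnS => sR.
    rewrite (@horner_coef_wide _ 2) ?size_map_poly // !big_ord_recl big_ord0 addr0 !coef_map /=.
    rewrite expr0 mulr1 expr1 => e.
    have h := fy (fun i => if i then R`_1 else R`_0); rewrite big_bool /= mulr1 addrC in h.
    have r0 := h e false; have r1 := h e true; rewrite /= in r0 r1.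
    apply/polyP => -[|[|i]]; rewrite coef0 //.
    by rewrite nth_default // (leq_trans sR).
have tE a e : tau (phi a + phi e * y) = phi a - phi e * y.
  by rewrite rmorphD rmorphM !tphi ty mulrN.
exists tau; split=> [//|x|x|].
- by have [a [e ->]] := sp x; rewrite tE rmorphB rmorphM !tphi ty mulrN opprK.
- have [a [e ->]] := sp x; rewrite tE => /eqP; rewrite -subr_eq0 => /eqP h.
  have : 2%:R * (phi e * y) = 0 by rewrite -[RHS]oppr0 -h; ring.
  move/eqP; rewrite !mulf_eq0 (negPf n2L) (negPf y_neq0) orbF /= => /eqP ->.
  by exists a; rewrite mul0r addr0.
- by exists y.
Qed.

(** * Kummer generators and the action of S_3 *)

Section CyclicCubic.
Variables (F L : fieldType) (phi : {rmorphism F -> L}) (zeta : F).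
Hypotheses (zetaE : zeta ^+ 2 + zeta + 1 = 0) (char3 : 3%:R != 0 :> F).
Let z : L := phi zeta.

Lemma sum3 (q : 'I_3 -> L) (u : L) : \sum_i q i * u ^+ i =
  q (inord 0) + q (inord 1) * u + q (inord 2) * u ^+ 2.
Proof.
rewrite !big_ord_recl big_ord0 /= addr0 expr0 mulr1 expr1 addrA.
by congr (q _ + q _ * _ + q _ * _); apply: val_inj; rewrite /= inordK.
Qed.

Lemma eigen_powers_free (K : fieldType) (psi : {rmorphism K -> L}) (sigma : {rmorphism L -> L}) u :
  (forall a, sigma (phi a) = phi a) -> (forall y, sigma (psi y) = psi y) ->
  u != 0 -> sigma u = z * u -> free_family psi (fun i : 'I_3 => u ^+ i).
Proof.
move=> sphi spsi u0 su c; rewrite sum3 => e.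
have [] := eigen_free zetaE char3 sphi u0 su (spsi _) (spsi _) (spsi _) e.
move=> /eqP h0 /eqP h1 /eqP h2; rewrite !fmorph_eq0 in h0 h1 h2.
move=> i; rewrite -(inord_val i); move: (val i) (ltn_ord i).
by case=> [|[|[|//]]] _; apply/eqP.
Qed.

Lemma cyclic_cubic (sigma : {rmorphism L -> L}) : has_dimension phi (@full L) 3 ->
  (forall a, sigma (phi a) = phi a) -> (forall y, sigma (sigma (sigma y)) = y) ->
  (exists x, sigma x != x) ->
  exists u, [/\ u != 0, sigma u = z * u, free_family phi (fun i : 'I_3 => u ^+ i),
    forall f, exists q : 'I_3 -> F, f = \sum_i phi (q i) * u ^+ i
    & forall f, sigma f = f -> exists y, f = phi y].
Proof.
move=> h3 sphi s3 [x sx].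
have [u [u0 su]] := eigenvector_exists zetaE char3 sphi s3 sx.
have fu := eigen_powers_free sphi sphi u0 su.
have sp f := free_span (subspace_full phi) h3 (card_ord 3) fu (fun=> I) (I : full f).
exists u; split=> // f sf; have [q fE] := sp f; rewrite sum3 in fE.
have : (phi (q (inord 0)) - f) + phi (q (inord 1)) * u + phi (q (inord 2)) * u ^+ 2 = 0.
  by rewrite fE; ring.
have sq0 : sigma (phi (q (inord 0)) - f) = phi (q (inord 0)) - f by rewrite rmorphB sphi sf.
move/(eigen_free zetaE char3 sphi u0 su sq0 (sphi _) (sphi _)) => -[/eqP h _ _].
by exists (q (inord 0)); move: h; rewrite subr_eq0 => /eqP.
Qed.

Section S3.
Variables (sigma s : {rmorphism L -> L}).
Hypotheses (sphi : forall a, sigma (phi a) = phi a) (tphi : forall a, s (phi a) = phi a).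

(** Equality would give u^2 = z^i B, which sigma fixes, although it multiplies u^2 by z^2. Then z^2
    = 1, so z = -2 and 3 = z^2 + z + 1 = 0. *)
Lemma cube_conj_neq (u B : L) : u != 0 -> sigma u = z * u -> sigma B = B -> (B / u) ^+ 3 != u ^+ 3.
Proof.
move=> u0 su sB; apply/eqP => e.
have {e} : (u ^+ 2) ^+ 3 = B ^+ 3.
  have u3 : u ^+ 3 != 0 by rewrite expf_neq0.
  by move/(congr1 (fun x => x * u ^+ 3)): e; rewrite expr_div_n divfK // => ->; ring.
move=> /(cube_roots phi zetaE)[i uE].
have := congr1 sigma uE; rewrite rmorphM !rmorphXn sB sphi -/z -uE su exprMn.
move=> /eqP; rewrite -subr_eq0 -{2}[u ^+ 2]mul1r -mulrBl mulf_eq0 expf_eq0 (negPf u0) orbF.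
rewrite (root3E phi zetaE) -/z -opprD -opprD oppr_eq0 => /eqP h.
have := three_neq0 phi char3; have := root3Z phi zetaE; rewrite -/z.
have -> : z = - 2%:R by apply/eqP; rewrite -addr_eq0 -[X in _ == X]h; apply/eqP; ring.
by move=> e; rewrite (_ : 3%:R = (- 2%:R) ^+ 2 + - 2%:R + 1 :> L); [rewrite e eqxx | ring].
Qed.

(** An element fixed by sigma has the form p + e u^3 with p, e in F; if s also fixes it, then e = 0
    because s moves u^3. *)
Lemma s3_fixed_in_base (u : L) : u != 0 -> sigma u = z * u -> s (u ^+ 3) != u ^+ 3 ->
  (forall f, exists2 P : {poly F}, (size P <= 6)%N & f = (map_poly phi P).[u]) ->
  forall f, sigma f = f -> s f = f -> exists a, f = phi a.
Proof.
move=> u0 su sa gen f sf tf; have [P sP fE] := gen f; rewrite horner6 // in fE.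
have su3 : sigma (u ^+ 3) = u ^+ 3.
  by rewrite rmorphXn su exprMn (root3X phi zetaE) mul1r.
have sq (a e : F) : sigma (phi a + phi e * u ^+ 3) = phi a + phi e * u ^+ 3.
  by rewrite rmorphD rmorphM su3 !sphi.
have : (phi P`_0 + phi P`_3 * u ^+ 3 - f) + (phi P`_1 + phi P`_4 * u ^+ 3) * u
  + (phi P`_2 + phi P`_5 * u ^+ 3) * u ^+ 2 = 0 by rewrite [in LHS]fE; ring.
have sq0 : sigma (phi P`_0 + phi P`_3 * u ^+ 3 - f) = phi P`_0 + phi P`_3 * u ^+ 3 - f.
  by rewrite rmorphB sq sf.
move/(eigen_free zetaE char3 sphi u0 su sq0 (sq _ _) (sq _ _)) => -[/eqP h _ _].
move: h; rewrite subr_eq0 => /eqP h.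
have := congr1 s h; rewrite tf -h rmorphD rmorphM !tphi => /addrI/eqP.
rewrite -subr_eq0 -mulrBr mulf_eq0 subr_eq0 (negPf sa) orbF => /eqP p3.
by exists P`_0; rewrite p3 mul0r addr0.
Qed.

(** Take u with sigma u = z u. The relation between s and sigma makes s u an eigenvector for z^2, so
    u s(u) and u^3 + s(u)^3 are fixed by both automorphisms; they are the images of b and c. *)
Lemma s3_cardano : has_dimension phi (@full L) 6 ->
  (forall x, sigma (sigma (sigma x)) = x) -> (forall x, s (s x) = x) ->
  (forall x, s (sigma x) = sigma (sigma (s x))) -> (exists x, sigma x != x) ->
  exists b c u, [/\ cardano phi b c u, sigma u = z * u & s u = phi b / u].
Proof.
move=> h6 s3 t2 st [x sx].
have [u [u0 su]] := eigenvector_exists zetaE char3 sphi s3 sx.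
have sz : sigma z = z by apply: sphi.
have stu : sigma (s u) = z ^+ 2 * s u.
  have e : sigma (sigma (s u)) = z * s u by rewrite -st su rmorphM tphi.
  have := congr1 (sigma \o sigma) e; rewrite /= s3 !rmorphM !sz e => ->.
  by rewrite mulrA -expr2.
pose B := u * s u; have sB : sigma B = B.
  rewrite rmorphM su stu (_ : _ * _ = z ^+ 3 * B); last by rewrite /B; ring.
  by rewrite (root3X phi zetaE) mul1r.
have tB : s B = B by rewrite rmorphM t2 mulrC.
have tu : s u = B / u by rewrite /B mulrC mulKf.
have ta : s (u ^+ 3) != u ^+ 3 by rewrite rmorphXn tu; apply: cube_conj_neq.
have su3 : sigma (u ^+ 3) = u ^+ 3.
  by rewrite rmorphXn su exprMn (root3X phi zetaE) mul1r.
have sq (a e : F) : sigma (phi a + phi e * u ^+ 3) = phi a + phi e * u ^+ 3.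
  by rewrite rmorphD rmorphM su3 !sphi.
have lin (a e : F) : phi a + phi e * u ^+ 3 = 0 -> a = 0 /\ e = 0.
  move=> h; have e0 : e = 0.
    apply/eqP/negPn/negP => e0; move/eqP: ta; apply.
    have pe : phi e != 0 by rewrite fmorph_eq0.
    apply: (mulfI pe); rewrite -[phi e in LHS]tphi -rmorphM.
    have -> : phi e * u ^+ 3 = - phi a by apply/eqP; rewrite -addr_eq0 addrC h.
    by rewrite rmorphN tphi.
  by split=> //; move/eqP: h; rewrite e0 rmorph0 mul0r addr0 fmorph_eq0 => /eqP.
have fr (P : {poly F}) : (size P <= 6)%N -> (map_poly phi P).[u] = 0 -> P = 0.
  move=> sP; rewrite horner6 // => /(eigen_free zetaE char3 sphi u0 su (sq _ _) (sq _ _) (sq _ _)).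
  move=> [/lin[p0 p3] /lin[p1 p4] /lin[p2 p5]].
  apply/polyP => i; rewrite coef0; have [|i6] := ltnP i 6; last first.
    by rewrite nth_default // (leq_trans sP).
  by case: i => [|[|[|[|[|[|//]]]]]].
have gen f : exists2 P : {poly F}, (size P <= 6)%N & f = (map_poly phi P).[u].
  have [r fE] := free_span (subspace_full phi) h6 (card_ord 6) (proj1 (free6 phi u) fr) (fun=> I) (I : full f).
  exists (\poly_(i < 6) (r (inord i))); first exact: size_poly.
  rewrite (@horner_coef_wide _ 6) ?size_map_poly ?size_poly // fE.
  by apply: eq_bigr => i _; rewrite coef_map coef_poly ltn_ord inord_val.
have base := s3_fixed_in_base u0 su ta gen.
have [b bE] := base _ sB tB.
have tu0 : s u != 0 by rewrite fmorph_eq0.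
have b0 : b != 0 by rewrite -(fmorph_eq0 phi) -bE mulf_neq0.
have [c cE] : exists c, u ^+ 3 + s u ^+ 3 = phi c.
  apply: base.
    rewrite rmorphD su3 rmorphXn stu exprMn -exprM (exprM z 3 2) (root3X phi zetaE).
    by rewrite expr1n mul1r.
  by rewrite rmorphD !rmorphXn t2 addrC.
exists b, c, u; split=> //; last by rewrite -bE.
split=> //; rewrite -bE -cE /B exprMn; ring.
Qed.

Variables (b c : F) (u : L) (Hu : cardano phi b c u).
Hypotheses (su : sigma u = z * u) (tu : s u = phi b / u).

Lemma cardano_fixed f : sigma f = f -> s f = f -> exists a, f = phi a.
Proof.
apply: (s3_fixed_in_base (cardano_u0 Hu) su); last by move=> {}f; apply: (cardano_gen Hu).
by rewrite rmorphXn tu; apply: cube_conj_neq => //; apply: cardano_u0 Hu.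
Qed.

Lemma cardano_sigma3 x : sigma (sigma (sigma x)) = x.
Proof.
have sz : sigma z = z by apply: sphi.
apply: (@hom_eq_gen F L L phi u (sigma \o sigma \o sigma) idfun) => [f|a|] /=.
- exact: cardano_gen' Hu f.
- by rewrite !sphi.
- rewrite su rmorphM sz su rmorphM sz rmorphM sz su (_ : _ * _ = z ^+ 3 * u); last by ring.
  by rewrite (root3X phi zetaE) mul1r.
Qed.

Lemma cardano_s2 x : s (s x) = x.
Proof.
apply: (@hom_eq_gen F L L phi u (s \o s) idfun) => [f|a|] /=.
- exact: cardano_gen' Hu f.
- by rewrite !tphi.
- rewrite tu fmorph_div tphi tu invf_div mulrCA divff ?mulr1 //.
  by rewrite fmorph_eq0 (cardano_b Hu).
Qed.

Lemma cardano_s_neq : s u != u.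
Proof.
have u0 := cardano_u0 Hu; rewrite tu; apply/eqP => e.
by have := cube_conj_neq u0 su (sphi b); rewrite e eqxx.
Qed.

Lemma cardano_fix_sigma_dim (K : fieldType) (psi : {rmorphism K -> L}) :
  (forall x, (exists y, x = psi y) <-> sigma x = x) -> has_dimension psi (@full L) 3.
Proof.
move=> im; rewrite -[3%N]card_ord; have u0 := cardano_u0 Hu.
have spsi y : sigma (psi y) = psi y by apply/im; exists y.
apply: (dimension_intro (b := fun i : 'I_3 => u ^+ i)) => //.
  exact: eigen_powers_free sphi spsi u0 su.
move=> f _; have [P sP ->] := cardano_gen Hu f; rewrite horner6 //.
have su3 : sigma (u ^+ 3) = u ^+ 3.
  by rewrite rmorphXn su exprMn (root3X phi zetaE) mul1r.
have sq (a e : F) : exists y, phi a + phi e * u ^+ 3 = psi y.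
  by apply/im; rewrite rmorphD rmorphM su3 !sphi.
have [y0 ->] := sq P`_0 P`_3; have [y1 ->] := sq P`_1 P`_4; have [y2 ->] := sq P`_2 P`_5.
exists (fun i : 'I_3 => nth 0 [:: y0; y1; y2] i).
by rewrite sum3 !inordK.
Qed.

(** Solving f = al + be u together with its image under s gives be = (f - s f) / (u - s u); then al
    and be are fixed by s. *)
Lemma cardano_fix_s_dim (K : fieldType) (psi : {rmorphism K -> L}) :
  (forall x, (exists y, x = psi y) <-> s x = x) -> has_dimension psi (@full L) 2.
Proof.
move=> im; have d0 : u - s u != 0 by rewrite subr_eq0 eq_sym cardano_s_neq.
have spsi y : s (psi y) = psi y by apply/im; exists y.
rewrite -card_bool; apply: (dimension_intro (b := fun i : bool => if i then u else 1)) => //.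
  move=> q; rewrite big_bool /= mulr1 => e.
  have e' := congr1 s e; rewrite rmorphD rmorphM !spsi rmorph0 in e'.
  have q1 : q true = 0.
    apply/eqP; rewrite -(fmorph_eq0 psi) -(mulIr_eq0 _ (mulIf d0)); apply/eqP.
    by rewrite -[RHS](subrr 0) -{1}e -e'; ring.
  by case=> //; move/eqP: e; rewrite q1 rmorph0 mul0r add0r fmorph_eq0 => /eqP.
move=> f _; pose be := (f - s f) / (u - s u); pose al := f - be * u.
have sbe : s be = be.
  rewrite fmorph_div !rmorphB !cardano_s2 /be -[LHS]mulrNN -invrN !opprB.
  by [].
have sal : s al = al.
  have h : be * (u - s u) = f - s f by rewrite divfK.
  rewrite rmorphB rmorphM sbe /al; apply/eqP; rewrite subr_eq; apply/eqP.
  by rewrite (_ : f - be * u + be * s u = f - be * (u - s u)); [rewrite h; ring | ring].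
have [y0 e0] := proj2 (im al) sal; have [y1 e1] := proj2 (im be) sbe.
exists (fun i => if i then y1 else y0).
by rewrite big_bool /= mulr1 -e0 -e1 /al addrC subrK.
Qed.

End S3.
End CyclicCubic.

(** A basis of L over F is sent to a free family over F', which spans L' because the dimensions
    agree. Homomorphisms are shown to be isomorphisms in this way. *)
Lemma semilinear_surjective (F L F' L' : fieldType) (phi : {rmorphism F -> L})
    (phi' : {rmorphism F' -> L'}) (theta : {rmorphism F -> F'}) (chi : {rmorphism L -> L'}) n :
  (forall a, chi (phi a) = phi' (theta a)) -> (forall y, exists x, theta x = y) ->
  has_dimension phi (@full L) n -> has_dimension phi' (@full L') n ->
  forall f, exists h, chi h = f.
Proof.
move=> comm /choice[t tE] hn hn' f.
have [b [bf _ _]] := dimension_elim (subspace_full phi) hn.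
have cf : free_family phi' (chi \o b).
  move=> c c0 i; rewrite -(tE (c i)); suff -> : t (c i) = 0 by rewrite rmorph0.
  apply: (bf (t \o c)); apply/eqP; rewrite -(fmorph_eq0 chi) rmorph_sum; apply/eqP.
  by apply: etrans c0; apply: eq_bigr => j _; rewrite rmorphM comm /= tE.
have [r ->] := free_span (subspace_full phi') hn' (card_ord n) cf (fun=> I) (I : full f).
exists (\sum_i phi (t (r i)) * b i); rewrite rmorph_sum; apply: eq_bigr => i _.
by rewrite rmorphM comm tE.
Qed.

Lemma gen_of_powers (F L : fieldType) (phi : {rmorphism F -> L}) n (u : L) :
  (forall f, exists q : 'I_n -> F, f = \sum_i phi (q i) * u ^+ i) ->
  forall f, exists P : {poly F}, f = (map_poly phi P).[u].
Proof.
move=> sp f; have [q ->] := sp f; exists (\sum_i (q i)%:P * 'X^i).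
rewrite rmorph_sum horner_sum; apply: eq_bigr => i _.
by rewrite rmorphM /= map_polyC map_polyXn hornerCM hornerXn.
Qed.

(** * Galois covers of curves *)

Section GaloisCurves.
Variable k : closedFieldType.
Implicit Types X Y Z : curve k.

Lemma has_degreeP X Y (u : mor X Y) n :
  has_degree u n <-> has_dimension (pullback u) (@full _) n.
Proof.
split=> [[b bE]|[b [_ bE]]]; exists b; first by split=> // f _; apply: bE.
by move=> f; apply: bE.
Qed.

Lemma mor_of_automorphism X Y (u : mor X Y) (tau : {rmorphism ratfun X -> ratfun X}) :
  (forall y, tau (pullback u y) = pullback u y) ->
  exists s : mor X X, pullback s = tau /\ deck u s.
Proof.
move=> tphi; have [a|s sE] := @mor_of_hom _ X X tau.
  by rewrite -(pullback_cst u) tphi.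
exists s; split=> //; split; last by apply: mor_ext => y /=; rewrite sE tphi.
have [n hn] := pullback_finite u.
apply: iso_of_pullback; rewrite sE.
by apply: (@semilinear_surjective _ _ _ _ _ (pullback u) idfun tau n) => // y; exists y.
Qed.

(** Pullback reverses composition, which accounts for the order of the factors in the second
    condition. *)
Lemma galois_with_automorphisms (G : finGroupType) X Y (u : mor X Y) : galois_with G u <->
  has_dimension (pullback u) (@full _) #|G| /\
  exists R : G -> {rmorphism ratfun X -> ratfun X},
    [/\ forall a y, R a (pullback u y) = pullback u y,
        forall a b x, R (a * b)%g x = R b (R a x),
        forall a b, R a =1 R b -> a = b
      & forall tau : {rmorphism ratfun X -> ratfun X},
          (forall y, tau (pullback u y) = pullback u y) -> exists a, tau =1 R a].
Proof.
split=> [[/has_degreeP hd [rho [rd rM ri rc]]]|[/has_degreeP hd [R [Rphi RM Ri Rc]]]].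
  split=> //; exists (fun a => pullback (rho a)); split=> [a y|a b x|a b ab|tau tphi].
  - by have [_ [_ h]] := rd a; apply: h.
  - by have [_ h] := rM a b; apply: h.
  - exact/ri/mor_ext.
  - have [s [sE sd]] := mor_of_automorphism tphi; have [a [_ h]] := rc s sd.
    by exists a => x; rewrite -sE; apply: h.
split=> //; have /choice[rho rE] a := mor_of_automorphism (Rphi a).
exists rho; split=> [a|a b|a b [_ h]|s [_ [_ h]]].
- by have [] := rE a.
- apply: mor_ext => x /=; have [-> _] := rE (a * b)%g; have [-> _] := rE a.
  by have [-> _] := rE b; rewrite RM.
- by apply: Ri => x; have := h x; have [-> _] := rE a; have [-> _] := rE b.
- have [y|a ae] := Rc (pullback s); first exact: h.
  by exists a; apply: mor_ext => x; have [-> _] := rE a; apply: ae.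
Qed.

Lemma galois_one (G : finGroupType) (L : fieldType) (R : G -> {rmorphism L -> L}) :
  (forall a b x, R (a * b)%g x = R b (R a x)) -> forall x, R 1%g x = x.
Proof. by move=> RM x; apply: (fmorph_inj (R 1%g)); rewrite -RM mulg1. Qed.

Lemma Z3_automorphism X Y (u : mor X Y) : galois_with 'Z_3 u ->
  has_dimension (pullback u) (@full _) 3 /\
  exists sigma : {rmorphism ratfun X -> ratfun X},
    [/\ forall y, sigma (pullback u y) = pullback u y,
        forall x, sigma (sigma (sigma x)) = x & exists x, sigma x != x].
Proof.
move=> /galois_with_automorphisms[]; rewrite card_ord => hd [R [Rphi RM Ri _]]; split=> //.
pose g : 'Z_3 := Zp1; exists (R g); split=> // [x|].
  by rewrite -!RM (_ : (g * (g * g))%g = 1%g) ?galois_one //; apply: val_inj.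
apply: contrapT => nx; suff : g = 1%g by [].
apply: Ri => x; rewrite galois_one //; apply/eqP/negPn/negP => h.
by apply: nx; exists x.
Qed.

Lemma S3_automorphisms X Y (u : mor X Y) : galois_with {perm 'I_3} u ->
  has_dimension (pullback u) (@full _) 6 /\
  exists sigma s : {rmorphism ratfun X -> ratfun X},
    [/\ forall y, sigma (pullback u y) = pullback u y,
        forall y, s (pullback u y) = pullback u y,
        [/\ forall x, sigma (sigma (sigma x)) = x, forall x, s (s x) = x &
            forall x, s (sigma x) = sigma (sigma (s x))] &
        exists x, sigma x != x].
Proof.
move=> /galois_with_automorphisms[].
rewrite card_Sn (_ : 3`! = 6) //.
move=> hd [R [Rphi RM Ri _]]; split=> //.
pose i0 : 'I_3 := inord 0; pose i1 : 'I_3 := inord 1; pose i2 : 'I_3 := inord 2.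
pose x : {perm 'I_3} := tperm i0 i1; pose y : {perm 'I_3} := tperm i1 i2.
have xx : (x * x = 1)%g by apply: tperm2.
have yy : (y * y = 1)%g by apply: tperm2.
have n01 : i0 != i1 by rewrite -val_eqE /= !inordK.
have n12 : i1 != i2 by rewrite -val_eqE /= !inordK.
have n02 : i0 != i2 by rewrite -val_eqE /= !inordK.
(* The braid relation; it gives g^3 = 1 and g x = x g^2 for the 3-cycle g = x y. *)
have braid : (x * y * x = y * x * y)%g.
  have -> : (x * y * x = y ^ x)%g by rewrite conjgE tpermV mulgA.
  have -> : (y * x * y = x ^ y)%g by rewrite conjgE tpermV mulgA.
  by rewrite !tpermJ tpermR tpermL !tpermD // eq_sym.
pose g := (x * y)%g.
have g3 : (g * g * g = 1)%g.
  have -> : (g * g * g = (x * y * x) * (y * x * y))%g by rewrite /g !mulgA.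
  by rewrite braid -!mulgA (mulgA y y) yy mul1g (mulgA x x) xx mul1g yy.
have xg : (g * x = x * g * g)%g by rewrite /g braid !mulgA xx mul1g.
exists (R g), (R x); split=> //; first split=> t.
- by rewrite -!RM mulgA g3 galois_one.
- by rewrite -!RM xx galois_one.
- by rewrite -!RM xg -mulgA.
apply: contrapT => nx; suff : g = 1%g.
  move/(congr1 (fun t : {perm 'I_3} => t i0)); rewrite perm1 permM tpermL tpermL => /eqP.
  by rewrite eq_sym (negPf n02).
apply: Ri => t; rewrite galois_one //; apply/eqP/negPn/negP => h.
by apply: nx; exists t.
Qed.

End GaloisCurves.

(** All six permutations of Z/3 are affine, j -> p(0) + j or j -> p(0) - j; here -1 is written as
    2. *)
Lemma perm3 (p : {perm 'I_3}) :
  (forall j, val (p j) = (val (p ord0) + j) %% 3)%N \/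
  (forall j, val (p j) = (val (p ord0) + 2 * j) %% 3)%N.
Proof.
pose i1 : 'I_3 := inord 1; pose i2 : 'I_3 := inord 2.
have n01 : val (p ord0) != val (p i1) by rewrite val_eqE (inj_eq perm_inj) -val_eqE /= inordK.
have n02 : val (p ord0) != val (p i2) by rewrite val_eqE (inj_eq perm_inj) -val_eqE /= inordK.
have n12 : val (p i1) != val (p i2) by rewrite val_eqE (inj_eq perm_inj) -val_eqE /= !inordK.
have ordE (j : 'I_3) : [\/ j = ord0, j = i1 | j = i2].
  case: j => -[|[|[|//]]] lt; [constructor 1 | constructor 2 | constructor 3];
  by apply: val_inj; rewrite /= ?inordK.
have l0 := ltn_ord (p ord0); have l1 := ltn_ord (p i1); have l2 := ltn_ord (p i2).
have v1 : val i1 = 1%N by rewrite /= inordK.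
have v2 : val i2 = 2%N by rewrite /= inordK.
have [h|h] : (val (p i1) = (val (p ord0) + 1) %% 3 /\ val (p i2) = (val (p ord0) + 2) %% 3)%N \/
    (val (p i1) = (val (p ord0) + 2) %% 3 /\ val (p i2) = (val (p ord0) + 4) %% 3)%N.
- by move: l0 l1 l2 n01 n02 n12; rewrite /=; lia.
- left=> j; case: (ordE j) => ->; rewrite ?v1 ?v2; case: h => // _ _.
  by rewrite /= addn0 modn_small.
- right=> j; case: (ordE j) => ->; rewrite ?v1 ?v2; case: h => // _ _.
  by rewrite /= addn0 modn_small.
Qed.

(** * The Galois group as permutations of the roots of the cubic *)

Section Resolvents.
Variables (F L : fieldType) (phi : {rmorphism F -> L}) (zeta : F).
Hypotheses (zetaE : zeta ^+ 2 + zeta + 1 = 0) (char3 : 3%:R != 0 :> F).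
Let z : L := phi zeta.

Lemma root3_mod n : z ^+ (n %% 3) = z ^+ n.
Proof. by rewrite expr_mod // (root3X phi zetaE). Qed.

Lemma root3_inj (a b : nat) : (a < 3)%N -> (b < 3)%N -> z ^+ a = z ^+ b -> a = b.
Proof.
have z1 := root3_neq1 phi zetaE char3; have z0 := root3_neq0 phi zetaE.
wlog ab : a b / (a <= b)%N.
  by move=> H a3 b3 e; case/orP: (leq_total a b) => h; [|apply/esym]; apply: H.
move=> a3 b3; rewrite -(subnKC ab) exprD -[LHS]mulr1 => /(mulfI (expf_neq0 _ z0)).
have : (b - a < 3)%N by lia.
case: (b - a)%N => [|[|[|//]]] _; first by rewrite addn0.
  by rewrite expr1 => e; rewrite -/z -e eqxx in z1.
move=> e; have := root3X phi zetaE; rewrite -/z exprS -e mulr1 => e'.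
by rewrite -/z e' eqxx in z1.
Qed.

Variables (b c : F) (u : L) (Hu : cardano phi b c u).
Let v := phi b / u.

(** By Cardano's formula these are the roots of W^3 = 3 b W + c. The automorphism u -> z^i u shifts
    the index by i, and u -> z^i b/u sends n to -(i + n) mod 3. *)
Definition cubic_root (n : nat) : L := z ^+ n * u + z ^+ (2 * n) * v.

Lemma cubic_root_mod n m : (n = m %[mod 3])%N -> cubic_root n = cubic_root m.
Proof.
move=> e; rewrite /cubic_root -(root3_mod n) e root3_mod; congr (_ + _ * _).
by rewrite -root3_mod -modnMmr e modnMmr root3_mod.
Qed.

Lemma rotation_root (tau : {rmorphism L -> L}) (i n : nat) : (forall a, tau (phi a) = phi a) ->
  tau u = z ^+ i * u -> tau (cubic_root n) = cubic_root (i + n).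
Proof.
move=> tphi tu; have u0 := cardano_u0 Hu; have z0 := root3_neq0 phi zetaE.
have tv : tau v = z ^+ (2 * i) * v.
  rewrite fmorph_div tphi tu /v invfM mulrCA; congr (_ * _).
  apply: (mulfI (expf_neq0 i z0)); rewrite divff ?expf_neq0 // -exprD.
  by rewrite -[(i + _)%N]/(3 * i)%N exprM (root3X phi zetaE) expr1n.
have tz m x : tau (z ^+ m * x) = z ^+ m * tau x by rewrite rmorphM rmorphXn /z tphi.
have zz m m' x : z ^+ m * (z ^+ m' * x) = z ^+ (m + m') * x by rewrite mulrA -exprD.
rewrite /cubic_root rmorphD !tz tu tv !zz.
by rewrite addnC mulnDr [(2 * n + _)%N]addnC.
Qed.

Lemma reflection_root (tau : {rmorphism L -> L}) (i n : nat) : (forall a, tau (phi a) = phi a) ->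
  tau u = z ^+ i * v -> tau (cubic_root n) = cubic_root (2 * i + 2 * n).
Proof.
move=> tphi tu; have u0 := cardano_u0 Hu; have z0 := root3_neq0 phi zetaE.
have b0 : phi b != 0 by rewrite fmorph_eq0 (cardano_b Hu).
have tv : tau v = z ^+ (2 * i) * u.
  rewrite fmorph_div tphi tu /v invfM invf_div mulrCA [phi b * _]mulrCA divff // mulr1.
  congr (_ * _).
  apply: (mulfI (expf_neq0 i z0)); rewrite divff ?expf_neq0 // -exprD.
  by rewrite -[(i + _)%N]/(3 * i)%N exprM (root3X phi zetaE) expr1n.
have tz m x : tau (z ^+ m * x) = z ^+ m * tau x by rewrite rmorphM rmorphXn /z tphi.
have zz m m' x : z ^+ m * (z ^+ m' * x) = z ^+ (m + m') * x by rewrite mulrA -exprD.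
rewrite /cubic_root rmorphD !tz tu tv !zz addrC.
rewrite [(2 * n + _)%N]addnC; congr (_ + _ * _).
by rewrite -root3_mod -[RHS]root3_mod; congr (_ ^+ _); lia.
Qed.

(** The Lagrange resolvent 3 u = w_0 + z^2 w_1 + z w_2 recovers u from the roots. *)
Lemma cubic_root_hom_eq (chi psi : {rmorphism L -> L}) :
  (forall a, chi (phi a) = phi a) -> (forall a, psi (phi a) = phi a) ->
  (forall j : 'I_3, chi (cubic_root j) = psi (cubic_root j)) -> chi =1 psi.
Proof.
move=> cphi pphi e; apply: (hom_eq_gen (cardano_gen' Hu)) => [a|]; first by rewrite cphi pphi.
have n3 := three_neq0 phi char3.
have uE : 3%:R * u = cubic_root 0 + (- z - 1) * cubic_root 1 + z * cubic_root 2.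
  rewrite /cubic_root (_ : z ^+ (2 * 2) = z); last by rewrite -root3_mod expr1.
  rewrite (_ : (2 * 1)%N = 2) // (root3E phi zetaE) -/z !expr1 muln0 !expr0.
  have -> : 1 * u + 1 * v + (- z - 1) * (z * u + (- z - 1) * v) + z * ((- z - 1) * u + z * v) =
    (1 - 2%:R * (z ^+ 2 + z)) * u + (2%:R * (z ^+ 2 + z + 1)) * v by ring.
  by rewrite (root3Z phi zetaE) (root3E phi zetaE) -/z; ring.
apply: (mulfI n3); transitivity (chi (3%:R * u)); first by rewrite rmorphM rmorph_nat.
transitivity (psi (3%:R * u)); last by rewrite rmorphM rmorph_nat.
rewrite uE.
have E (t : {rmorphism L -> L}) : (forall a, t (phi a) = phi a) ->
    t (cubic_root 0 + (- z - 1) * cubic_root 1 + z * cubic_root 2) =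
    t (cubic_root 0) + (- z - 1) * t (cubic_root 1) + z * t (cubic_root 2).
  move=> tphi; move: (cubic_root 0) (cubic_root 1) (cubic_root 2) => w0 w1 w2.
  rewrite !rmorphD (rmorphM t (- z - 1)) (rmorphM t z).
  by rewrite rmorphB rmorphN rmorph1 /z tphi.
rewrite !E //; have := e (inord 0); have := e (inord 1); have := e (inord 2).
by rewrite !inordK // => -> -> ->.
Qed.

(** Multiplied by u, the difference of two roots is a combination of 1 and u^2 over F; its
    coefficient at u^2 gives z^i = z^j. *)
Lemma cubic_root_inj (i j : 'I_3) : cubic_root i = cubic_root j -> i = j.
Proof.
have [sigma [sphi su]] := cardano_aut_rotation zetaE Hu 1; have u0 := cardano_u0 Hu.
rewrite expr1 in su; move=> e.
have {e} : (z ^+ (2 * i) - z ^+ (2 * j)) * phi b + 0 * u + (z ^+ i - z ^+ j) * u ^+ 2 = 0.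
  transitivity (u * (cubic_root i - cubic_root j)); last by rewrite e subrr mulr0.
  rewrite /cubic_root -{1}[phi b](divfK u0) -/v; ring.
have sz n : sigma (z ^+ n) = z ^+ n by rewrite rmorphXn /z sphi.
move/(eigen_free zetaE char3 sphi u0 su _ (rmorph0 _)) => [||_ _ /eqP].
- by rewrite rmorphM rmorphB !sz sphi.
- by rewrite rmorphB !sz.
by rewrite subr_eq0 => /eqP/root3_inj e; apply: val_inj; apply: e.
Qed.

Lemma permutation_automorphism (p : {perm 'I_3}) : exists tau : {rmorphism L -> L},
  (forall a, tau (phi a) = phi a) /\ forall j : 'I_3, tau (cubic_root j) = cubic_root (p j).
Proof.
have [h|h] := perm3 p.
  have [tau [tphi tu]] := cardano_aut_rotation zetaE Hu (p ord0).
  exists tau; split=> // j; rewrite (rotation_root _ tphi tu).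
  by apply: cubic_root_mod; rewrite (h j) modn_mod.
(* The reflection of index i sends root j to root 2 i + 2 j, and i = 2 p(0) gives 4 p(0) + 2 j =
   p(0) + 2 j mod 3. *)
have [tau [tphi tu]] := cardano_aut_reflection zetaE Hu (2 * p ord0).
exists tau; split=> // j; rewrite (reflection_root _ tphi tu).
by apply: cubic_root_mod; rewrite (h j) modn_mod /=; lia.
Qed.

Lemma automorphism_permutation (tau : {rmorphism L -> L}) : (forall a, tau (phi a) = phi a) ->
  exists p : {perm 'I_3}, forall j : 'I_3, tau (cubic_root j) = cubic_root (p j).
Proof.
move=> tphi; have [f fE] : exists f : 'I_3 -> 'I_3, forall j : 'I_3,
    tau (cubic_root j) = cubic_root (f j).
  have lt n : (n %% 3 < 3)%N by rewrite ltn_mod.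
  have [i [] tu] := cardano_aut_list zetaE Hu tphi.
    exists (fun j => Ordinal (lt (i + j)%N)) => j.
    by rewrite (rotation_root _ tphi tu); apply: cubic_root_mod; rewrite /= modn_mod.
  exists (fun j => Ordinal (lt (2 * i + 2 * j)%N)) => j.
  by rewrite (reflection_root _ tphi tu); apply: cubic_root_mod; rewrite /= modn_mod.
have fi : injective f.
  by move=> i j e; apply: cubic_root_inj; apply: (fmorph_inj tau); rewrite !fE e.
by exists (perm fi) => j; rewrite fE permE.
Qed.

End Resolvents.

Section GaloisGroups.
Variable k : closedFieldType.
Implicit Types X Y Z : curve k.
Variables (X Y : curve k) (f : mor X Y) (zeta : ratfun Y).
Hypotheses (zetaE : zeta ^+ 2 + zeta + 1 = 0) (char3 : 3%:R != 0 :> ratfun Y).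

Lemma S3_galois b c u : cardano (pullback f) b c u -> galois_with {perm 'I_3} f.
Proof.
move=> Hu; apply/galois_with_automorphisms; rewrite card_Sn; split.
  exact: cardano_dimension Hu.
have /choice[R RE] := permutation_automorphism zetaE char3 Hu.
have Rphi a : forall y, R a (pullback f y) = pullback f y by have [] := RE a.
exists R; split=> // [a a' x|a a' aa'|tau tphi].
- apply: (cubic_root_hom_eq zetaE char3 Hu (chi := R (a * a')%g) (psi := R a' \o R a)) => [//|y|j].
    by rewrite /= !Rphi.
  by rewrite /= (proj2 (RE _)) (proj2 (RE a)) (proj2 (RE a')) permM.
- apply/permP => j; apply: (cubic_root_inj zetaE char3 Hu).
  by rewrite -(proj2 (RE a)) -(proj2 (RE a')) aa'.
- have [p pE] := automorphism_permutation zetaE char3 Hu tphi; exists p.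
  by apply: (cubic_root_hom_eq zetaE char3 Hu) => // j; rewrite pE (proj2 (RE p)).
Qed.

(** The powers of sigma multiply the Kummer generator u by the powers of z, and any automorphism
    over the base does the same because u^3 comes from the base. *)
Lemma Z3_galois (sigma : {rmorphism ratfun X -> ratfun X}) :
  has_dimension (pullback f) (@full _) 3 ->
  (forall y, sigma (pullback f y) = pullback f y) ->
  (forall x, sigma (sigma (sigma x)) = x) -> (exists x, sigma x != x) ->
  galois_with 'Z_3 f.
Proof.
move=> hd sphi s3 sx; apply/galois_with_automorphisms; rewrite card_ord; split=> //.
have [u [u0 su uf sp base]] := cyclic_cubic zetaE char3 hd sphi s3 sx.
set z := pullback f zeta in su.
have gen := gen_of_powers sp.
have sz : sigma z = z := sphi _.
have /choice[R RE] : forall a : 'Z_3, exists tau : {rmorphism ratfun X -> ratfun X},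
    (forall y, tau (pullback f y) = pullback f y) /\ tau u = z ^+ a * u.
  move=> [[|[|[|m]]] lt]; last by [].
  - by exists idfun; rewrite mul1r.
  - by exists sigma; rewrite expr1.
  - by exists (sigma \o sigma); split=> [y|]; rewrite /= ?sphi // su rmorphM sz su mulrA.
have Rphi a y : R a (pullback f y) = pullback f y by have [h _] := RE a; apply: h.
have Ru a : R a u = z ^+ a * u by have [] := RE a.
exists R; split=> // [a b x|a b ab|tau tphi].
- apply: (hom_eq_gen gen (chi := R (a * b)%g) (psi := R b \o R a)) => [y|] /=; rewrite ?Rphi //.
  rewrite !Ru rmorphM rmorphXn Rphi -/z Ru mulrA -exprD.
  by rewrite -[z ^+ (a + b)](root3_mod (pullback f) zetaE).
- apply: val_inj; apply: (root3_inj (phi := pullback f) zetaE char3) => //; try exact: ltn_ord.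
  by apply: (mulIf u0); rewrite -/z -!Ru ab.
have su3 : sigma (u ^+ 3) = u ^+ 3.
  by rewrite rmorphXn su exprMn (root3X _ zetaE) mul1r.
have [y yE] := base _ su3.
have [|i iE] := cube_roots (pullback f) zetaE (x := tau u) (y := u).
  by rewrite -rmorphXn yE tphi.
exists i; apply: (hom_eq_gen gen) => [y'|]; first by rewrite tphi Rphi.
by rewrite Ru iE.
Qed.

End GaloisGroups.

(** * Kummer generators and ramification *)

Section Ramification.
Variable k : closedFieldType.
Local Notation kx := {fraction {poly k}}.
Local Notation "x %:F" := (@FracField.tofrac _ x).
Implicit Types X Y Z : curve k.

Lemma closed_cube_root (a : k) : exists r, a = r ^+ 3.
Proof.
have /closed_rootP[r] : size ('X^3 - a%:P) != 1%N by rewrite size_XnsubC.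
by rewrite /root hornerD hornerN hornerXn hornerC subr_eq0 => /eqP <-; exists r.
Qed.

Lemma poly_cube (P : {poly k}) : P != 0 -> (forall c, 3 %| mup c P)%N -> exists Q, P = Q ^+ 3.
Proof.
move: {2}(size P) (leqnn (size P)) => n; elim: n P => [|n IH] P.
  by rewrite leqn0 size_poly_eq0 => ->.
move=> sP P0 hP; have [s1|s1] := eqVneq (size P) 1.
  have /size_poly1P[a a0 ->] : size P == 1%N by apply/eqP.
  by have [r ->] := closed_cube_root a; exists r%:P; rewrite rmorphXn.
have [c rc] := elimT (closed_rootP P) s1.
have c3 : (3 <= mup c P)%N.
  have : (0 < mup c P)%N by rewrite mup_geq // expr1 dvdp_XsubCl.
  by have := hP c; case: (mup c P) => [|[|[|]]].
have := c3; rewrite mup_geq // => /dvdpP[R RE].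
have R0 : R != 0 by apply: contraNneq P0 => e; rewrite RE e mul0r.
have X0 : ('X - c%:P) ^+ 3 != 0 :> {poly k} by rewrite expf_neq0 // polyXsubC_eq0.
have sR : (size R <= n)%N.
  rewrite -ltnS; apply: leq_trans sP; rewrite RE size_mul // size_exp_XsubC addnS /=.
  by rewrite -[ltnLHS]addn0 ltn_add2l.
have hR d : (3 %| mup d R)%N.
  by have := hP d; rewrite RE mupM // dvdn_addl // mup_XsubCX; case: eqP.
have [Q QE] := IH R sR R0 hR.
by exists (Q * ('X - c%:P)); rewrite exprMn -QE.
Qed.

(** P / Q = P Q^2 / Q^3, and the polynomial P Q^2 has multiplicities divisible by three, so
    [poly_cube] applies to it. *)
Lemma P1_cube (r : kx) : r != 0 -> (forall c : k, (3 %| P1_ord (Some c) r)%Z) -> exists t, r = t ^+ 3.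
Proof.
move=> r0; case/fracdP: (r0) => P Q P0 Q0 h.
have [|c|S SE] := @poly_cube (P * Q ^+ 2); first by rewrite mulf_neq0 ?expf_neq0.
  have := h c; rewrite P1_ordE //= mupM ?expf_neq0 // expr2 mupM //.
  by move: (mup c P) (mup c Q) => x y; lia.
have QF : Q%:F != 0 :> kx by rewrite tofrac_eq0.
exists (S%:F / Q%:F); have aux (K : fieldType) (x y z : K) :
    y != 0 -> x * y ^+ 2 = z ^+ 3 -> x / y = (z / y) ^+ 3.
  by move=> y0 e; rewrite expr_div_n -e; field.
by apply: aux => //; rewrite -!tofracXn -tofracM SE.
Qed.

Lemma ram_le X Y (v : mor X Y) n p : has_dimension (pullback v) (@full _) n -> (ram v p <= n)%N.
Proof.
move=> hn; have := @sum_ram_le _ _ _ v n hn (v p) [:: p] isT.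
by rewrite big_seq1; apply=> x; rewrite inE => /eqP ->.
Qed.

Lemma etaleP X Y (v : mor X Y) : etale v <-> forall p, ram v p = 1%N.
Proof. by split=> h p; apply/ramification_indexP. Qed.

Lemma simply_branched_ram X Y (v : mor X Y) : simply_branched v ->
  forall p, ram v p = 1%N \/ ram v p = 2%N.
Proof.
move=> sb p; have [h|h] := eqVneq (ram v p) 1%N; first by left.
have rp : ramified_at v p by move/ramification_indexP/eqP; rewrite (negPf h).
have [|p1 [_ /ramification_indexP r2 un]] := sb (v p); first by exists p.
by right; rewrite (un p).
Qed.

(** Two points of index two over the same branch point would contribute 4 to a fibre of degree 3. *)
Lemma simply_branched_intro X Y (v : mor X Y) : has_dimension (pullback v) (@full _) 3 ->
  (forall p, (ram v p <= 2)%N) -> simply_branched v.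
Proof.
move=> h3 r2 y [p [py rp]]; have ge1 p' := ram_gt0 v p'.
have rE p' : ramified_at v p' -> ram v p' = 2%N.
  move=> h; apply/eqP; rewrite eqn_leq r2 ltn_neqAle ge1 andbT eq_sym.
  by apply/eqP => e; apply: h; apply/ramification_indexP.
exists p; split=> //; first by apply/ramification_indexP/rE.
move=> p' p'y rp'; apply/eqP/negPn/negP => ne.
have := @sum_ram_le _ _ _ v 3 h3 y [:: p'; p]; rewrite /= inE ne /= => /(_ isT).
rewrite !big_cons big_nil !rE // => H; suff : (4 <= 3)%N by [].
by apply: H => x; rewrite !inE => /orP[]/eqP ->.
Qed.

Section Kummer.
Variables (X Y : curve k) (f : mor X Y) (u : ratfun X) (a : ratfun Y).
Hypotheses (u0 : u != 0) (ua : u ^+ 3 = pullback f a).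

Lemma kummer_a0 : a != 0.
Proof. by rewrite -(fmorph_eq0 (pullback f)) -ua expf_neq0. Qed.

Lemma kummer_ord p : 3%:Z * ord p u = (ram f p)%:Z * ord (f p) a.
Proof. by rewrite -ramE ?kummer_a0 // -ua (valX (ord_weak p)). Qed.

Lemma kummer_dvd p : coprime 3 (ram f p) -> (3 %| ord (f p) a)%Z.
Proof.
move=> cp; have := kummer_ord p; rewrite -(@Gauss_dvdzr 3 (ram f p)) // => <-.
exact: dvdz_mulr.
Qed.

(* After division by a cube, u is a unit at p whose residue c is nonzero; the points p,
   S p, S^2 p are distinct since the residues of u there are c, z c and z^2 c. *)
Lemma kummer_unramified (S : mor X X) (zeta : k) (p : point X) :
  zeta ^+ 2 + zeta + 1 = 0 -> 3%:R != 0 :> k ->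
  deck f S -> pullback S u = cst X zeta * u -> has_dimension (pullback f) (@full _) 3 ->
  (3 %| ord (f p) a)%Z -> ram f p = 1%N.
Proof.
move=> zE n3 [Siso [Sf Sp]] Su h3 /dvdzP[m am].
have [t [t0 vt]] := valuation_uniformizer (curve_smooth (f p)).
have tm0 : t ^ m != 0 by rewrite expfz_neq0.
pose w := u / pullback f (t ^ m).
have fm0 : pullback f (t ^ m) != 0 by rewrite fmorph_eq0.
have w0 : w != 0 by rewrite mulf_neq0 ?invr_eq0.
have Wp := ord_weak p.
have pw : ord p w = 0.
  rewrite (valB_div Wp) // ramE // (valXz (ord_weak _)) // vt mulr1.
  by have := kummer_ord p; rewrite am; lia.
have Sw : pullback S w = cst X zeta * w.
  by rewrite fmorph_div Su -[pullback S _]/((pullback S \o pullback f) _) [_ (t ^ m)]Sp mulrA.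
have [c wc] : exists c, vge (ord p) 1 (w - cst X c).
  by apply: residue_field; rewrite vge_val // pw.
have c0 : c != 0.
  by apply/eqP => e; move: wc; rewrite e rmorph0 subr0 vge_val // pw.
(* Since w composed with S is zeta w, the residue of w at S p' is zeta times its residue at p'. *)
have step p' d : vge (ord p') 1 (w - cst X d) -> vge (ord (S p')) 1 (w - cst X (zeta * d)).
  move=> h; have : vge (ord p') 1 (pullback S (w - cst X (zeta * d))).
    rewrite rmorphB Sw pullback_cst rmorphM -mulrBr.
    exact: vge_cstM (ord_weak p') _ _ _ _.
  have [->|d0] := eqVneq (w - cst X (zeta * d)) 0; first by rewrite vge0.
  by rewrite !vge_val ?fmorph_eq0 // ramE // (iso_ram _ Siso) mul1r.
have diff p' d e : d != e -> vge (ord p') 1 (w - cst X d) -> ~~ vge (ord p') 1 (w - cst X e).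
  move=> de hd; apply/negP => he.
  have : vge (ord p') 1 ((w - cst X e) - (w - cst X d)).
    by apply: (vgeD (ord_weak p')) => //; rewrite (vgeN (ord_weak p')).
  rewrite opprB addrC addrA subrK -rmorphB vge_val ?fmorph_eq0 ?subr_eq0 //.
  by rewrite (val_cst (ord_weak p')) // subr_eq0.
have z1 := root3_neq1 idfun zE n3; rewrite /= in z1.
have z0 := root3_neq0 idfun zE; rewrite /= in z0.
have h1 := step _ _ wc; have h2 := step _ _ h1.
have zc : zeta * c != c by rewrite -subr_eq0 -[X in _ - X]mul1r -mulrBl mulf_neq0 // subr_eq0.
have zzc : zeta * (zeta * c) != zeta * c by rewrite (inj_eq (mulfI z0)).
have zzc' : zeta * (zeta * c) != c.
  apply: contra zc; rewrite mulrA -expr2 => /eqP e; apply/eqP.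
  have := root3X idfun zE; rewrite /= exprS => z3.
  by rewrite -{1}e mulrA z3 mul1r.
rewrite eq_sym in zc; rewrite eq_sym in zzc; rewrite eq_sym in zzc'.
have n1 : p != S p by apply/eqP => e; rewrite -e in h1; case/negP: (diff _ _ _ zc wc).
have n2 : S p != S (S p) by apply/eqP => e; rewrite -e in h2; case/negP: (diff _ _ _ zzc h1).
have n3' : p != S (S p) by apply/eqP => e; rewrite -e in h2; case/negP: (diff _ _ _ zzc' wc).
have := @sum_ram_le _ _ _ f 3 h3 (f p) [:: p; S p; S (S p)].
rewrite /= !inE negb_or n1 n2 n3' /= => /(_ isT).
rewrite !big_cons big_nil => H.
have : (ram f p + (ram f (S p) + (ram f (S (S p)) + 0)) <= 3)%N.
  apply: H => x; rewrite !inE => /or3P[]/eqP -> //; first exact: (Sf p).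
  by rewrite -[RHS](Sf p); apply: (Sf (S p)).
move: (ram_gt0 f p) (ram_gt0 f (S p)) (ram_gt0 f (S (S p))).
by move: (ram f p) (ram f (S p)) (ram f (S (S p))) => x y x'; clear; lia.
Qed.

End Kummer.

End Ramification.

(** The maps [g1] and [g2] are merely linear over F: in [genus_square_ell], [g2] sends be to be u +
    s(be u), which is no field homomorphism. *)
Lemma dimension_direct_sum (F K1 K2 M : fieldType) (c1 : {rmorphism F -> K1})
    (c2 : {rmorphism F -> K2}) (c : {rmorphism F -> M}) (g1 : K1 -> M) (g2 : K2 -> M)
    (L1 : K1 -> Prop) (L2 : K2 -> Prop) (L : M -> Prop) n1 n2 :
  is_subspace c1 L1 -> is_subspace c2 L2 ->
  (forall (I : finType) (r : I -> F) (x : I -> K1), g1 (\sum_i c1 (r i) * x i) = \sum_i c (r i) * g1 (x i)) ->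
  (forall (I : finType) (r : I -> F) (x : I -> K2), g2 (\sum_i c2 (r i) * x i) = \sum_i c (r i) * g2 (x i)) ->
  (forall x y, g1 x + g2 y = 0 -> x = 0 /\ y = 0) ->
  (forall f, L f <-> exists x y, [/\ L1 x, L2 y & f = g1 x + g2 y]) ->
  g1 0 = 0 -> g2 0 = 0 ->
  has_dimension c1 L1 n1 -> has_dimension c2 L2 n2 -> has_dimension c L (n1 + n2).
Proof.
move=> s1 s2 lin1 lin2 inj LE g10 g20.
move=> /(dimension_elim s1)[b1 [f1 Lb1 sp1]] /(dimension_elim s2)[b2 [f2 Lb2 sp2]].
have -> : (n1 + n2)%N = #|{: 'I_n1 + 'I_n2}| by rewrite card_sum !card_ord.
have sumE (r : 'I_n1 + 'I_n2 -> F) :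
    \sum_i c (r i) * (match i with inl i => g1 (b1 i) | inr i => g2 (b2 i) end) =
    g1 (\sum_i c1 (r (inl i)) * b1 i) + g2 (\sum_i c2 (r (inr i)) * b2 i).
  by rewrite big_sumType /= lin1 lin2.
apply: (dimension_intro
  (b := fun i => match i with inl i => g1 (b1 i) | inr i => g2 (b2 i) end)).
- move=> r; rewrite sumE => /inj[e1 e2] [i|i].
    exact: (f1 (r \o inl) e1).
  exact: (f2 (r \o inr) e2).
- case=> i; apply/LE.
    by exists (b1 i), 0; split=> //; [case: s2 | rewrite g20 addr0].
  by exists 0, (b2 i); split=> //; [case: s1 | rewrite g10 add0r].
- move=> f /LE[x [y [/sp1[r1 ->] /sp2[r2 ->] ->]]].
  by exists (fun i => match i with inl i => r1 i | inr i => r2 i end); rewrite sumE.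
Qed.

Section Pullbacks.
Variable k : closedFieldType.
Implicit Types X Y Z : curve k.

Lemma vge_pullback X Y (v : mor X Y) p (d : int) g :
  vge (ord p) ((ram v p)%:Z * d) (pullback v g) = vge (ord (v p)) d g.
Proof.
rewrite /vge fmorph_eq0; have [//|g0 /=] := eqVneq g 0.
by rewrite ramE // ler_pM2l // ltz_nat ram_gt0.
Qed.

Lemma coeff_fibre_comp X Y Z (w : mor Y Z) (v : mor X Y) z p :
  coeff p (fibre_divisor (mor_comp w v) z) =
  (ram v p)%:Z * coeff (v p) (fibre_divisor w z).
Proof. by rewrite !coeff_fibre ram_comp /=; case: ifP => _; rewrite ?mulr0 // PoszM. Qed.

Lemma coeff_fibre_eq X Y (v w : mor X Y) z p : mor_eq v w ->
  coeff p (fibre_divisor v z) = coeff p (fibre_divisor w z).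
Proof. by move=> e; rewrite !coeff_fibre (eq_ram p e) (proj1 e p). Qed.

(** The degree bounds l from above, the functions 1, x, ..., x^m from below. *)
Lemma ell_P1 m : ell (fibre_divisor (mor_id (P1 k)) None *+ m) = m.+1.
Proof.
set B := fibre_divisor _ _; have B0 p : 0 <= coeff p B := fibre_ge0 _ _ _.
apply/eqP; rewrite eqn_leq; apply/andP; split.
  have h1 : has_dimension (pullback (mor_id (P1 k))) (@full _) 1.
    rewrite -card_unit; apply: (dimension_intro (b := fun=> 1)) => //.
      move=> c; rewrite (bigD1 tt) //= big1 => [|[]//].
      by rewrite addr0 mulr1 => c0 [].
    move=> g _; exists (fun=> g).
    by rewrite (bigD1 tt) //= big1 => [|[]//]; rewrite addr0 mulr1.
  have := @ell_effective _ _ (B *+ m); rewrite degMn (deg_fibre _ h1) => h.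
  have : (ell (B *+ m))%:Z <= 1%:Z *+ m + 1.
    by apply: h => p; rewrite coeffMn mulrn_wge0.
  by rewrite -mulr_natr natz mul1r; lia.
have := ell_ge (D := B *+ m) (@pole_function_free k None m.+1); rewrite card_ord; apply=> i.
apply: rr_mono (rrX i (rr_pole_function (mor_id (P1 k)) None)) => p.
by apply: mulrn_coeff_mono => //; rewrite -ltnS.
Qed.

End Pullbacks.

(** * The genera in an S_3-square *)

Section Square.
Variables (k : closedFieldType) (X C C0 : curve k).
Variables (f : mor X C) (pi : mor C (P1 k)) (q : mor X C0) (h : mor C0 (P1 k)).
Hypothesis comm : mor_eq (mor_comp pi f) (mor_comp h q).
Variable zk : k.
Hypotheses (zkE : zk ^+ 2 + zk + 1 = 0) (char3 : 3%:R != 0 :> k).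
Let phi : {rmorphism ratfun (P1 k) -> ratfun X} := pullback (mor_comp pi f).
Let zt : ratfun (P1 k) := P1_cst k zk.
Variables (b c : ratfun (P1 k)) (u : ratfun X) (sigma s : {rmorphism ratfun X -> ratfun X}).
Hypotheses (Hu : cardano phi b c u).
Hypotheses (sphi : forall r, sigma (phi r) = phi r) (tphi : forall r, s (phi r) = phi r).
Hypotheses (su : sigma u = phi zt * u) (tu : s u = phi b / u).
Hypothesis imf : forall x, (exists y, x = pullback f y) <-> sigma x = x.
Hypothesis imq : forall x, (exists y, x = pullback q y) <-> s x = x.

Lemma ztE : zt ^+ 2 + zt + 1 = 0.
Proof. by rewrite -rmorphXn -(rmorph1 (P1_cst k)) -!rmorphD zkE rmorph0. Qed.

Lemma three_P1 : 3%:R != 0 :> ratfun (P1 k).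
Proof. by rewrite -(rmorph_nat (P1_cst k)) fmorph_eq0. Qed.

Let z := phi zt.

Lemma square_zE : z = cst X zk. Proof. exact: (pullback_P1_const (mor_comp pi f) zk). Qed.

Let z2E : z ^+ 2 = - z - 1 := root3E phi ztE.
Let z3E : z ^+ 3 = 1 := root3X phi ztE.
Let u0 : u != 0 := cardano_u0 Hu.
Let s3 := cardano_sigma3 ztE sphi Hu su.
Let t2 := cardano_s2 tphi Hu tu.
Let sz : sigma z = z := sphi zt.
Let tz : s z = z := tphi zt.
Let n3 : 3%:R != 0 :> ratfun X := three_neq0 phi three_P1.

Lemma square_relation x : s (sigma x) = sigma (sigma (s x)).
Proof.
apply: (@hom_eq_gen _ _ _ phi u (s \o sigma) (sigma \o sigma \o s)) => [g|a|] /=.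
- exact: cardano_gen' Hu g.
- by rewrite !(sphi, tphi).
- rewrite su rmorphM tphi tu !fmorph_div !sphi su rmorphM su -/z sz.
  rewrite invfM invfM mulrCA; congr (_ * _); rewrite mulrA; congr (_ * _).
  have z0 : z != 0 := root3_neq0 phi ztE.
  by apply: (mulIf (expf_neq0 2 z0)); rewrite -exprS z3E expr2 -invfM mulVf // mulf_neq0.
Qed.

Lemma square_degrees : [/\ has_dimension (pullback f) (@full _) 3,
  has_dimension (pullback q) (@full _) 2, has_dimension (pullback pi) (@full _) 2 &
  has_dimension (pullback h) (@full _) 3].
Proof.
have h6 : has_dimension phi (@full _) 6 := cardano_dimension Hu.
have hf := cardano_fix_sigma_dim ztE three_P1 sphi Hu su imf.
have hq := cardano_fix_s_dim ztE three_P1 sphi tphi Hu su tu imq.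
split=> //.
  have [d hd] := dimension_tower_bottom (phi := pullback pi) (isT : (0 < 3)%N) h6 hf.
  by case: d hd => [|[|[|d]]].
have h6' : has_dimension (pullback q \o pullback h) (@full _) 6.
  by apply: eq_dimension_hom h6 => r; case: comm => _ e; apply: e.
have [d hd] := dimension_tower_bottom (isT : (0 < 2)%N) h6' hq.
by case: d hd => [|[|[|[|d]]]].
Qed.

(** The poles on X of the coordinate of the projective line. This divisor is invariant under deck
    transformations of the diagonal, so sigma and s preserve bounds by its multiples. *)
Let E : {freeg (point X)} := fibre_divisor (mor_comp pi f) None.

Lemma deck_vge (tau : {rmorphism ratfun X -> ratfun X}) (m : int) (x : ratfun X) :
  (forall r, tau (phi r) = phi r) ->
  (forall p, vge (ord p) (m * coeff p E) x) -> forall p, vge (ord p) (m * coeff p E) (tau x).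
Proof.
move=> tauphi hx p; have [S [SE [Siso Sd]]] := mor_of_automorphism (u := mor_comp pi f) tauphi.
have := vge_pullback S p (m * coeff (S p) E) x; rewrite (iso_ram _ Siso) mul1r hx SE.
suff -> : coeff (S p) E = coeff p E by [].
have := coeff_fibre_comp (mor_comp pi f) S None p; rewrite (iso_ram _ Siso) mul1r => <-.
exact: coeff_fibre_eq.
Qed.

Hypothesis et : etale f.

Let ram1 p : ram f p = 1%N := proj1 (etaleP f) et p.

(** Let u^3 = a in k(C). As f is unramified, the order of a is three times that of u at every point;
    so div a = 3 D, whence deg D = 0, and div u is the pullback of D. *)
Lemma kummer_divisor : exists D : {freeg (point C)}, deg D = 0 /\
  forall p, ord p u = coeff (f p) D.
Proof.
have : exists y, u ^+ 3 = pullback f y.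
  by apply/imf; rewrite rmorphXn su exprMn z3E mul1r.
case=> a ua; have [P [PE P0]] := principal_divisor (kummer_a0 u0 ua).
have ordu p : 3%:Z * ord p u = ord (f p) a by rewrite (kummer_ord u0 ua) ram1 mul1r.
pose D := fgmap xpredT (fun n => (n %/ 3)%Z) P.
have DE p : coeff p D = (ord p a %/ 3)%Z by rewrite fgmap_f0_coeffE // PE.
have uD p : ord p u = coeff (f p) D by rewrite DE -ordu mulrC mulzK.
exists D; split=> //.
have PD : P = D *+ 3.
  apply/eqP/freeg_eqP => y; have [p <-] := mor_surjective f y.
  by rewrite coeffMn -uD PE -ordu -mulr_natr natz mulrC.
move: (congr1 (@deg _) PD); rewrite P0 degMn; move: (deg D) => d.
by rewrite -mulr_natr natz; lia.
Qed.

(** The components r, be u and s(be u) of an element fixed by s are obtained with sigma, s and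
    constants only, so each respects the bound by m E if the element does. Moreover be u respects it
    iff be is in L(m pi^*oo + D), because div u is the pullback of D. The component r contributes m
    + 1. *)
Lemma genus_square_ell (D : {freeg (point C)}) : (forall p, ord p u = coeff (f p) D) ->
  forall m, ell (fibre_divisor h None *+ m) = (m.+1 + ell (fibre_divisor pi None *+ m + D))%N.
Proof.
move=> uD m.
pose w be := pullback f be * u.
have sw be : sigma (w be) = z * w be.
  have -> : sigma (w be) = pullback f be * (z * u).
    by rewrite rmorphM su; congr (_ * _); apply/imf; exists be.
  by rewrite mulrCA.
have /choice[g2 g2E] : forall be, exists y, pullback q y = w be + s (w be).
  move=> be; have [|y ->] := proj2 (imq (w be + s (w be))); last by exists y.
  by rewrite rmorphD t2 addrC.
pose g1 r := pullback h r.
have qh r : pullback q (g1 r) = phi r by case: comm => _ e; rewrite /phi e.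
have wlin (I : finType) (r : I -> k) x : w (\sum_i cst C (r i) * x i) = \sum_i cst X (r i) * w (x i).
  rewrite /w rmorph_sum mulr_suml; apply: eq_bigr => i _.
  by rewrite rmorphM pullback_cst mulrA.
have scst r : s (cst X r) = cst X r by rewrite -(pullback_P1_const (mor_comp pi f) r); apply: tphi.
have coefE p : coeff p E = (ram q p)%:Z * coeff (q p) (fibre_divisor h None).
  by rewrite /E (coeff_fibre_eq _ _ comm) coeff_fibre_comp.
have coefC p : coeff p E = coeff (f p) (fibre_divisor pi None).
  by rewrite /E coeff_fibre_comp ram1 mul1r.
have coefP p : coeff p E = (ram (mor_comp pi f) p)%:Z *
    coeff (mor_comp pi f p) (fibre_divisor (mor_id (P1 k)) None).
  apply: etrans (coeff_fibre_comp (mor_id (P1 k)) (mor_comp pi f) None p).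
  by apply: coeff_fibre_eq; split.
have nm (y : int) : - m%:Z * y = - (y *+ m) by rewrite -mulr_natr natz; ring.
have nm2 (x y : int) : - m%:Z * (x * y) = x * - (y *+ m) by rewrite nm; ring.
have vr r : (forall p, vge (ord p) (- m%:Z * coeff p E) (phi r)) <->
    rr (fibre_divisor (mor_id (P1 k)) None *+ m) r.
  split=> [H|/rrP H p].
    apply/rrP => y; have [p <-] := mor_surjective (mor_comp pi f) y.
    rewrite -vge_pullback coeffMn; have := H p; rewrite coefP.
    by rewrite nm2.
  by rewrite coefP nm2 (vge_pullback (mor_comp pi f)) -coeffMn; apply: H.
have vw be : (forall p, vge (ord p) (- m%:Z * coeff p E) (w be)) <->
    rr (fibre_divisor pi None *+ m + D) be.
  have e p : vge (ord p) (- m%:Z * coeff p E) (w be) =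
      vge (ord (f p)) (- coeff (f p) (fibre_divisor pi None *+ m + D)) be.
    have [->|b0] := eqVneq be 0; first by rewrite /w rmorph0 mul0r !vge0.
    rewrite !vge_val ?mulf_neq0 ?fmorph_eq0 // (valM (ord_weak p)) ?fmorph_eq0 //.
    by rewrite ramE // ram1 mul1r uD coefC coeffD coeffMn nm opprD lerBlDr.
  split=> [H|/rrP H p]; last by rewrite e.
  by apply/rrP => y; have [p <-] := mor_surjective f y; rewrite -e.
have vx y : (forall p, vge (ord p) (- m%:Z * coeff p E) (pullback q y)) <->
    rr (fibre_divisor h None *+ m) y.
  have e p : vge (ord p) (- m%:Z * coeff p E) (pullback q y) =
      vge (ord (q p)) (- coeff (q p) (fibre_divisor h None *+ m)) y.
    by rewrite coefE nm2 vge_pullback coeffMn.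
  split=> [H|/rrP H p]; last by rewrite e.
  by apply/rrP => y'; have [p <-] := mor_surjective q y'; rewrite -e.
apply: ell_eq; rewrite -[m.+1](ell_P1 k m).
apply: (dimension_direct_sum (c := cst C0) (g1 := g1) (g2 := g2)
  (rr_subspace (fibre_divisor (mor_id (P1 k)) None *+ m))
  (rr_subspace (fibre_divisor pi None *+ m + D)) _ _ _ _ _ _ (ellP _) (ellP _)).
- move=> I r x; rewrite /g1 rmorph_sum; apply: eq_bigr => i _.
  by rewrite rmorphM (pullback_P1_const h).
- move=> I r x; apply: (fmorph_inj (pullback q)); rewrite g2E wlin !rmorph_sum -big_split.
  apply: eq_bigr => i _ /=; rewrite [pullback q _]rmorphM pullback_cst g2E.
  by rewrite (rmorphM s (cst X (r i))) scst mulrDr.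
(* s(be u) is an eigenvector for z^2, so its quotient by u^2 is fixed by sigma and [eigen_free]
   separates the three terms. *)
- move=> r be e; have {e} : phi r + pullback f be * u + s (w be) / u ^+ 2 * u ^+ 2 = 0.
    by rewrite divfK ?expf_neq0 // -addrA -[X in _ + X]g2E -qh -rmorphD e rmorph0.
  move/(eigen_free ztE three_P1 sphi u0 su (sphi r)) => [||/eqP h1 /eqP h2 _].
  + by apply/imf; exists be.
  + have -> : sigma (s (w be) / u ^+ 2) = sigma (s (w be)) / (z * u) ^+ 2.
      by rewrite fmorph_div rmorphXn su.
    have -> : sigma (s (w be)) = z ^+ 2 * s (w be).
      have e2 : s (sigma (sigma (w be))) = sigma (s (w be)).
        by rewrite !square_relation s3.
      by rewrite -e2 sw rmorphM sz sw mulrA -expr2 rmorphM rmorphXn tz.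
    have z0 : z != 0 := root3_neq0 phi ztE.
    by rewrite exprMn invfM mulrACA divff ?expf_neq0 // mul1r.
  + by move: h1 h2; rewrite !fmorph_eq0 => /eqP -> /eqP ->.
- move=> y; split=> [/vx H|[r [be [/vr H1 /vw H2 ->]]]]; last first.
    apply/vx => p; rewrite rmorphD qh g2E.
    have W := ord_weak p; apply: (vgeD W) => //; apply: (vgeD W) => //.
    exact: (deck_vge tphi).
  pose x := pullback q y; have sx : s x = x by apply/imq; exists y.
  have H' := deck_vge sphi H; have H'' := deck_vge sphi H'.
  (* Three times the components of x for the eigenvalues 1 and z; [s x1] is three times the
     component for z^2. *)
  pose x0 := x + sigma x + sigma (sigma x).
  pose x1 := x + (- z - 1) * sigma x + z * sigma (sigma x).
  have zzE : - z - 1 = cst X (- zk - 1) by rewrite rmorphB rmorphN rmorph1 -square_zE.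
  have H0 p : vge (ord p) (- m%:Z * coeff p E) x0.
    by have W := ord_weak p; apply: (vgeD W) => //; apply: (vgeD W).
  have H1 p : vge (ord p) (- m%:Z * coeff p E) x1.
    have W := ord_weak p; rewrite /x1 zzE square_zE.
    by apply: (vgeD W); [apply: (vgeD W) => // | ]; apply: vge_cstM W _ _ _ _.
  have stx : s (sigma x) = sigma (sigma x) by rewrite square_relation sx.
  have sttx : s (sigma (sigma x)) = sigma x by rewrite -stx t2.
  have [r rE] : exists r, x0 = phi r.
    apply: (cardano_fixed ztE three_P1 sphi tphi Hu su tu).
      by rewrite /x0 !rmorphD s3 addrC addrA.
    by rewrite /x0 !rmorphD sx stx sttx addrAC.
  have sx1 : sigma x1 = z * x1.
    have szz : sigma (- z - 1) = - z - 1 by rewrite rmorphB rmorphN rmorph1 sz.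
    rewrite /x1 !rmorphD (rmorphM sigma z) (rmorphM sigma (- z - 1)) sz szz s3.
    transitivity (sigma x + (- z - 1) * sigma (sigma x) + z * x
      + (z ^+ 2 + z + 1) * (sigma (sigma x) - sigma x)); last by ring.
    by rewrite z2E; ring.
  have [be beE] : exists be, x1 = w be.
    have [|be bE] := proj2 (imf (x1 / u)); last by exists be; rewrite /w -bE divfK.
    have z0 : z != 0 := root3_neq0 phi ztE.
    by rewrite fmorph_div sx1 su -/z invfM mulrACA divff // mul1r.
  have xE : 3%:R * x = x0 + x1 + s x1.
    have -> : s x1 = x + (- z - 1) * sigma (sigma x) + z * sigma x.
      rewrite /x1 !rmorphD (rmorphM s z) (rmorphM s (- z - 1)) rmorphB rmorphN rmorph1 tz.
      by rewrite sx stx sttx.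
    by rewrite /x0 /x1; ring.
  pose third : k := 3%:R^-1.
  have third1 : cst X third * 3%:R = 1.
    by rewrite -(rmorph_nat (cst X)) -rmorphM mulVf ?rmorph1.
  exists (P1_cst k third * r), (cst C third * be); split.
  + apply/vr => p; rewrite rmorphM -rE [phi _](pullback_P1_const (mor_comp pi f)).
    exact: vge_cstM (ord_weak p) _ _ _ _.
  + apply/vw => p; rewrite /w rmorphM pullback_cst -mulrA -/(w be) -beE.
    exact: vge_cstM (ord_weak p) _ _ _ _.
  + apply: (fmorph_inj (pullback q)); rewrite rmorphD qh g2E -/x.
    have -> : w (cst C third * be) = cst X third * x1.
      by rewrite beE /w rmorphM pullback_cst mulrA.
    rewrite [s _]rmorphM scst rmorphM [phi (_ third)](pullback_P1_const (mor_comp pi f)) -rE.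
    by rewrite -!mulrDr [x0 + _]addrA -xE mulrA third1 mul1r.
- by rewrite /g1 rmorph0.
- by apply: (fmorph_inj (pullback q)); rewrite g2E /w rmorph0 mul0r rmorph0 addr0 rmorph0.
Qed.

(** With l = l(m pi^*oo + D), the numbers 3 m + 1 - (m + 1 + l) on C_0 and 2 m + 1 - l on C differ
    by one, and for large m they are the genera. *)
Lemma genus_square (n : nat) : has_genus C0 n <-> has_genus C n.+1.
Proof.
have [_ _ hpi hh] := square_degrees.
have [D [D0 uD]] := kummer_divisor; have ellE := genus_square_ell uD.
have chiE m : chi (fibre_divisor h None *+ m + 0) + 1 = chi (fibre_divisor pi None *+ m + D).
  rewrite addr0 /chi ellE degD !degMn D0 (deg_fibre None hh) (deg_fibre None hpi).
  rewrite -[3%:Z *+ m]mulr_natr -[2%:Z *+ m]mulr_natr !natz.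
  by move: (ell _) => l; clear; lia.
rewrite (genusP 0 n hh) // (genusP D n.+1 hpi) //.
by split=> -[m0 H]; exists m0 => m /H; have := chiE m; lia.
Qed.

End Square.

(** * Fixed fields and splitting fields of cubics *)

Section FixedField.
Variables (L : fieldType) (s : {rmorphism L -> L}).

Definition fixed_pred : {pred L} := fun x => s x == x.

Lemma fixed_divring_closed : divring_closed fixed_pred.
Proof.
split=> [|x y|x y]; rewrite !unfold_in; first by rewrite rmorph1.
  by move=> /eqP sx /eqP sy; rewrite rmorphB sx sy.
by move=> /eqP sx /eqP sy; rewrite fmorph_div sx sy.
Qed.

HB.instance Definition _ := GRing.isDivringClosed.Build L fixed_pred fixed_divring_closed.

(** The fixed elements form a type of their own, so that the fixed field is a [fieldType] and can
    serve as the function field of a curve. *)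
Record fixed_field := FixedField { fixed_val : L; fixed_valP : fixed_val \in fixed_pred }.

HB.instance Definition _ := [isSub for fixed_val].
HB.instance Definition _ := [Choice of fixed_field by <:].
HB.instance Definition _ := [SubChoice_isSubComUnitRing of fixed_field by <:].
HB.instance Definition _ := [SubComUnitRing_isSubIntegralDomain of fixed_field by <:].
HB.instance Definition _ := [SubIntegralDomain_isSubField of fixed_field by <:].

Definition fixed_incl : {rmorphism fixed_field -> L} := (val : {rmorphism fixed_field -> L}).

Lemma fixed_inclP x : (exists y, x = fixed_incl y) <-> s x = x.
Proof.
split=> [[y ->]|sx]; first by apply/eqP; apply: (fixed_valP y).
have h : x \in fixed_pred by rewrite unfold_in sx.
by exists (FixedField h).
Qed.

End FixedField.

Lemma fixed_curve (k : closedFieldType) (X Y : curve k) (g : mor X Y)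
    (s : {rmorphism ratfun X -> ratfun X}) : (forall r, s (pullback g r) = pullback g r) ->
  exists (Z : curve k) (q : mor X Z) (h : mor Z Y),
    mor_eq (mor_comp h q) g /\ forall x, (exists y, x = pullback q y) <-> s x = x.
Proof.
move=> sg; have [r|th thE] := @hom_factor _ _ _ (fixed_incl s) (pullback g).
  by have [y yE] := proj2 (fixed_inclP s (pullback g r)) (sg r); exists y.
pose cstZ : {rmorphism k -> fixed_field s} := th \o cst Y.
have cE a : fixed_incl s (cstZ a) = cst X a by apply: etrans (thE (cst Y a)) (pullback_cst g a).
have ffZ : function_field cstZ.
  have [|n hn] := @finite_over_bottom _ _ _ th (fixed_incl s).
    have [n hn] := pullback_finite g; exists n; apply: eq_dimension_hom hn => r.
    exact: esym (thE r).
  by apply: (function_field_up (phi := th) _ (@curve_function_field _ Y)) => //; exists n.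
pose Z := curve_of_field ffZ.
have [q qE] := @mor_of_hom _ X Z (fixed_incl s) cE.
have [h hE] := @mor_of_hom _ Z Y th (fun=> erefl).
exists Z, q, h; split; first by apply: mor_ext => r /=; rewrite qE hE thE.
by move=> x; rewrite qE; apply: fixed_inclP.
Qed.

(** If a relation involved b_i0, this vector could be dropped, leaving a spanning family smaller
    than the dimension. *)
Lemma span_free (F K : fieldType) (phi : {rmorphism F -> K}) (I : finType) (b : I -> K) :
  has_dimension phi (@full K) #|I| ->
  (forall f, exists r : I -> F, f = \sum_i phi (r i) * b i) -> free_family phi b.
Proof.
move=> hn span c c0 i0; apply/eqP/negPn/negP => ci.
have [e [ef _ _]] := dimension_elim (subspace_full phi) hn.
have : (#|{: 'I_#|I|}| <= #|{: {i in predC1 i0}}|)%N.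
  apply: (free_card_le (b := fun j => b (val j)) ef) => l.
  have [r ->] := span (e l).
  exists (fun j => r (val j) - r i0 / c i0 * c (val j)).
  have pc : phi (c i0) != 0 by rewrite fmorph_eq0.
  have bE : b i0 = - \sum_(i | i != i0) phi (c i / c i0) * b i.
    apply: (mulfI pc); move/eqP: c0; rewrite (bigD1 i0) //= addr_eq0 => /eqP ->.
    rewrite mulrN mulr_sumr; congr (- _); apply: eq_bigr => i _.
    by rewrite mulrA -rmorphM [c i0 * _]mulrC divfK.
  rewrite (bigD1 i0) //= {1}bE mulrN mulr_sumr -sumrN -big_split /=.
  rewrite -[RHS](big_sub (predC1 i0) (fun i => phi (r i - r i0 / c i0 * c i) * b i)).
  apply: eq_bigr => i _; rewrite rmorphB mulrBl addrC; congr (_ - _).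
  by rewrite mulrA -rmorphM; congr (phi _ * _); rewrite mulrA mulrAC.
rewrite card_ord card_sig cardC1.
have : (0 < #|I|)%N by apply/card_gt0P; exists i0.
by case: #|I| => // m _; rewrite ltnn.
Qed.

Lemma cardano_eq_hom (F L : fieldType) (phi psi : {rmorphism F -> L}) b c u :
  phi =1 psi -> cardano phi b c u -> cardano psi b c u.
Proof.
move=> e [b0 rel gen fr]; have eP (P : {poly F}) : map_poly psi P = map_poly phi P.
  by apply: eq_map_poly => a; rewrite e.
split=> // [|f|P]; first by rewrite -!e.
  by have [P sP ->] := gen f; exists P; rewrite ?eP.
by rewrite eP; apply: fr.
Qed.

Section CardanoAutomorphisms.
Variables (F L : fieldType) (phi : {rmorphism F -> L}) (zeta : F).
Hypotheses (zetaE : zeta ^+ 2 + zeta + 1 = 0) (char3 : 3%:R != 0 :> F).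
Let z : L := phi zeta.
Variables (b c : F) (u : L) (Hu : cardano phi b c u).
Let u0 := cardano_u0 Hu.
Let z3 : z ^+ 3 = 1 := root3X phi zetaE.

(** z^i u is the image of u under an automorphism over F. This freedom is used to adapt u to a given
    involution. *)
Lemma cardano_rotate i : cardano phi b c (z ^+ i * u).
Proof.
have [tau [tphi tu]] := cardano_aut_rotation zetaE Hu i.
have [f|tinv [tK Kt]] := @hom_bij_inverse _ _ tau.
  apply: (@semilinear_surjective _ _ _ _ phi phi idfun tau 6 tphi) => [y||].
  - by exists y.
  - exact: cardano_dimension Hu.
  - exact: cardano_dimension Hu.
have tP (P : {poly F}) : (map_poly phi P).[z ^+ i * u] = tau (map_poly phi P).[u].
  rewrite -tu -horner_map -map_poly_comp; congr (_.[_]).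
  by apply: eq_map_poly => a; rewrite /= tphi.
split; first exact: (cardano_b Hu).
- have := congr1 tau (cardano_rel Hu).
  by rewrite rmorph0 rmorphD rmorphB (rmorphM tau (phi c)) !(rmorphXn tau) !tphi tu.
- move=> f; have [P sP PE] := cardano_gen Hu (tinv f); exists P => //.
  by rewrite tP -PE Kt.
- move=> P sP; rewrite tP => /eqP; rewrite fmorph_eq0 => /eqP.
  exact: (cardano_free Hu).
Qed.

Lemma reflection_involutive (tau : {rmorphism L -> L}) i : (forall a, tau (phi a) = phi a) ->
  tau u = z ^+ i * (phi b / u) -> forall x, tau (tau x) = x.
Proof.
move=> tphi tu x; have z0 : z ^+ i != 0 by rewrite expf_neq0 // (root3_neq0 phi zetaE).
have b0 : phi b != 0 by rewrite fmorph_eq0 (cardano_b Hu).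
apply: (@hom_eq_gen F L L phi u (tau \o tau) idfun) => [f|a|] /=.
- exact: cardano_gen' Hu f.
- by rewrite !tphi.
- rewrite tu rmorphM rmorphXn /z !tphi -/z fmorph_div tphi tu.
  move: (z ^+ i) (phi b) z0 b0 u0 => y y' y0 y'0 u1; field.
  by rewrite ?y0 ?y'0 ?u1.
Qed.

Lemma generator_fixed (tau : {rmorphism L -> L}) : (forall a, tau (phi a) = phi a) ->
  tau u = u -> forall x, tau x = x.
Proof.
move=> tphi tu x; apply: (@hom_eq_gen F L L phi u tau idfun) => [f|a|] //=.
exact: cardano_gen' Hu f.
Qed.

(** A rotation u -> z^i u whose square is the identity is trivial, so a nontrivial involution is a
    reflection. *)
Lemma order_two (tau : {rmorphism L -> L}) : (forall a, tau (phi a) = phi a) ->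
  (forall x, tau (tau x) = x) -> (exists x, tau x != x) ->
  exists i, tau u = z ^+ i * (phi b / u).
Proof.
move=> tphi t2 [x tx]; have [i [tu|tu]] := cardano_aut_list zetaE Hu tphi; last by exists i.
have /eqP := t2 u; rewrite tu rmorphM rmorphXn /z tphi -/z tu mulrA -exprD.
rewrite -subr_eq0 -{2}[u]mul1r -mulrBl mulf_eq0 (negPf u0) orbF subr_eq0 => /eqP e.
have zi : z ^+ i = 1.
  have : z ^+ (i + i) * z ^+ (i + i) = z ^+ (3 * i) * z ^+ i.
    by rewrite -!exprD; congr (_ ^+ _); clear; lia.
  by rewrite e exprM z3 expr1n !mul1r.
by case/eqP: tx; apply: (generator_fixed tphi); rewrite tu zi mul1r.
Qed.

(** Reflections are involutions, so an automorphism of order three is sigma or its square, and these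
    have the same fixed field. *)
Lemma order_three (tau sigma : {rmorphism L -> L}) : (forall a, tau (phi a) = phi a) ->
  (forall a, sigma (phi a) = phi a) -> sigma u = z * u ->
  (forall x, tau (tau (tau x)) = x) -> (exists x, tau x != x) ->
  forall x, tau x = x <-> sigma x = x.
Proof.
move=> tphi sphi su t3 [x tx].
have s3 := cardano_sigma3 zetaE sphi Hu su.
have sz : sigma z = z := sphi _.
have eqg (t t' : {rmorphism L -> L}) : (forall a, t (phi a) = phi a) ->
    (forall a, t' (phi a) = phi a) -> t u = t' u -> t =1 t'.
  by move=> h h' e; apply: (hom_eq_gen (cardano_gen' Hu)) => // a; rewrite h h'.
have [i [tu|tu]] := cardano_aut_list zetaE Hu tphi; last first.
  by case/eqP: tx; have t2 := reflection_involutive tphi tu; rewrite -{2}[x]t3 t2.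
case: i tu => -[|[|[|//]]] lt /= tu.
- by case/eqP: tx; apply: (generator_fixed tphi); rewrite tu mul1r.
- have e : tau =1 sigma by apply: eqg => //; rewrite tu su expr1.
  by move=> y; rewrite e.
- have e : tau =1 sigma \o sigma.
    by apply: eqg => // [a|]; rewrite /= ?sphi // tu su rmorphM sz su mulrA.
  by move=> y; rewrite e /=; split=> h; [rewrite -{2}[y]s3 h | rewrite !h].
Qed.

End CardanoAutomorphisms.

(** * Depressed cubics and their splitting fields *)

Section CubicClosure.
Variables (F K : fieldType) (phi : {rmorphism F -> K}).
Hypothesis h3 : has_dimension phi (@full K) 3.

Let im y := exists a, y = phi a.

(** Otherwise M = F + F y would be a field of degree two. With x outside M, the elements 1, y, x, x
    y would be independent, four of them in an extension of degree three. *)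
Lemma cubic_no_quadratic y p q : ~ im y -> y ^+ 2 <> phi p + phi q * y.
Proof.
move=> ny y2; pose M g := exists a e, g = phi a + phi e * y.
have lin a e : phi a + phi e * y = 0 -> a = 0 /\ e = 0.
  move=> h; have e0 : e = 0.
    apply/eqP/negPn/negP => e0; apply: ny; exists (- a / e).
    have pe : phi e != 0 by rewrite fmorph_eq0.
    apply: (mulfI pe); rewrite -rmorphM [e * _]mulrC divfK // rmorphN.
    by apply/eqP; rewrite -addr_eq0 addrC h.
  by split=> //; move/eqP: h; rewrite e0 rmorph0 mul0r addr0 fmorph_eq0 => /eqP.
have MM g g' : M g -> M g' -> M (g * g').
  move=> [a [e ->]] [a' [e' ->]].
  exists (a * a' + e * e' * p), (a * e' + a' * e + e * e' * q).
  rewrite !rmorphD !rmorphM.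
  transitivity (phi a * phi a' + (phi a * phi e' + phi a' * phi e) * y + phi e * phi e' * y ^+ 2).
    by ring.
  by rewrite y2; ring.
have MV g : M g -> M g^-1.
  move=> [a [e ->]]; have [->|g0] := eqVneq (phi a + phi e * y) 0.
    by rewrite invr0; exists 0, 0; rewrite rmorph0 mul0r addr0.
  (* The conjugate of a + e y: the second root of Y^2 = p + q Y is q - y. *)
  pose g' := phi (a + e * q) + phi (- e) * y.
  have nE : (phi a + phi e * y) * g' = phi (a * (a + e * q) - e ^+ 2 * p).
    rewrite /g' rmorphB !rmorphM !rmorphD rmorphN !rmorphM.
    transitivity (phi a * (phi a + phi e * phi q) + phi e * phi e * phi q * y - phi e * phi e * y ^+ 2).
      by ring.
    by rewrite y2; ring.
  have g'0 : g' != 0.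
    apply/eqP => /lin[h1 /eqP]; rewrite oppr_eq0 => /eqP h2.
    by move: h1 g0; rewrite h2 mul0r addr0 => ->; rewrite rmorph0 mul0r addr0 eqxx.
  exists ((a + e * q) / (a * (a + e * q) - e ^+ 2 * p)), (- e / (a * (a + e * q) - e ^+ 2 * p)).
  apply: (mulfI g0); rewrite divff // !fmorph_div -nE [_ / _ * y]mulrAC -mulrDl -/g' mulrA divff //.
  by rewrite mulf_neq0.
have [x nx] : exists x, ~ M x.
  apply/existsNP => hM; have [b [bf _ _]] := dimension_elim (subspace_full phi) h3.
  have := free_card_le (b := fun i : bool => if i then y else 1) bf.
  rewrite card_ord card_bool => H; suff : (3 <= 2)%N by [].
  apply: H => i; have [a [e ->]] := hM (b i).
  by exists (fun i => if i then e else a); rewrite big_bool /= mulr1 addrC.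
have : (#|{: bool * bool}| <= 3)%N.
  apply: (dimension_free_le (c := fun ij => (if ij.1 then y else 1) * (if ij.2 then x else 1)) h3) => //.
  move=> r r0; have e : \sum_(i : bool) \sum_(j : bool)
      phi (r (i, j)) * ((if i then y else 1) * (if j then x else 1)) = 0.
    by rewrite pair_bigA; apply: etrans r0; apply: eq_bigr => -[i j] _.
  rewrite !big_bool /= !mulr1 !mul1r in e.
  have e' : (phi (r (false, false)) + phi (r (true, false)) * y)
     + (phi (r (false, true)) + phi (r (true, true)) * y) * x = 0.
    by rewrite -[RHS]e; ring.
  have A0 : phi (r (false, true)) + phi (r (true, true)) * y = 0.
    apply/eqP/negPn/negP => A0; apply: nx.
    have -> : x = (phi (- r (false, false)) + phi (- r (true, false)) * y)
        * (phi (r (false, true)) + phi (r (true, true)) * y)^-1.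
      apply: (mulIf A0); rewrite mulfVK // mulrC.
      by apply/eqP; rewrite -subr_eq0 !rmorphN; apply/eqP; rewrite -[RHS]e'; ring.
    apply: MM; first by exists (- r (false, false)), (- r (true, false)).
    by apply: MV; exists (r (false, true)), (r (true, true)).
  move: e'; rewrite A0 mul0r addr0 => /lin[r1 r2]; have [r3 r4] := lin _ _ A0.
  by case=> -[] [].
by rewrite card_prod card_bool.
Qed.

Lemma cubic_generator_free w p0 p1 p2 : ~ im w ->
  phi p0 + phi p1 * w + phi p2 * w ^+ 2 = 0 -> [/\ p0 = 0, p1 = 0 & p2 = 0].
Proof.
move=> nw e; have p20 : p2 = 0.
  apply/eqP/negPn/negP => n2; apply: (cubic_no_quadratic (p := - p0 / p2) (q := - p1 / p2) nw).
  have pp : phi p2 != 0 by rewrite fmorph_eq0.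
  apply: (mulfI pp); rewrite !fmorph_div !rmorphN; apply/eqP; rewrite -subr_eq0; apply/eqP.
  by rewrite -[RHS]e; field.
move: e; rewrite p20 rmorph0 mul0r addr0 => e.
have p10 : p1 = 0.
  apply/eqP/negPn/negP => n1; apply: nw; exists (- p0 / p1).
  have pp : phi p1 != 0 by rewrite fmorph_eq0.
  by apply: (mulfI pp); rewrite fmorph_div rmorphN [RHS]mulrC divfK //; apply/eqP; rewrite -addr_eq0 addrC e.
by split=> //; move/eqP: e; rewrite p10 rmorph0 mul0r addr0 fmorph_eq0 => /eqP.
Qed.

Lemma cubic_generator_span w : ~ im w ->
  forall g, exists p0 p1 p2, g = phi p0 + phi p1 * w + phi p2 * w ^+ 2.
Proof.
move=> nw g; have fw : free_family phi (fun i : 'I_3 => w ^+ i).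
  move=> r; rewrite sum3 => /(cubic_generator_free nw)[h0 h1 h2] i.
  rewrite -(inord_val i); move: (val i) (ltn_ord i).
  by case=> [|[|[|//]]].
have [r ->] := free_span (subspace_full phi) h3 (card_ord 3) fw (fun=> I) (I : full g).
by exists (r (inord 0)), (r (inord 1)), (r (inord 2)); rewrite sum3.
Qed.

Lemma cubic_nontrivial : exists y, ~ im y.
Proof.
apply/existsNP => h; have [b [bf _ _]] := dimension_elim (subspace_full phi) h3.
have := free_card_le (b := fun _ : unit => 1) bf.
rewrite card_ord card_unit => H; suff : (3 <= 1)%N by [].
apply: H => i; have [a ->] := h (b i); exists (fun=> a).
by rewrite (bigD1 tt) //= big1 => [|[]//]; rewrite addr0 mulr1.
Qed.

(** Subtracting from a generator a third of the coefficient [p2] removes the quadratic term. *)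
Lemma depressed_cubic : 3%:R != 0 :> F ->
  exists w b c, ~ im w /\ w ^+ 3 = 3%:R * phi b * w + phi c.
Proof.
move=> n3; have [y ny] := cubic_nontrivial.
have [p0 [p1 [p2 y3]]] := cubic_generator_span ny (y ^+ 3).
have n3' : 3%:R != 0 :> K by rewrite -(rmorph_nat phi) fmorph_eq0.
have [g gE] : exists g, p2 = 3%:R * g by exists (p2 / 3%:R); rewrite mulrC divfK.
exists (y - phi g), (p1 / 3%:R + g ^+ 2), (p0 + p1 * g + 2%:R * g ^+ 3); split.
  by case=> a ya; apply: ny; exists (a + g); rewrite rmorphD -ya subrK.
have e3 : 3%:R * phi (p1 / 3%:R + g ^+ 2) = phi p1 + 3%:R * phi g ^+ 2.
  by rewrite rmorphD fmorph_div rmorph_nat rmorphXn; field.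
rewrite e3 !rmorphD !rmorphM rmorph_nat.
transitivity (y ^+ 3 - 3%:R * phi g * y ^+ 2 + 3%:R * phi g ^+ 2 * y - phi g ^+ 3); first by ring.
by rewrite y3 gE rmorphM rmorph_nat; ring.
Qed.

(* K(u) with u^2 - w u + b = 0, so that w = u + b/u *)
Lemma cubic_closure w b c : 2%:R != 0 :> F -> ~ im w -> w ^+ 3 = 3%:R * phi b * w + phi c ->
  (forall r, r ^+ 2 - w * r + phi b <> 0) ->
  exists (L : fieldType) (psi : {rmorphism K -> L}) (u : L),
    [/\ cardano (psi \o phi) b c u, u != 0, psi w = u + psi (phi b) / u
      & has_dimension psi (@full L) 2].
Proof.
move=> n2 nw w3 irr.
pose P : {poly K} := 'X^2 - w%:P * 'X + (phi b)%:P.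
have sP : size P = 3.
  rewrite /P -addrA size_polyDl size_polyXn // ltnS.
  apply: leq_trans (size_polyD _ _) _; rewrite geq_max size_polyN; apply/andP; split.
    by rewrite mul_polyC; apply: leq_trans (size_scale_leq _ _) _; rewrite size_polyX.
  by apply: leq_trans (size_polyC_leq1 _) _.
have irrP : irreducible_poly P.
  apply: cubic_irreducible; rewrite ?sP // => r; apply/negP.
  by rewrite /root /P hornerD hornerD hornerN hornerCM hornerXn hornerX hornerC => /eqP/irr.
have [L dimL [u ru _]] := irredp_FAdjoin irrP.
have [psi psiE] : exists psi : {rmorphism K -> L}, in_alg L =1 psi by exists (in_alg L).
have uE : u ^+ 2 - psi w * u + psi (phi b) = 0.
  move/eqP: ru; rewrite (eq_map_poly psiE) /P rmorphD rmorphB (rmorphM _ w%:P) /= map_polyXn !map_polyC map_polyX.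
  by rewrite 2!hornerD hornerN hornerCM hornerXn hornerX hornerC.
have b0 : b != 0.
  apply/eqP => b0; apply: (irr 0); rewrite b0 rmorph0 expr0n /= mulr0 subrr addr0 //.
have u0 : u != 0.
  apply/eqP => e; move: uE; rewrite e expr2 mul0r mulr0 subrr add0r => /eqP.
  by rewrite !fmorph_eq0 (negPf b0).
have wE : psi w = u + psi (phi b) / u.
  apply: (mulIf u0); rewrite mulrDl divfK // -expr2; apply/eqP; rewrite -subr_eq0 -oppr_eq0.
  by apply/eqP; rewrite -[RHS]uE; ring.
have h2 : has_dimension psi (@full L) 2.
  have bas := vbasisP {:L}.
  have d2 : 2%N = \dim {:L} by rewrite dimL sP.
  pose bb i := (vbasis {:L})`_i.
  rewrite d2 -[\dim _]card_ord.
  apply: (dimension_intro (b := fun i : 'I_(\dim {:L}) => bb i)) => //.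
    move=> r r0 i; have fr := basis_free bas.
    have /freeP H := fr; apply: (H r); rewrite -[RHS]r0; apply: eq_bigr => j _.
    by rewrite -psiE /= mulr_algl.
  move=> g _; exists (fun i => coord (vbasis {:L}) i g).
  rewrite {1}(coord_vbasis (memvf g)); apply: eq_bigr => i _.
  by rewrite -psiE /= mulr_algl.
have h6 : has_dimension (psi \o phi) (@full L) 6 by apply: (dimension_tower h3 h2).
exists L, psi, u; split=> //.
pose ph : {rmorphism F -> L} := psi \o phi; change (cardano ph b c u).
have rel : u ^+ 6 - ph c * u ^+ 3 + ph b ^+ 3 = 0.
  have cE : ph c = u ^+ 3 + (ph b / u) ^+ 3.
    have -> : ph c = psi w ^+ 3 - 3%:R * ph b * psi w.
      by rewrite -rmorphXn w3 rmorphD !rmorphM rmorph_nat /= [X in X - _]addrC addrK.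
    by rewrite wE /ph /=; move: (psi (phi b)) => y; field.
  rewrite cE mulrDl expr_div_n divfK ?expf_neq0 //; ring.
(* The subring F[u]. By the sextic relation it contains 1/u, hence w = u + b/u, hence K and all of
   L; since L has degree six, the first six powers of u are then free. *)
pose G g := exists Q : {poly F}, g = (map_poly ph Q).[u].
have GD g g' : G g -> G g' -> G (g + g').
  by move=> [Q ->] [Q' ->]; exists (Q + Q'); rewrite rmorphD hornerD.
have GM g g' : G g -> G g' -> G (g * g').
  by move=> [Q ->] [Q' ->]; exists (Q * Q'); rewrite rmorphM hornerM.
have Gc a : G (ph a) by exists a%:P; rewrite map_polyC hornerC.
have Gu : G u by exists 'X; rewrite map_polyX hornerX.
have GuX n : G (u ^+ n) by elim: n => [|n IH]; [rewrite expr0 -(rmorph1 ph) | rewrite exprS; apply: GM].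
have pb0 : ph b != 0 by rewrite fmorph_eq0.
have Gui : G u^-1.
  have -> : u^-1 = ph (b ^- 3) * (ph c * u ^+ 2 + ph (- 1) * u ^+ 5).
    have pb3 : ph (b ^+ 3) != 0 by rewrite fmorph_eq0 expf_neq0.
    apply: (mulIf u0); rewrite mulVf // fmorphV rmorphN1.
    apply: (mulfI pb3); rewrite mulr1 -mulrA mulVKf // rmorphXn.
    by apply/eqP; rewrite -subr_eq0; apply/eqP; rewrite -[RHS]rel; ring.
  by apply: (GM) => //; apply: GD; apply: (GM).
have Gw : G (psi w) by rewrite wE; apply: GD => //; apply: GM => //; apply: (Gc b).
have Gpsi g : G (psi g).
  have [p0 [p1 [p2 ->]]] := cubic_generator_span nw g.
  rewrite !rmorphD !rmorphM.
  apply: (GD); first apply: (GD); first exact: (Gc p0).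
    by apply: (GM) => //; apply: (Gc p1).
  by apply: (GM); [apply: (Gc p2) | apply: (GM)].
have nu : ~ exists g, u = psi g.
  case=> g ug; apply: (irr g); apply: (fmorph_inj psi).
  by rewrite rmorph0 rmorphD rmorphB rmorphXn (rmorphM psi w) -ug uE.
have gen g : exists2 Q : {poly F}, (size Q <= 6)%N & g = (map_poly ph Q).[u].
  have [Q ->] : G g.
    have fu : free_family psi (fun i : bool => if i then u else 1).
      move=> r; rewrite big_bool /= mulr1 => r0.
      have rt : r true = 0.
        apply/eqP/negPn/negP => rt; apply: nu; exists (- r false / r true).
        have pr : psi (r true) != 0 by rewrite fmorph_eq0.
        apply: (mulfI pr); rewrite -rmorphM [r true * _]mulrC divfK // rmorphN.
        by apply/eqP; rewrite -addr_eq0 r0.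
      by case=> //; move/eqP: r0; rewrite rt rmorph0 mul0r add0r fmorph_eq0 => /eqP.
    have [r ->] := free_span (subspace_full psi) h2 card_bool fu (fun=> I) (I : full g).
    by rewrite big_bool /= mulr1; apply: (GD) => //; apply: (GM).
  exists (Q %% cardano_poly b c).
    have : (size (Q %% cardano_poly b c)%R < size (cardano_poly b c))%N.
      by rewrite ltn_modp -size_poly_eq0 size_cardano_poly.
    by rewrite size_cardano_poly ltnS.
  rewrite {1}(divp_eq Q (cardano_poly b c)) rmorphD rmorphM hornerD hornerM.
  by rewrite [X in _ * X](horner_cardano_poly ph) rel mulr0 add0r.
split=> //; apply/free6; apply: span_free; first by rewrite card_ord.
move=> g; have [Q sQ ->] := gen g; exists (fun i : 'I_6 => Q`_i).
rewrite (@horner_coef_wide _ 6) ?size_map_poly //.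
by apply: eq_bigr => i _; rewrite coef_map.
Qed.

End CubicClosure.

Lemma reflection_of_rotated (L : fieldType) (z v B : L) i : z ^+ 3 = 1 -> z != 0 -> v != 0 ->
  z ^+ i * (z ^+ i * (B / v)) = B / (z ^+ i * v).
Proof.
move=> z3 z0 v0; have := expf_neq0 i z0.
have : (z ^+ i) ^+ 3 = 1 by rewrite -exprM mulnC exprM z3 expr1n.
move: (z ^+ i) => w w3 w0; apply: (canRL (mulfK (mulf_neq0 w0 v0))).
rewrite -[RHS]mul1r -w3; field.
by [].
Qed.

(** * The correspondence *)

Section S3Squares.
Variables (k : closedFieldType) (zk : k).
Hypotheses (zkE : zk ^+ 2 + zk + 1 = 0) (char3 : 3%:R != 0 :> k) (char2 : 2%:R != 0 :> k).

Let zt : ratfun (P1 k) := P1_cst k zk.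
Let ztE' : zt ^+ 2 + zt + 1 = 0 := ztE zkE.
Let three' : 3%:R != 0 :> ratfun (P1 k) := three_P1 char3.

Lemma cst_root3 (X : curve k) : cst X zk ^+ 2 + cst X zk + 1 = 0.
Proof. by rewrite -rmorphXn -(rmorph1 (cst X)) -!rmorphD zkE rmorph0. Qed.

Lemma cst_nat_neq0 (X : curve k) n : n%:R != 0 :> k -> n%:R != 0 :> ratfun X.
Proof. by move=> n0; rewrite -(rmorph_nat (cst X)) fmorph_eq0. Qed.

(** The common normal form: k(C) and k(C_0) appear in k(X) as the fixed fields of sigma and s, and u
    is chosen so that s u = b / u without a power of z. *)
Record s3_square (X C C0 : curve k) (f : mor X C) (pi : mor C (P1 k)) (q : mor X C0)
  (h : mor C0 (P1 k)) (b c : ratfun (P1 k)) (u : ratfun X)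
  (sigma s : {rmorphism ratfun X -> ratfun X}) : Prop := S3Square {
  sq_comm : mor_eq (mor_comp pi f) (mor_comp h q);
  sq_cardano : cardano (pullback (mor_comp pi f)) b c u;
  sq_sphi : forall r, sigma (pullback (mor_comp pi f) r) = pullback (mor_comp pi f) r;
  sq_tphi : forall r, s (pullback (mor_comp pi f) r) = pullback (mor_comp pi f) r;
  sq_su : sigma u = pullback (mor_comp pi f) zt * u;
  sq_tu : s u = pullback (mor_comp pi f) b / u;
  sq_imf : forall x, (exists y, x = pullback f y) <-> sigma x = x;
  sq_imq : forall x, (exists y, x = pullback q y) <-> s x = x
}.

Lemma s3_square_degrees X C C0 f pi q h b c u sigma s :
  @s3_square X C C0 f pi q h b c u sigma s ->
  [/\ has_dimension (pullback f) (@full _) 3,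
  has_dimension (pullback q) (@full _) 2, has_dimension (pullback pi) (@full _) 2 &
  has_dimension (pullback h) (@full _) 3].
Proof.
case=> comm Hu sphi tphi su tu imf imq.
exact: (square_degrees comm zkE char3 Hu sphi tphi su tu imf imq).
Qed.

Lemma s3_square_genus X C C0 f pi q h b c u sigma s n :
  @s3_square X C C0 f pi q h b c u sigma s -> etale f ->
  has_genus C0 n <-> has_genus C n.+1.
Proof.
case=> comm Hu sphi tphi su tu imf imq et.
exact: (genus_square comm zkE char3 Hu sphi tphi su tu imf imq et).
Qed.

(** The automorphism tau of the cyclic cover and the involution rho of q need not be those supplied
    by the S_3-structure. But tau has the same fixed field as sigma, and rho v = z^i b / v becomes b
    / u for u = z^i v, since z^(3 i) = 1. *)
Lemma s3_square_exists (X C C0 : curve k) (f : mor X C) (pi : mor C (P1 k)) (q : mor X C0)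
    (h : mor C0 (P1 k)) :
  mor_eq (mor_comp pi f) (mor_comp h q) -> galois_with {perm 'I_3} (mor_comp pi f) ->
  galois_with 'Z_3 f -> has_dimension (pullback h) (@full _) 3 ->
  exists b c u sigma s, s3_square f pi q h b c u sigma s.
Proof.
move=> comm /S3_automorphisms[h6 [sg [s0 [sphi s0phi [g3 s02 rel] [x gx]]]]].
move=> /Z3_automorphism[hf [tau [tauf tau3 tx]]] hh.
set phi : {rmorphism _ -> _} := pullback (mor_comp pi f) in h6 sphi s0phi *.
have [b [c [v [Hv sv s0v]]]] := s3_cardano ztE' three' sphi s0phi h6 g3 s02 rel (ex_intro _ x gx).
have tauphi r : tau (phi r) = phi r by apply: tauf.
have fix_tau := order_three ztE' Hv tauphi sphi sv tau3 tx.
have [w [_ _ _ _ base]] :=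
  cyclic_cubic (cst_root3 C) (cst_nat_neq0 C char3) hf tauf tau3 tx.
have h6' : has_dimension (pullback q \o pullback h) (@full _) 6.
  by apply: eq_dimension_hom h6 => r; case: comm => _ e; apply: e.
have [m hq m6] := dimension_tower_top (isT : (0 < 3)%N) h6' hh.
have {m6} m2 : m = 2 by move: m6; clear; lia.
rewrite {m}m2 in hq.
have [rho [rhoq rho2 rho_fix [y y0 ry]]] := quadratic_involution (cst_nat_neq0 C0 char2) hq.
have rhophi r : rho (phi r) = phi r.
  have e : phi r = pullback q (pullback h r) by case: comm => _; apply.
  by rewrite e rhoq.
have ry' : rho y != y.
  rewrite ry eq_sym -addr_eq0 -mulr2n -mulr_natl mulf_eq0 (negPf y0) orbF.
  exact: cst_nat_neq0.
have [i rv] := order_two ztE' Hv rhophi rho2 (ex_intro _ y ry').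
set z := phi zt in rv sv.
have z0 : z != 0 := root3_neq0 phi ztE'.
have sz : sg z = z := sphi _.
exists b, c, (z ^+ i * v), sg, rho; split=> //.
- exact: (cardano_rotate ztE' Hv i).
- by rewrite rmorphM rmorphXn sz sv mulrCA.
- by rewrite rmorphM (rmorphXn rho) rhophi rv (reflection_of_rotated _ _ (root3X phi ztE') z0 (cardano_u0 Hv)).
- move=> g; rewrite -fix_tau; split=> [[y' ->]|/base[y' ->]]; [exact: tauf | by exists y'].
- move=> g; split=> [[y' ->]|/rho_fix[y' ->]]; [exact: rhoq | by exists y'].
Qed.

End S3Squares.

(** * Extending the hyperelliptic involution to the cover *)

Section KummerReflection.
Variables (K L : fieldType) (f : {rmorphism K -> L}) (iota : {rmorphism K -> K}).
Variables (tau : {rmorphism L -> L}) (u : L) (z a B : K).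
Hypotheses (u0 : u != 0) (ua : u ^+ 3 = f a) (aB : a * iota a = B ^+ 3).
Hypotheses (z3 : z ^+ 3 = 1) (iotaz : iota z = z) (iotaB : iota B = B).
Hypotheses (iota2 : forall y, iota (iota y) = y) (tauf : forall y, tau (f y) = f y).
Hypotheses (tauu : tau u = f z * u).
Hypothesis free : free_family f (fun i : 'I_3 => u ^+ i).
Hypothesis span : forall x, exists q : 'I_3 -> K, x = \sum_i f (q i) * u ^+ i.

Lemma kummer_minimal (P : {poly K}) :
  (size P < size ('X^3 - a%:P)%R)%N -> (map_poly f P).[u] = 0 -> P = 0.
Proof.
rewrite size_XnsubC // ltnS => sP; rewrite (horner_coef_wide (n := 3)) ?size_map_poly //.
under eq_bigr do rewrite coef_map.
move=> /free h; apply/polyP => i; rewrite coef0; have [i3|i3] := ltnP i 3.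
  exact: (h (Ordinal i3)).
by rewrite nth_default // (leq_trans sP).
Qed.

(** As iota a = (B/u)^3, iota extends by u -> B/u. The extension is an involution because iota fixes
    B, and it inverts tau because iota fixes z. *)
Lemma kummer_reflection : exists s : {rmorphism L -> L},
  [/\ forall y, s (f y) = f (iota y), forall x, s (s x) = x
    & forall x, s (tau x) = tau (tau (s x))].
Proof.
have gen := gen_of_powers span; have a0 : f a != 0 by rewrite -ua expf_neq0.
have [P|s [sf su]] := @hom_extend _ _ _ f (f \o iota) u (f B / u) gen.
- apply: (@minimal_kernel K L L f (f \o iota) ('X^3 - a%:P)).
  + by rewrite -size_poly_gt0 size_XnsubC.
  + by rewrite rmorphB /= map_polyXn map_polyC hornerD hornerN hornerXn hornerC ua subrr.
  + rewrite rmorphB /= map_polyXn map_polyC hornerD hornerN hornerXn hornerC /=.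
    by rewrite expr_div_n ua -(rmorphXn f) -aB (rmorphM f) mulrAC divff ?mul1r ?subrr.
  + exact: kummer_minimal.
have B0 : f B != 0.
  have : f (a * iota a) != 0 by rewrite (rmorphM f) mulf_neq0 // fmorph_eq0 fmorph_eq0 -(fmorph_eq0 f).
  by rewrite aB (rmorphXn f) expf_eq0.
have z30 : f z ^+ 3 = 1 by rewrite -(rmorphXn f) z3 rmorph1.
have fz0 : f z != 0 by apply/eqP => e; have /eqP := z30; rewrite e expr0n /= eq_sym oner_eq0.
exists s; split=> // x.
- apply: (@hom_eq_gen K L L f u (s \o s) idfun) => // [y|] /=; first by rewrite !sf /= iota2.
  by rewrite su fmorph_div sf /= iotaB su invf_div mulrCA divff ?mulr1.
- apply: (@hom_eq_gen K L L f u (s \o tau) (tau \o tau \o s)) => // [y|] /=.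
    by rewrite tauf sf !tauf.
  rewrite tauu (rmorphM s) sf /= iotaz su !fmorph_div !tauf tauu (rmorphM tau) tauf tauu.
  move: (f z) (f B) z30 fz0 => w b w3 w0; rewrite -[RHS]mul1r -w3; field.
  by rewrite w0 u0.
Qed.

End KummerReflection.

Section FromCover.
Variables (k : closedFieldType) (zk : k).
Hypotheses (zkE : zk ^+ 2 + zk + 1 = 0) (char3 : 3%:R != 0 :> k) (char2 : 2%:R != 0 :> k).

(** The orders of a and of its conjugate are divisible by 3. At p their sum is the order of N times
    the index of pi, which is 1 or 2 and can be cancelled. *)
Lemma norm_is_cube (X C : curve k) (f : mor X C) (pi : mor C (P1 k)) (u : ratfun X)
    (a : ratfun C) (iota : {rmorphism ratfun C -> ratfun C}) (N : ratfun (P1 k)) :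
  etale f -> has_dimension (pullback pi) (@full _) 2 ->
  (forall r, iota (pullback pi r) = pullback pi r) -> u != 0 -> u ^+ 3 = pullback f a ->
  a * iota a = pullback pi N -> exists t, N = t ^+ 3.
Proof.
move=> /etaleP et hpi iotap u0 ua NE.
have a0 : a != 0 := kummer_a0 u0 ua.
have N0 : N != 0 by rewrite -(fmorph_eq0 (pullback pi)) -NE mulf_neq0 ?fmorph_eq0.
have dvd p : (3 %| ord p a)%Z.
  by have [p' <-] := mor_surjective f p; apply: (kummer_dvd u0 ua); rewrite et.
have [I [IE _]] := mor_of_automorphism iotap.
apply: (P1_cube N0) => c; have [p pc] := mor_surjective pi (Some c : point (P1 k)).
have : (3 %| (ram pi p)%:Z * P1_ord (Some c) N)%Z.
  rewrite -[P1_ord _ _]/(ord (Some c : point (P1 k)) N) -pc -ramE // -NE.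
  rewrite (valM (ord_weak p)) ?fmorph_eq0 // -IE ramE // rpredD ?dvdz_mull //.
have := ram_le p hpi; have := ram_gt0 pi p.
case: (ram pi p) => [|[|[|//]]] // _ _; first by rewrite mul1r.
by rewrite Gauss_dvdzr.
Qed.

Lemma square_simply_branched (X C C0 : curve k) (f : mor X C) (pi : mor C (P1 k))
    (q : mor X C0) (h : mor C0 (P1 k)) :
  mor_eq (mor_comp pi f) (mor_comp h q) -> etale f ->
  has_dimension (pullback pi) (@full _) 2 -> has_dimension (pullback h) (@full _) 3 ->
  simply_branched h.
Proof.
move=> comm /etaleP et hpi hh; apply: (simply_branched_intro hh) => p0.
have [p <-] := mor_surjective q p0; apply: leq_trans (ram_le (f p) hpi).
have := eq_ram p comm; rewrite !ram_comp et mul1n => ->.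
by rewrite leq_pmull // ram_gt0.
Qed.

Lemma related_of_cover g n (E : triple_cover k g) : g = n.+1 ->
  exists h : simple_triple_map k n, S3_related E h.
Proof.
move=> gn; case: E => X C f et gal gen hyp.
have [pi /has_degreeP hpi] := hyp; have [hf [tau [tauf tau3 tx]]] := Z3_automorphism gal.
have zC := cst_root3 zkE C; have three := cst_nat_neq0 C char3.
have [u [u0 tu ufree uspan ufix]] := cyclic_cubic zC three hf tauf tau3 tx.
have [a ua] : exists a, u ^+ 3 = pullback f a.
  apply: ufix; rewrite (rmorphXn tau) tu exprMn.
  by rewrite (root3X (pullback f) zC) mul1r.
have [iota [iotap iota2 iotafix _]] := quadratic_involution (cst_nat_neq0 (P1 k) char2) hpi.
have [N NE] : exists N, a * iota a = pullback pi N.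
  by apply: iotafix; rewrite (rmorphM iota) iota2 mulrC.
have [t tE] := norm_is_cube et hpi iotap u0 ua NE.
have aB : a * iota a = pullback pi t ^+ 3 by rewrite NE tE (rmorphXn (pullback pi)).
have z3 : cst C zk ^+ 3 = 1 := root3X (cst C) zkE.
have iotaz : iota (cst C zk) = cst C zk by rewrite -(pullback_P1_const pi) iotap.
have iotaB := iotap t.
have [s [sf s2 st]] := kummer_reflection u0 ua aB z3 iotaz iotaB iota2 tauf tu ufree uspan.
pose phi := pullback (mor_comp pi f).
have tauphi r : tau (phi r) = phi r by apply: tauf.
have sphi r : s (phi r) = phi r by rewrite /phi /= sf iotap.
have h6 : has_dimension phi (@full _) 6 := dimension_tower hpi hf.
have [b [c [v [Hv tv sv]]]] := s3_cardano (ztE zkE) (three_P1 char3) tauphi sphi h6 tau3 s2 st tx.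
have [C0 [q [h [comm imq]]]] := fixed_curve sphi.
have comm' : mor_eq (mor_comp pi f) (mor_comp h q).
  by case: comm => e1 e2; split=> x; rewrite ?e1 ?e2.
have sq : s3_square zk f pi q h b c v tau s.
  by split=> // x; split=> [[y ->]|/ufix[y ->]]; [apply: tauf | exists y].
have [_ _ _ hh] := s3_square_degrees zkE char3 sq.
have sb := square_simply_branched comm' et hpi hh.
have gC0 : has_genus C0 n by apply/(s3_square_genus zkE char3 n sq et); rewrite -gn.
exists (SimpleTripleMap (proj2 (has_degreeP h 3) hh) sb gC0), pi, q; split=> //.
exact: (S3_galois (ztE zkE) (three_P1 char3) Hv).
Qed.

End FromCover.

(** A fixed element outside K would generate L over K, and s would be trivial. *)
Lemma quadratic_fixed (K L : fieldType) (psi : {rmorphism K -> L}) (s : {rmorphism L -> L}) :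
  has_dimension psi (@full L) 2 -> (forall y, s (psi y) = psi y) -> (exists x, s x != x) ->
  forall x, s x = x -> exists y, x = psi y.
Proof.
move=> h2 spsi [y sy] x sx; apply: contrapT => nx; case/negP: sy; apply/eqP.
have fr : free_family psi (fun i : bool => if i then x else 1).
  move=> r; rewrite big_bool /= mulr1 => e.
  have r1 : r true = 0.
    apply/eqP/negPn/negP => r1; apply: nx; exists (- r false / r true).
    have p1 : psi (r true) != 0 by rewrite fmorph_eq0.
    apply: (mulfI p1); rewrite fmorph_div rmorphN mulrCA divff // mulr1.
    by apply/eqP; rewrite -addr_eq0 e.
  move: e; rewrite r1 rmorph0 mul0r add0r => /eqP; rewrite fmorph_eq0 => /eqP r0.
  by case.
have yI : full y by [].
have [r ->] := free_span (subspace_full psi) h2 card_bool fr (fun _ => I) yI.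
rewrite big_bool /= mulr1.
by rewrite rmorphD rmorphM !spsi sx.
Qed.

(** * From a simply branched triple map to a cover *)

Section FromTripleMap.
Variables (k : closedFieldType) (zk : k).
Hypotheses (zkE : zk ^+ 2 + zk + 1 = 0) (char3 : 3%:R != 0 :> k) (char2 : 2%:R != 0 :> k).

Lemma resolvent_irreducible (C0 : curve k) (h : mor C0 (P1 k)) w b c :
  has_dimension (pullback h) (@full _) 3 -> simply_branched h ->
  ~ (exists a, w = pullback h a) ->
  w ^+ 3 = 3%:R * pullback h b * w + pullback h c ->
  forall r, r ^+ 2 - w * r + pullback h b <> 0.
Proof.
move=> hh sb nw w3 r re; have [u [u0 wE]] : exists u, u != 0 /\ w = u + pullback h b / u.
  (* A nonzero root r is itself the required u. For r = 0 one has b = 0, and u = w serves. *)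
  have [r0|r0] := eqVneq r 0; last first.
    exists r; split=> //; apply: (mulIf r0); rewrite mulrDl divfK //.
    by apply/eqP; rewrite eq_sym -subr_eq0 -re; apply/eqP; ring.
  have hb : pullback h b = 0 by rewrite -re r0; ring.
  exists w; rewrite hb mul0r addr0; split=> //; apply/eqP => w0; apply: nw.
  by exists 0; rewrite w0 rmorph0.
have a2 : (u ^+ 3) ^+ 2 = pullback h (- b ^+ 3) + pullback h c * u ^+ 3.
  have -> : pullback h c = w ^+ 3 - 3%:R * pullback h b * w by rewrite w3; ring.
  by rewrite rmorphN (rmorphXn (pullback h)) wE; move: (pullback h b) => B; field.
(* u^3 satisfies a quadratic equation over F, which in an extension of degree three forces it into
   F. *)
have [a ua] : exists a, u ^+ 3 = pullback h a.
  by apply: contrapT => na; apply: (cubic_no_quadratic hh na a2).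
have a0 : a != 0 := kummer_a0 u0 ua.
have [t tE] : exists t, a = t ^+ 3.
  apply: (P1_cube a0) => e; have [p pe] := mor_surjective h (Some e : point (P1 k)).
  have := kummer_dvd u0 ua (p := p); rewrite pe; apply.
  by case: (simply_branched_ram sb p) => ->.
have [i uE] : exists i : 'I_3, u = pullback h (P1_cst k zk) ^+ i * pullback h t.
  by apply: (cube_roots _ (ztE zkE)); rewrite ua tE (rmorphXn (pullback h)).
apply: nw; exists (P1_cst k zk ^+ i * t + b / (P1_cst k zk ^+ i * t)).
rewrite (rmorphD (pullback h)) (fmorph_div (pullback h)) (rmorphM (pullback h)).
by rewrite (rmorphXn (pullback h)) -uE.
Qed.

(** Where 3 divides the order of a = u^3, [kummer_unramified] applies. Elsewhere 3 would divide the
    index of f and hence that of the diagonal, a product of indices of q and h that are each 1 or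
    2. *)
Lemma square_etale (X C C0 : curve k) (f : mor X C) (pi : mor C (P1 k)) (q : mor X C0)
    (h : mor C0 (P1 k)) b c u sigma s :
  s3_square zk f pi q h b c u sigma s -> simply_branched h -> etale f.
Proof.
move=> sq sb; have [hf hq _ _] := s3_square_degrees zkE char3 sq.
case: sq => comm Hu sphi tphi su tu imf imq; have u0 := cardano_u0 Hu.
have sf y : sigma (pullback f y) = pullback f y by apply/imf; exists y.
have z3 := root3X (pullback (mor_comp pi f)) (ztE zkE).
have [a ua] : exists a, u ^+ 3 = pullback f a.
  by apply/imf; rewrite (rmorphXn sigma) su exprMn z3 mul1r.
have [S [SE Sdeck]] := mor_of_automorphism sf.
apply/etaleP => p; have [d|d] := boolP (3 %| ord (f p) a)%Z.
  apply: (kummer_unramified u0 ua zkE char3 Sdeck _ hf d).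
  rewrite SE su; congr (_ * _); exact: (pullback_P1_const (mor_comp pi f) zk).
have : ~~ coprime 3 (ram f p) by apply/negP => /(kummer_dvd u0 ua); apply/negP.
rewrite prime_coprime // negbK => r3.
have : (3 %| ram f p * ram pi (f p))%N by apply: dvdn_mulr.
rewrite -ram_comp (eq_ram p comm) ram_comp.
have := ram_le p hq; have := ram_gt0 q p.
by case: (ram q p) => [|[|[|//]]] // _ _; case: (simply_branched_ram sb (q p)) => ->.
Qed.

Lemma cover_of_triple_map g n (h : simple_triple_map k n) : g = n.+1 ->
  exists E : triple_cover k g, S3_related E h.
Proof.
move=> gn; case: h => C0 h hdeg sb gC0; have hh := proj1 (has_degreeP h 3) hdeg.
have ztE' := ztE zkE; have three := three_P1 char3.
have [w [b [c [nw w3]]]] := depressed_cubic hh three.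
have irr := resolvent_irreducible hh sb nw w3.
have [L [psi [u [Hu u0 wE h2]]]] := cubic_closure hh (cst_nat_neq0 (P1 k) char2) nw w3 irr.
have ffL : function_field (psi \o cst C0 : {rmorphism k -> L}).
  by apply: (function_field_up (phi := psi) _ (curve_function_field C0)) => //; exists 2.
pose X := curve_of_field ffL.
have [|q qE] := @mor_of_hom k X C0 psi; first by [].
have gE : psi \o pullback h =1 pullback (mor_comp h q) by move=> r; rewrite /= qE.
have {}Hu : cardano (pullback (mor_comp h q)) b c (u : ratfun X) := cardano_eq_hom gE Hu.
have [sigma [sg su]] := cardano_aut_rotation ztE' Hu 1.
have [s [tg tu]] := cardano_aut_reflection ztE' Hu 0.
rewrite expr1 in su; rewrite expr0 mul1r in tu.
have snt : exists x, s x != x by exists u; apply: (cardano_s_neq ztE' three sg Hu su tu).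
have wE' : pullback q w = u + pullback (mor_comp h q) b / u by rewrite -gE qE.
(* s exchanges u and b/u, so it fixes w and therefore the whole image of k(C_0) = F(w). *)
have tw : s (pullback q w) = pullback q w.
  rewrite wE' (rmorphD s) fmorph_div tu tg invf_div addrC; congr (_ + _).
  by rewrite mulrCA divff ?mulr1 // fmorph_eq0 (cardano_b Hu).
have tq y : s (pullback q y) = pullback q y.
  have [p0 [p1 [p2 ->]]] := cubic_generator_span hh nw y.
  rewrite 2!(rmorphD (pullback q)) 2!(rmorphM (pullback q)) (rmorphXn (pullback q)).
  by rewrite 2!(rmorphD s) 2!(rmorphM s) (rmorphXn s) tw !tg.
have hq : has_dimension (pullback q) (@full (ratfun X)) 2 by rewrite qE.
have imq x : (exists y, x = pullback q y) <-> s x = x.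
  by split=> [[y ->]//|]; apply: (quadratic_fixed hq tq snt).
have [C [f [pi [comm imf]]]] := fixed_curve sg.
have Hu' := cardano_eq_hom (fun r => esym (proj2 comm r)) Hu.
have sq : s3_square zk f pi q h b c (u : ratfun X) sigma s.
  by split=> // [r|r||]; rewrite (proj2 comm).
have [hf _ hpi _] := s3_square_degrees zkE char3 sq.
have et := square_etale sq sb.
have gC : has_genus C g by rewrite gn; apply/(s3_square_genus zkE char3 n sq et).
have sf y : sigma (pullback f y) = pullback f y by apply/imf; exists y.
have sigma3 := cardano_sigma3 ztE' sg Hu su.
have snt' : exists x, sigma x != x.
  exists u; rewrite su -subr_eq0 -{2}[u]mul1r -mulrBl mulf_neq0 // subr_eq0.
  exact: (root3_neq1 (pullback (mor_comp h q)) ztE' three).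
have gal := Z3_galois (cst_root3 zkE C) (cst_nat_neq0 C char3) hf sf sigma3 snt'.
have hyp : hyperelliptic C by exists pi; apply/has_degreeP.
exists (TripleCover et gal gC hyp), pi, q; split=> //.
exact: (S3_galois ztE' three Hu').
Qed.

End FromTripleMap.

(** The roots have sum 0, and x^2 + x y + y^2 = 3 be. So U = (x + z y + z^2 t) / 3 and V = (x + z^2
    y + z t) / 3 satisfy U + V = x and U V = be, whence U^3 + V^3 = ga. *)
Lemma lagrange_resolvent (L : fieldType) (z x y t be ga : L) :
  z ^+ 2 + z + 1 = 0 -> 3%:R != 0 :> L -> x != y -> y != t -> x != t ->
  x ^+ 3 = 3%:R * be * x + ga -> y ^+ 3 = 3%:R * be * y + ga -> t ^+ 3 = 3%:R * be * t + ga ->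
  exists U, U ^+ 6 - ga * U ^+ 3 + be ^+ 3 = 0.
Proof.
move=> zE n3 xy yt xt ex ey et.
have pair a e : a != e -> a ^+ 3 = 3%:R * be * a + ga -> e ^+ 3 = 3%:R * be * e + ga ->
    a ^+ 2 + a * e + e ^+ 2 = 3%:R * be.
  move=> ae ea ee; have ae0 : a - e != 0 by rewrite subr_eq0.
  apply: (mulfI ae0); transitivity (a ^+ 3 - e ^+ 3); first by ring.
  by rewrite ea ee; ring.
have exy := pair _ _ xy ex ey; have eyt := pair _ _ yt ey et.
have tE : t = - x - y.
  have xt0 : x - t != 0 by rewrite subr_eq0.
  apply: (mulfI xt0); apply/eqP; rewrite -subr_eq0; apply/eqP.
  transitivity ((x ^+ 2 + x * y + y ^+ 2) - (y ^+ 2 + y * t + t ^+ 2)); first by ring.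
  by rewrite exy eyt subrr.
have z2 : z ^+ 2 = - z - 1 by apply/eqP; rewrite -subr_eq0 -zE; apply/eqP; ring.
pose U := (x + z * y + z ^+ 2 * t) / 3%:R; pose V := (x + z ^+ 2 * y + z * t) / 3%:R.
have UV : U * V = be.
  apply: (mulfI (mulf_neq0 n3 n3)).
  transitivity ((x + z * y + z ^+ 2 * t) * (x + z ^+ 2 * y + z * t)).
    by rewrite /U /V; field.
  transitivity (3%:R * (x ^+ 2 + x * y + y ^+ 2)); last by rewrite exy; ring.
  rewrite tE z2; transitivity ((z ^+ 2 + z + 1) * - (x + y *+ 2) ^+ 2 +
     3%:R * (x ^+ 2 + x * y + y ^+ 2)); first by ring.
  by rewrite zE mul0r add0r.
have UVx : U + V = x.
  apply: (mulfI n3); transitivity (x *+ 2 - y - t + (z ^+ 2 + z + 1) * (y + t)).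
    by rewrite /U /V; field.
  by rewrite zE tE; ring.
exists U; rewrite -UV.
have -> : ga = U ^+ 3 + V ^+ 3.
  have -> : ga = x ^+ 3 - 3%:R * be * x by rewrite ex; ring.
  by rewrite -UVx -UV; ring.
ring.
Qed.

Lemma dimension_surjective (F K : fieldType) (theta : {rmorphism F -> K}) :
  (forall y, exists x, theta x = y) -> has_dimension theta (@full K) 1.
Proof.
move=> surj; rewrite -card_unit.
apply: (dimension_intro (b := fun _ : unit => 1)) => // [c|f _].
  by rewrite (bigD1 tt) //= big1 => [|[]//]; rewrite addr0 mulr1 => /eqP; rewrite fmorph_eq0 => /eqP c0 [].
have [x <-] := surj f; exists (fun=> x).
by rewrite (bigD1 tt) //= big1 => [|[]//]; rewrite addr0 mulr1.
Qed.

Lemma galois_with_base_change (G : finGroupType) (k : closedFieldType) (X Y Y' : curve k)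
    (u : mor X Y) (v : mor X Y') (theta : {rmorphism ratfun Y' -> ratfun Y}) :
  (forall y, exists x, theta x = y) -> (forall x, pullback v x = pullback u (theta x)) ->
  galois_with G u -> galois_with G v.
Proof.
move=> surj vE /galois_with_automorphisms[hu [R [Ru RM Ri Rs]]].
apply/galois_with_automorphisms; split.
  apply: (@eq_dimension_hom _ _ (pullback u \o theta)) => [x|]; first by rewrite vE.
  by rewrite -[#|G|]mul1n; apply: dimension_tower (dimension_surjective surj) hu.
exists R; split=> // [a y|tau tv]; first by rewrite vE.
by apply: Rs => y; have [x <-] := surj y; rewrite -vE.
Qed.

Lemma iso_pullback_surjective (k : closedFieldType) (X Y : curve k) (u : mor X Y) :
  is_iso u -> forall x, exists y, pullback u y = x.
Proof. by move=> /iso_pullback[v [_ K]] x; exists (pullback v x). Qed.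

(** * Isomorphisms of covers against isomorphisms of triple maps *)

Section Uniqueness.
Variables (k : closedFieldType) (zk : k).
Hypotheses (zkE : zk ^+ 2 + zk + 1 = 0) (char3 : 3%:R != 0 :> k) (char2 : 2%:R != 0 :> k).
Variables (X C C0 X' C' C0' : curve k).
Variables (f : mor X C) (pi : mor C (P1 k)) (q : mor X C0) (h : mor C0 (P1 k)).
Variables (f' : mor X' C') (pi' : mor C' (P1 k)) (q' : mor X' C0') (h' : mor C0' (P1 k)).
Variables (b c b' c' : ratfun (P1 k)) (u : ratfun X) (u' : ratfun X').
Variables (sigma s : {rmorphism ratfun X -> ratfun X}).
Variables (sigma' s' : {rmorphism ratfun X' -> ratfun X'}).
Hypotheses (sq : s3_square zk f pi q h b c u sigma s).
Hypotheses (sq' : s3_square zk f' pi' q' h' b' c' u' sigma' s').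
Let phi := pullback (mor_comp pi f).
Let phi' := pullback (mor_comp pi' f').

Lemma hyperelliptic_base (B : mor C C') g : has_genus C g -> (2 <= g)%N -> is_iso B ->
  exists theta : {rmorphism ratfun (P1 k) -> ratfun (P1 k)},
    (forall r, pullback pi (theta r) = pullback B (pullback pi' r)) /\
    forall r, exists r', theta r' = r.
Proof.
move=> gC g2 /iso_pullback_surjective Bs.
have [_ _ hpi _] := s3_square_degrees zkE char3 sq.
have [_ _ hpi' _] := s3_square_degrees zkE char3 sq'.
have hpB : has_dimension (pullback (mor_comp pi' B)) (@full _) 2.
  exact: (dimension_tower hpi' (dimension_surjective Bs)).
have [theta thE] := hom_factor (degree_two_subfield gC g2 hpi hpB).
exists theta; split=> // r; have [r' rE] := degree_two_subfield gC g2 hpB hpi r.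
by exists r'; apply: (fmorph_inj (pullback pi)); rewrite thE rE.
Qed.

(** The involution s' transported to X is a reflection, hence conjugate to s by a rotation rho;
    following the transport by rho carries k(C_0') onto k(C_0). *)
Lemma triple_map_iso (A : mor X X') (B : mor C C') g : has_genus C g -> (2 <= g)%N ->
  is_iso A -> is_iso B -> mor_eq (mor_comp f' A) (mor_comp B f) -> cover_iso h h'.
Proof.
move=> gC g2 /iso_pullback[A' [AK KA]] Bi [_ AB].
have [theta [thE ths]] := hyperelliptic_base gC g2 Bi.
have [_ _ _ hh] := s3_square_degrees zkE char3 sq.
have [_ _ _ hh'] := s3_square_degrees zkE char3 sq'.
have ztE' := ztE zkE; have three := three_P1 char3.
case: sq => comm Hu sphi tphi su tu imf imq.
case: sq' => comm' Hu' sphi' tphi' su' tu' imf' imq'.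
pose al : {rmorphism _ -> _} := pullback A.
have alphi r : al (phi' r) = phi (theta r).
  by rewrite /al /phi /phi' /= [LHS]AB /= thE.
have als y : exists x, al x = y by exists (pullback A' y); apply: KA.
have [s2 s2al] : exists s2 : {rmorphism ratfun X -> ratfun X}, forall x, s2 (al x) = al (s' x).
  by exists (al \o s' \o pullback A') => x /=; rewrite /al AK.
have s2phi r : s2 (phi r) = phi r.
  by have [r' <-] := ths r; rewrite -alphi s2al tphi'.
have s22 x : s2 (s2 x) = x.
  by have [y <-] := als x; rewrite !s2al (cardano_s2 tphi' Hu' tu').
have s2n : exists x, s2 x != x.
  exists (al u'); rewrite s2al (inj_eq (fmorph_inj al)).
  exact: (cardano_s_neq ztE' three sphi' Hu' su' tu').
have [i s2u] := order_two ztE' Hu s2phi s22 s2n.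
(* For s2 u = z^i b / u, conjugation by u -> z^(2 i) u absorbs the power of z: rho s2 u = z^(-i) b /
   u = z^(2 i) b / u = s rho u. *)
have [rho [rphi ru]] := cardano_aut_rotation ztE' Hu (2 * i).
have rsphi r : rho (s2 (phi r)) = s (rho (phi r)) by rewrite s2phi rphi tphi.
have rsu : rho (s2 u) = s (rho u).
  rewrite s2u ru !(rmorphM rho) (rmorphM s) (rmorphXn rho) (rmorphXn s) fmorphV.
  rewrite !rphi tphi tu ru.
  have := root3X phi ztE'; have := root3_neq0 phi ztE'; have := cardano_u0 Hu.
  move: (phi (P1_cst k zk)) (phi b) => w B0 u0 w0 w3.
  have wi0 := expf_neq0 i w0; have wi3 : (w ^+ i) ^+ 3 = 1 by rewrite -exprM mulnC exprM w3 expr1n.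
  rewrite mulnC exprM; move: (w ^+ i) wi0 wi3 => v v0 v3.
  rewrite -[LHS]mul1r -v3; field.
  by rewrite v0 u0.
have rs x : rho (s2 x) = s (rho x).
  by apply: (@hom_eq_gen _ _ _ phi u (rho \o s2) (s \o rho)) => //; apply: cardano_gen' Hu.
have [y|Lam LamE] := @hom_factor _ _ _ (pullback q) (rho \o al \o pullback q').
  apply/imq; rewrite -rs s2al; congr (rho (al _)); apply/imq'; by exists y.
have LamE' x : pullback q (Lam x) = rho (al (pullback q' x)) := LamE x.
have qh r : pullback q (pullback h r) = phi r by rewrite [RHS](proj2 comm).
have qh' r : pullback q' (pullback h' r) = phi' r by rewrite [RHS](proj2 comm').
have Lamh r : Lam (pullback h' r) = pullback h (theta r).
  by apply: (fmorph_inj (pullback q)); rewrite LamE' qh' alphi rphi qh.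
have thcst a : theta (cst (P1 k) a) = cst (P1 k) a.
  by apply: (fmorph_inj (pullback pi)); rewrite thE !pullback_cst.
have Lamcst a : Lam (cst C0' a) = cst C0 a by rewrite -(pullback_cst h') Lamh thcst pullback_cst.
have Lams := semilinear_surjective Lamh ths hh' hh.
have [a aE] := @mor_of_hom _ C0 C0' Lam Lamcst.
have [t tE] := @mor_of_hom _ (P1 k) (P1 k) theta thcst.
exists a, t; split.
- by apply: iso_of_pullback; rewrite aE.
- by apply: iso_of_pullback; rewrite tE.
- by apply: mor_ext => r /=; rewrite aE tE.
Qed.

(** Otherwise u' would be a root of X^2 - r X + b', against the independence of its powers below the
    sixth. *)
Lemma resolvent_not_rational r : u' + phi' b' / u' <> phi' r.
Proof.
case: sq' => comm' Hu' sphi' tphi' su' tu' imf' imq' e; have u0 := cardano_u0 Hu'.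
pose P : {poly ratfun (P1 k)} := 'X^2 - r *: 'X + b'%:P.
have sP : size P = 3%N.
  rewrite /P -addrA size_polyDl size_polyXn // ltnS.
  apply: leq_trans (size_polyD _ _) _; rewrite geq_max size_polyN.
  by rewrite (leq_trans (size_scale_leq _ _)) ?size_polyX // (leq_trans (size_polyC_leq1 _)).
have P0 : P = 0.
  apply: (cardano_free Hu'); rewrite ?sP //.
  rewrite /P rmorphD rmorphB /= map_polyXn map_polyC map_polyZ map_polyX.
  rewrite !(hornerD, hornerN, hornerXn, hornerC, hornerZ, hornerX) -e.
  by rewrite -/phi'; field.
by have := sP; rewrite P0 size_poly0.
Qed.

(** The image x in k(X) of a root of the cubic of h' and its conjugates under sigma are three roots
    of the transported cubic. Their Lagrange resolvent solves the transported sextic, which defines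
    [chi] from k(X') to k(X). It carries sigma' to an automorphism of order three, with the same
    fixed field as sigma, and so identifies k(C') with k(C). *)
Lemma triple_cover_iso (a : mor C0 C0') (t : mor (P1 k) (P1 k)) :
  is_iso a -> is_iso t -> mor_eq (mor_comp h' a) (mor_comp t h) -> cover_iso f f'.
Proof.
move=> ai ti [_ at_]; have ts := iso_pullback_surjective ti.
have as_ := iso_pullback_surjective ai.
pose theta := pullback t; pose Lam := pullback a.
have Lamh r : Lam (pullback h' r) = pullback h (theta r) by apply: at_.
have nrat := resolvent_not_rational.
case: sq => comm Hu sphi tphi su tu imf imq.
case: sq' => comm' Hu' sphi' tphi' su' tu' imf' imq'.
have qh r : pullback q (pullback h r) = phi r by rewrite [RHS](proj2 comm).
have qh' r : pullback q' (pullback h' r) = phi' r by rewrite [RHS](proj2 comm').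
have ztE' := ztE zkE; have three := three_P1 char3.
have u0' := cardano_u0 Hu'; have b0' : phi' b' != 0 by rewrite fmorph_eq0 (cardano_b Hu').
have [w0 wE] : exists w0, u' + phi' b' / u' = pullback q' w0.
  apply/imq'; rewrite (rmorphD s') fmorph_div tu' tphi' -/phi' invf_div addrC; congr (_ + _).
  by rewrite mulrCA divff ?mulr1.
have w3 : w0 ^+ 3 = 3%:R * pullback h' b' * w0 + pullback h' c'.
  apply: (fmorph_inj (pullback q')).
  rewrite (rmorphXn (pullback q')) (rmorphD (pullback q')) !(rmorphM (pullback q')).
  rewrite rmorph_nat !qh' -wE (cardano_c Hu') -/phi'; move: (phi' b') => B; field.
  by [].
pose x := pullback q (Lam w0).
have x3 : x ^+ 3 = 3%:R * phi (theta b') * x + phi (theta c').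
  rewrite /x -(rmorphXn (pullback q)) -(rmorphXn Lam) w3 (rmorphD Lam) !(rmorphM Lam).
  rewrite (rmorphD (pullback q)) !(rmorphM (pullback q)).
  by rewrite !(rmorph_nat Lam) !rmorph_nat !Lamh !qh.
have sx3 y : y ^+ 3 = 3%:R * phi (theta b') * y + phi (theta c') ->
    sigma y ^+ 3 = 3%:R * phi (theta b') * sigma y + phi (theta c').
  move/(congr1 sigma); rewrite (rmorphXn sigma) (rmorphD sigma) !(rmorphM sigma).
  by rewrite rmorph_nat !sphi.
have sigma3 := cardano_sigma3 ztE' sphi Hu su.
(* The conjugates of x must be distinct. If sigma fixed x, then x, being fixed by s too, would lie
   in F, against [resolvent_not_rational]. *)
have xs : sigma x != x.
  apply/eqP => sx; have tx : s x = x by apply/imq; exists (Lam w0).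
  have [r xr] := cardano_fixed ztE' three sphi tphi Hu su tu sx tx.
  have [r' rE] := ts r; apply: (nrat r'); rewrite wE -qh'; congr (pullback q' _).
  apply: (fmorph_inj Lam); apply: (fmorph_inj (pullback q)).
  by rewrite Lamh qh -/x xr -rE.
have z1 := root3Z phi ztE'.
have [|||U UE] := lagrange_resolvent z1 (three_neq0 phi three) _ _ _ x3 (sx3 _ x3) (sx3 _ (sx3 _ x3)).
- by rewrite eq_sym.
- by rewrite (inj_eq (fmorph_inj sigma)) eq_sym.
- by apply/eqP => e; have := sigma3 x; rewrite -e; apply/eqP.
have [chi [chiphi chiu]] := cardano_hom Hu' (psi := phi \o theta) UE.
have chi_phi r : chi (phi' r) = phi (theta r) := chiphi r.
have chis := semilinear_surjective chi_phi ts (cardano_dimension Hu') (cardano_dimension Hu).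
have [chi' [chiK Kchi]] := hom_bij_inverse chis.
have [tau tauchi] : exists tau : {rmorphism ratfun X -> ratfun X},
    forall y, tau (chi y) = chi (sigma' y).
  by exists (chi \o sigma' \o chi') => y /=; rewrite chiK.
have tauphi r : tau (phi r) = phi r.
  by have [r' <-] := ts r; rewrite -chi_phi tauchi sphi'.
have tau3 y : tau (tau (tau y)) = y.
  have [y' <-] := chis y; rewrite !tauchi.
  by rewrite (cardano_sigma3 ztE' sphi' Hu' su').
have taun : exists y, tau y != y.
  exists (chi u'); rewrite tauchi (inj_eq (fmorph_inj chi)) su' -subr_eq0 -{2}[u']mul1r -mulrBl.
  by rewrite mulf_neq0 // subr_eq0 (root3_neq1 phi' ztE' three).
have fix_tau := order_three ztE' Hu tauphi sphi su tau3 taun.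
have [y|mu muE] := @hom_factor _ _ _ (pullback f) (chi \o pullback f').
  by apply/imf; rewrite -fix_tau /= tauchi; congr (chi _); apply/imf'; exists y.
have muE' y : pullback f (mu y) = chi (pullback f' y) := muE y.
have mus y : exists y', mu y' = y.
  have [y' yE] := chis (pullback f y).
  have [v vE] : exists v, y' = pullback f' v.
    by apply/imf'; apply: (fmorph_inj chi); rewrite -tauchi yE; apply/fix_tau/imf; exists y.
  by exists v; apply: (fmorph_inj (pullback f)); rewrite muE' -vE.
have phicst e : phi (cst (P1 k) e) = cst X e := pullback_cst (mor_comp pi f) e.
have phicst' e : phi' (cst (P1 k) e) = cst X' e := pullback_cst (mor_comp pi' f') e.
have chicst e : chi (cst X' e) = cst X e.
  by rewrite -phicst' chi_phi (pullback_cst t) phicst.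
have mucst e : mu (cst C' e) = cst C e.
  by apply: (fmorph_inj (pullback f)); rewrite muE' !pullback_cst chicst.
have [A AE] := @mor_of_hom _ X X' chi chicst; have [B BE] := @mor_of_hom _ C C' mu mucst.
exists A, B; split.
- by apply: iso_of_pullback; rewrite AE.
- by apply: iso_of_pullback; rewrite BE.
- by apply: mor_ext => r /=; rewrite AE BE.
Qed.

End Uniqueness.

Section Correspondence.
Variables (k : closedFieldType) (zk : k).
Hypotheses (zkE : zk ^+ 2 + zk + 1 = 0) (char3 : 3%:R != 0 :> k) (char2 : 2%:R != 0 :> k).
Variables (g n : nat).
Implicit Types (E : triple_cover k g) (h : simple_triple_map k n).

Lemma related_square E h : S3_related E h -> exists pi q b c u sigma s,
  s3_square zk (cover_map E) pi q (triple_map h) b c u sigma s.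
Proof.
move=> [pi [q [comm gal]]]; exists pi, q.
apply: (s3_square_exists zkE char3 char2 comm gal (cover_cyclic E)).
exact/has_degreeP/triple_degree.
Qed.

Lemma related_cover_iso E E' h h' : (2 <= g)%N -> S3_related E h -> S3_related E' h' ->
  cover_iso (cover_map E) (cover_map E') <-> cover_iso (triple_map h) (triple_map h').
Proof.
move=> g2 /related_square[pi [q [b [c [u [sigma [s sq]]]]]]].
move=> /related_square[pi' [q' [b' [c' [u' [sigma' [s' sq']]]]]]].
split=> [[A [B [Ai Bi AB]]]|[a [t [ai ti at_]]]].
  exact: (triple_map_iso zkE char3 sq sq' (cover_base_genus E) g2 Ai Bi AB).
exact: (triple_cover_iso zkE char3 sq sq' ai ti at_).
Qed.

(** Compose the square with a and t: the diagonal changes by an automorphism of the projective line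
    and stays Galois with the same group. *)
Lemma related_iso E h h' : S3_related E h -> cover_iso (triple_map h) (triple_map h') ->
  S3_related E h'.
Proof.
move=> [pi [q [comm gal]]] [a [t [ai ti at_]]].
exists (mor_comp t pi), (mor_comp a q); split; last first.
  exact: (@galois_with_base_change _ _ _ _ _ _ _ (pullback t) (iso_pullback_surjective ti) _ gal).
apply: mor_ext => r /=; have e := proj2 at_ r; have e' := proj2 comm (pullback t r).
by rewrite /= in e e'; rewrite e e'.
Qed.

Lemma cover_iso_refl (X Y : curve k) (u : mor X Y) : cover_iso u u.
Proof.
by exists (mor_id X), (mor_id Y); split=> //; [exists (mor_id X)|exists (mor_id Y)].
Qed.

End Correspondence.

Theorem proposition4p2 (k : closedFieldType) (k_char0 : [pchar k]%R =i pred0)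
    (g n : nat) (hg : (2 <= g)%N) (hn : n = (g - 1)%N) :
  exists Phi : triple_cover k g -> simple_triple_map k n,
    [/\ forall E E' : triple_cover k g,
          cover_iso (cover_map E) (cover_map E') <->
          cover_iso (triple_map (Phi E)) (triple_map (Phi E')),
        forall h : simple_triple_map k n,
          exists E : triple_cover k g,
            cover_iso (triple_map (Phi E)) (triple_map h)
      & forall (E : triple_cover k g) (h : simple_triple_map k n),
          S3_related E h <-> cover_iso (triple_map (Phi E)) (triple_map h)].
Proof.
have char3 : 3%:R != 0 :> k by have /pcharf0P -> := k_char0.
have char2 : 2%:R != 0 :> k by have /pcharf0P -> := k_char0.
have [zk zkE] : exists z : k, z ^+ 2 + z + 1 = 0.
  have /closed_rootP[z zE] : size ('X^2 + 'X + 1%:P : {poly k}) != 1%N.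
    by rewrite -addrA size_polyDl ?size_polyXn // size_polyDl size_polyX ?size_polyC ?oner_eq0.
  by exists z; move: zE; rewrite /root !hornerE => /eqP.
have gn : g = n.+1 by rewrite hn; move: hg; clear; lia.
(* [Phi E] is any triple map related to E. By [key] its isomorphism class depends only on that of E,
   so the choice does no harm. *)
have /choice[Phi PhiE] E := related_of_cover zkE char3 char2 E gn.
have key E E' h h' := @related_cover_iso k zk zkE char3 char2 g n E E' h h' hg.
exists Phi; split=> [E E'|h|E h].
- exact: (key _ _ _ _ (PhiE E) (PhiE E')).
- have [E Eh] := cover_of_triple_map zkE char3 char2 h gn; exists E.
  by apply/(key _ _ _ _ (PhiE E) Eh); apply: cover_iso_refl.
- split=> [Eh|]; last exact: related_iso (PhiE E).
  by apply/(key _ _ _ _ (PhiE E) Eh); apply: cover_iso_refl.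
Qed.
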